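(* C-Cons-Del (under the Plurality rule) with a symmetric bundling function and bundles of size at most two can be solved in polynomial time.
   Context: An election $(C,V)$: finite candidate set $C$, finite voter set $V$, each voter with one favorite candidate; $s_c(X)$ is the number of voters in $X$ with favorite $c$; $c$ is a (Plurality) winner if $s_c(V)\ge s_{c'}(V)$ for all $c'$. A bundling function on $V$ is $\kappa:V\to2^V$ with $v\in\kappa(v)$; $\kappa(V')=\bigcup_{v\in V'}\kappa(v)$; symmetric means for distinct $x,y$: $y\in\kappa(x)$ iff $x\in\kappa(y)$. C-Cons-Del: given $(C,V)$, $\kappa:V\to2^V$, $p\in C$ and $k\in\mathbb{N}$, decide whether some $V'\subseteq V$ with $|V'|\le k$ makes $p$ a winner of $(C,V\setminus\kappa(V'))$. *)

(* Defs.v *)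
From mathcomp Require Import all_boot.
Unset Printing Implicit Defensive.

(* An instance: candidates C = {0,..,ncand-1}, voters V = {0,..,nvot-1},   *)
(* fav`_v = favourite candidate of voter v, kap`_v = the bundle kappa(v)    *)
(* (a duplicate-free list of voters), pref = the distinguished candidate p, *)
(* budget = k.                                                              *)
Record instance := Instance {
  ncand : nat; nvot : nat; fav : seq nat; kap : seq (seq nat);
  pref : nat; budget : nat }.

Definition wf_instance (I : instance) : Prop :=
  [/\ size (fav I) = nvot I, size (kap I) = nvot I,
      all (fun c => c < ncand I) (fav I), pref I < ncand I &
      forall v, v < nvot I ->
        [/\ v \in nth [::] (kap I) v,
            all (fun w => w < nvot I) (nth [::] (kap I) v) &
            uniq (nth [::] (kap I) v)]].

Definition symmetric_bundling (I : instance) : Prop :=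
  forall x y, x < nvot I -> y < nvot I -> x != y ->
    (y \in nth [::] (kap I) x) = (x \in nth [::] (kap I) y).

Definition bundles_le2 (I : instance) : Prop :=
  forall v, v < nvot I -> size (nth [::] (kap I) v) <= 2.

Definition bundle_set (I : instance) (V' : {set 'I_(nvot I)}) : {set 'I_(nvot I)} :=
  [set w : 'I_(nvot I) | [exists v in V', (val w) \in nth [::] (kap I) (val v)]].

Definition score (I : instance) (c : nat) (X : {set 'I_(nvot I)}) : nat :=
  #|[set v in X | nth 0 (fav I) (val v) == c]|.

Definition plurality_winner (I : instance) (c : nat) (X : {set 'I_(nvot I)}) : Prop :=
  forall c', c' < ncand I -> score I c' X <= score I c X.

Definition CConsDel (I : instance) : Prop :=
  exists V' : {set 'I_(nvot I)},
    #|V'| <= budget I /\ plurality_winner I (pref I) (~: bundle_set I V').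

(* 2. Machine model: unit-cost RAM with addition, truncated subtraction,    *)
(* indirect addressing and conditional jumps (polynomially equivalent to    *)
(* Turing machines).                                                        *)
Inductive instr :=
| IConst of nat & nat
| IAdd of nat & nat & nat
| ISub of nat & nat & nat
| ILoad of nat & nat
| IStore of nat & nat
| IJz of nat & nat
| IHalt.

Definition config := (nat * (nat -> nat))%type.

Definition upd (R : nat -> nat) (r v : nat) : nat -> nat :=
  fun i => if i == r then v else R i.

Definition step (prog : seq instr) (s : config) : config :=
  let: (pc, R) := s in
  match nth IHalt prog pc with
  | IConst r c => (pc.+1, upd R r c)
  | IAdd r a b => (pc.+1, upd R r (R a + R b))
  | ISub r a b => (pc.+1, upd R r (R a - R b))
  | ILoad r a => (pc.+1, upd R r (R (R a)))
  | IStore a b => (pc.+1, upd R (R a) (R b))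
  | IJz r l => (if R r == 0 then l else pc.+1, R)
  | IHalt => (pc, R)
  end.

Definition halted (prog : seq instr) (s : config) : bool :=
  if nth IHalt prog s.1 is IHalt then true else false.

Definition run (prog : seq instr) (t : nat) (s : config) : config :=
  iter t (step prog) s.

Definition init_config (x : seq nat) : config :=
  (0, fun i => if i == 0 then size x else nth 0 x i.-1).

Definition accepts (s : config) : bool := s.2 0 != 0.

Definition bitlen (a : nat) : nat := (trunc_log 2 a).+1.
Definition input_size (x : seq nat) : nat := \sum_(a <- x) bitlen a.

Definition encode (I : instance) : seq nat :=
  [:: ncand I; nvot I; pref I; budget I] ++ fav I
    ++ flatten [seq size s :: s | s <- kap I].

Definition poly_time_decidable (promise : instance -> Prop)
  (P : instance -> Prop) : Prop :=
  exists (prog : seq instr) (K d : nat),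
    forall I, promise I ->
      exists t, t <= K * (input_size (encode I)).+1 ^ d /\
        halted prog (run prog t (init_config (encode I))) /\
        (accepts (run prog t (init_config (encode I))) <-> P I).

(* Main.v *)
(** A bundle is a pair [{v, pt v}] for an involution [pt], possibly with [pt v = v], and it
    never helps to delete a bundle containing a supporter of [p].  So [p] can win iff one can
    choose, for every candidate [c], exactly [excess c = s_c - s_p] voters of [c] from the
    bundles without supporters of [p], such that the number of bundles met is at most [k].
    This is a perfect matching problem: join the two voters of a bundle by an edge, match
    the voters of [c] that are not chosen to slack vertices of colour [c], and match the
    chosen voters whose partner is not chosen to dummy vertices, which are also joined to
    each other.  If [s] voters are chosen and [q] of them have no chosen partner, then
    [(s + q) / 2] bundles are deleted, so [2 k - s] dummies enforce the budget.

    Perfect matchings are found by augmentation, without representing blossoms.  For an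
    exposed root [r] of a matching [M], a set [D] of vertices [x] is grown for which a
    matching [Mt x] exposing [x] instead of [r] is stored.  For an edge from [x] in [D] to
    [y], the hole is moved from [x] along the alternating walk that uses [Mt x] and, if
    [y] is in [D], [Mt y]; this augments [M], or enlarges [D], or changes nothing.  A
    partition of [D] into odd classes, one more than the set [A] of vertices matched into
    [D], exists only in the invariant; when no edge changes anything, it is an obstruction
    to perfect matchings as in Tutte's theorem.

    The algorithm is written in a language whose only loops and sums run over [0, ..., N - 1]
    for a fixed [N], so that each program of it compiles to a RAM program whose running time
    is polynomial in [N]. *)

Require Import Defs.
From mathcomp Require Import all_boot.
From mathcomp Require Import zify.

Set Implicit Arguments.
Unset Strict Implicit.

(** * A loop language and its compilation *)

(** Exactly [excess c] voters of each [c] suffice, because deleting more of them does no harm and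
    [p] loses nothing; this exactness is what a perfect matching can express. The budget is an
    inequality, while a perfect matching must use up all dummies: [s + q] is even, so the dummies
    left over are even in number and can be matched to each other.

    The matchings stored in a phase arise at different times and need not come from one alternating
    tree. What makes them fit together is a count: the classes are odd and one more than the
    vertices of [A], so each [Mt x] has exactly one vertex per class that it does not match inside
    the class. For two stored matchings this puts every second vertex of the path from [y] to [x] in
    their union into [D], so the hole can be moved along the whole path, and the vertices of [A] on
    it become exposable. The classes on the path outnumber its vertices of [A] by one, so merging
    them preserves both the oddness and the count. A table of full matchings costs [N] times the
    space of one matching, but no blossom ever has to be traced. *)

(* [m a i] is the cell [i] of the array [a]; a scalar variable is a cell [0]. *)
Definition store := nat -> nat -> nat.

Definition wr (m : store) (a i v : nat) : store :=
  fun b j => if (b == a) && (j == i) then v else m b j.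

(* [EN] is the common length [N] of all loops, [ERd a i] reads the cell [i] of [a], and
   [ESum x e] sums [e] over the values [0, ..., N - 1] of the scalar [x]. *)
Inductive expr :=
| ECst of nat
| EN
| EAdd of expr & expr
| ESub of expr & expr
| ERd of nat & expr
| EIf of expr & expr & expr
| ESum of nat & expr.

Inductive cmd :=
| CSkip
| CWr of nat & expr & expr
| CSeq of cmd & cmd
| CIf of expr & cmd & cmd
| CFor of nat & cmd.

Fixpoint eval (N : nat) (m : store) (e : expr) : nat :=
  match e with
  | ECst c => c
  | EN => N
  | EAdd a b => eval N m a + eval N m b
  | ESub a b => eval N m a - eval N m b
  | ERd a i => m a (eval N m i)
  | EIf c a b => if eval N m c == 0 then eval N m b else eval N m a
  | ESum x a => \sum_(0 <= i < N) eval N (wr m x 0 i) a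
  end.

Fixpoint exec (N : nat) (c : cmd) (m : store) : store :=
  match c with
  | CSkip => m
  | CWr a i v => wr m a (eval N m i) (eval N m v)
  | CSeq c1 c2 => exec N c2 (exec N c1 m)
  | CIf e c1 c2 => if eval N m e == 0 then exec N c2 m else exec N c1 m
  | CFor x c => foldl (fun m i => exec N c (wr m x 0 i)) m (iota 0 N)
  end.

(* Register [0] holds [N], the other registers below [ntmp] are temporaries, and [narr]
   arrays are interleaved above them. *)
Definition narr := 32.
Definition ntmp := 64.
Definition addr (a i : nat) : nat := ntmp + a + narr * i.

Lemma addr_inj a i b j : a < narr -> b < narr ->
  (addr a i == addr b j) = (a == b) && (i == j).
Proof. rewrite /addr /narr /ntmp; lia. Qed.

(* Multiplies by [narr]. *)
Definition dbl5 (t : nat) : seq instr :=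
  [:: IAdd t t t; IAdd t t t; IAdd t t t; IAdd t t t; IAdd t t t].

Definition addr_code (a t : nat) : seq instr :=
  dbl5 t ++ [:: IConst t.+1 (ntmp + a); IAdd t t t.+1].

(* Code for [e], placed at the address [b], that leaves the value of [e] in the register [t]
   and preserves the registers below [t]. *)
Fixpoint cexp (e : expr) (t b : nat) : seq instr :=
  match e with
  | ECst c => [:: IConst t c]
  | EN => [:: IConst t 0; IAdd t 0 t]
  | EAdd e1 e2 => let c1 := cexp e1 t b in
      let c2 := cexp e2 t.+1 (b + size c1) in c1 ++ c2 ++ [:: IAdd t t t.+1]
  | ESub e1 e2 => let c1 := cexp e1 t b in
      let c2 := cexp e2 t.+1 (b + size c1) in c1 ++ c2 ++ [:: ISub t t t.+1]
  | ERd a i => cexp i t b ++ addr_code a t ++ [:: ILoad t t]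
  | EIf e0 e1 e2 =>
      let c0 := cexp e0 t b in
      let b1 := b + size c0 + 1 in
      let c1 := cexp e1 t b1 in
      let b2 := b1 + size c1 + 2 in
      let c2 := cexp e2 t b2 in
      c0 ++ [:: IJz t b2] ++ c1 ++ [:: IConst t.+1 0; IJz t.+1 (b2 + size c2)] ++ c2
  | ESum x e0 =>
      let c0 := cexp e0 t.+3 (b + 7) in
      [:: IConst t 0; IConst t.+1 0; IAdd t.+2 (addr x 0) t;
          ISub t.+3 0 t.+1; IJz t.+3 (b + 7 + size c0 + 5);
          IConst t.+3 0; IAdd (addr x 0) t.+1 t.+3]
      ++ c0 ++
      [:: IAdd t t t.+3; IConst t.+3 1; IAdd t.+1 t.+1 t.+3; IConst t.+3 0;
          IJz t.+3 (b + 3);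
          IConst t.+1 0; IAdd (addr x 0) t.+2 t.+1]
  end.

(** The machine jumps only conditionally, so an unconditional jump tests a register that has just
    been set to 0. The counter of a loop lives in the temporary [t], which the body preserves, and
    is copied into [x] in every round; the body may therefore overwrite [x]. *)
Fixpoint ccmd (c : cmd) (t b : nat) : seq instr :=
  match c with
  | CSkip => [::]
  | CWr a i v =>
      let ci := cexp i t b ++ addr_code a t in
      ci ++ cexp v t.+1 (b + size ci) ++ [:: IStore t t.+1]
  | CSeq c1 c2 => let d1 := ccmd c1 t b in d1 ++ ccmd c2 t (b + size d1)
  | CIf e0 c1 c2 =>
      let d0 := cexp e0 t b in
      let b1 := b + size d0 + 1 in
      let d1 := ccmd c1 t b1 in
      let b2 := b1 + size d1 + 2 in
      let d2 := ccmd c2 t b2 in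
      d0 ++ [:: IJz t b2] ++ d1 ++ [:: IConst t 0; IJz t (b2 + size d2)] ++ d2
  | CFor x c0 =>
      let d0 := ccmd c0 t.+1 (b + 5) in
      [:: IConst t 0; ISub t.+1 0 t; IJz t.+1 (b + 5 + size d0 + 4);
          IConst t.+1 0; IAdd (addr x 0) t t.+1]
      ++ d0 ++
      [:: IConst t.+1 1; IAdd t t t.+1; IConst t.+1 0; IJz t.+1 (b + 1)]
  end.

(* The number of temporaries used by [cexp]. *)
Fixpoint eheight (e : expr) : nat :=
  match e with
  | ECst _ => 1
  | EN => 1
  | EAdd a b | ESub a b => maxn (eheight a) (eheight b).+1
  | ERd _ a => (eheight a).+1
  | EIf c a b => maxn 2 (maxn (eheight c) (maxn (eheight a) (eheight b)))
  | ESum _ a => (eheight a).+3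
  end.

Fixpoint earr (e : expr) : bool :=
  match e with
  | ECst _ => true
  | EN => true
  | EAdd a b | ESub a b => earr a && earr b
  | ERd a i => (a < narr) && earr i
  | EIf c a b => [&& earr c, earr a & earr b]
  | ESum x a => (x < narr) && earr a
  end.

Fixpoint cheight (c : cmd) : nat :=
  match c with
  | CSkip => 0
  | CWr _ i v => maxn (eheight i).+1 (eheight v).+1
  | CSeq a b => maxn (cheight a) (cheight b)
  | CIf e a b => maxn (eheight e) (maxn (cheight a) (cheight b))
  | CFor _ c => (cheight c).+2
  end.

Fixpoint carr (c : cmd) : bool :=
  match c with
  | CSkip => true
  | CWr a i v => [&& a < narr, earr i & earr v]
  | CSeq a b => carr a && carr b
  | CIf e a b => [&& earr e, carr a & carr b]
  | CFor x c => (x < narr) && carr c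
  end.

(** * Running time as a polynomial in the length of the loops *)

Fixpoint ecost (N : nat) (e : expr) : nat :=
  match e with
  | ECst _ => 1
  | EN => 2
  | EAdd a b | ESub a b => ecost N a + ecost N b + 1
  | ERd _ i => ecost N i + 8
  | EIf c a b => ecost N c + ecost N a + ecost N b + 3
  | ESum _ a => 7 + N * (ecost N a + 9)
  end.

Fixpoint ccost (N : nat) (c : cmd) : nat :=
  match c with
  | CSkip => 0
  | CWr _ i v => ecost N i + ecost N v + 8
  | CSeq a b => ccost N a + ccost N b
  | CIf e a b => ecost N e + ccost N a + ccost N b + 3
  | CFor _ c => 3 + N * (ccost N c + 8)
  end.

Definition poly_bounded (f : nat -> nat) : Prop :=
  exists K d, forall N, f N <= K * N.+1 ^ d.

Lemma poly_bounded_cst c : poly_bounded (fun=> c).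
Proof. by exists c, 0 => N; rewrite expn0 muln1. Qed.

Lemma poly_bounded_add f g :
  poly_bounded f -> poly_bounded g -> poly_bounded (fun N => f N + g N).
Proof.
move=> [K [d Hf]] [K' [d' Hg]]; exists (K + K'), (maxn d d') => N.
rewrite mulnDl leq_add //.
- by apply: leq_trans (Hf N) _; apply: leq_mul => //; apply: leq_pexp2l => //; exact: leq_maxl.
- by apply: leq_trans (Hg N) _; apply: leq_mul => //; apply: leq_pexp2l => //; exact: leq_maxr.
Qed.

Lemma poly_bounded_mulN f :
  poly_bounded f -> poly_bounded (fun N => N * f N).
Proof.
move=> [K [d Hf]]; exists K, d.+1 => N.
by rewrite expnS mulnCA leq_mul.
Qed.

(** Counting both branches of a conditional makes the bound independent of the store; for a fixed
    expression the degree is then at most the nesting depth of its sums. *)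
Lemma ecost_poly e : poly_bounded (ecost^~ e).
Proof.
elim: e => [c||a IHa b IHb|a IHa b IHb|x a IHa|c IHc a IHa b IHb|x a IHa] /=;
  by do ?[ exact: poly_bounded_cst | assumption | apply: poly_bounded_mulN
         | apply: poly_bounded_add].
Qed.

Lemma ccost_poly c : poly_bounded (ccost^~ c).
Proof.
elim: c => [|a i v|c1 IH1 c2 IH2|e c1 IH1 c2 IH2|x c IHc] /=;
  by do ?[ exact: poly_bounded_cst | assumption | exact: ecost_poly
         | apply: poly_bounded_mulN | apply: poly_bounded_add].
Qed.

(** * Correctness of the compiled code *)

Fixpoint code_at (prog : seq instr) (b : nat) (cs : seq instr) : Prop :=
  if cs is i :: cs' then nth IHalt prog b = i /\ code_at prog b.+1 cs' else True.

Lemma code_at_cat prog b c1 c2 :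
  code_at prog b (c1 ++ c2) <-> code_at prog b c1 /\ code_at prog (b + size c1) c2.
Proof.
elim: c1 b => [|i c1 IH] b /=; first by rewrite addn0; tauto.
by rewrite IH addSnnS; tauto.
Qed.

Lemma code_at_self pre cs post : code_at (pre ++ cs ++ post) (size pre) cs.
Proof.
elim: cs pre => [//|i cs IH] pre /=; split.
  by rewrite nth_cat ltnn subnn.
by have := IH (rcons pre i); rewrite size_rcons cat_rcons.
Qed.

Definition reaches (prog : seq instr) (B : nat) (s s' : config) : Prop :=
  exists2 k, k <= B & run prog k s = s'.

Lemma reaches0 prog s : reaches prog 0 s s.
Proof. by exists 0. Qed.

Lemma reaches_trans prog B1 B2 s1 s2 s3 :
  reaches prog B1 s1 s2 -> reaches prog B2 s2 s3 -> reaches prog (B1 + B2) s1 s3.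
Proof.
move=> [k1 Hk1 E1] [k2 Hk2 E2]; exists (k2 + k1); first by lia.
by rewrite /run iterD -/(run prog k1 s1) E1.
Qed.

Lemma reaches_leq prog B B' s s' : B <= B' -> reaches prog B s s' -> reaches prog B' s s'.
Proof. by move=> le_BB' [k Hk E]; exists k => //; apply: leq_trans Hk _. Qed.

Definition step_instr (i : instr) (pc : nat) (R : nat -> nat) : config :=
  match i with
  | IConst r c => (pc.+1, upd R r c)
  | IAdd r a b => (pc.+1, upd R r (R a + R b))
  | ISub r a b => (pc.+1, upd R r (R a - R b))
  | ILoad r a => (pc.+1, upd R r (R (R a)))
  | IStore a b => (pc.+1, upd R (R a) (R b))
  | IJz r l => (if R r == 0 then l else pc.+1, R)
  | IHalt => (pc, R)
  end.

Lemma reaches_step prog B b R i s' : nth IHalt prog b = i ->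
  reaches prog B (step_instr i b R) s' -> reaches prog B.+1 (b, R) s'.
Proof.
move=> Hi [k Hk E]; exists k.+1 => //.
by rewrite /run iterSr /= Hi -/(step_instr i b R).
Qed.

Definition sim (N : nat) (m : store) (R : nat -> nat) : Prop :=
  R 0 = N /\ forall a i, a < narr -> R (addr a i) = m a i.

Definition low_eq (t : nat) (R R' : nat -> nat) : Prop :=
  forall j, j < t -> R' j = R j.

Lemma upd_eq R r v : upd R r v r = v.
Proof. by rewrite /upd eqxx. Qed.

Lemma upd_neq R r v j : j != r -> upd R r v j = R j.
Proof. by rewrite /upd => /negbTE ->. Qed.

Ltac get_upd := rewrite ?upd_eq; repeat (rewrite upd_neq; [|lia]; rewrite ?upd_eq).

Lemma sim_upd_tmp N m R r v : 0 < r -> r < ntmp -> sim N m R -> sim N m (upd R r v).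
Proof.
move=> r0 rT [H0 Hm]; split=> [|a i Ha]; rewrite upd_neq //; first by lia.
  exact: Hm.
by rewrite /addr; lia.
Qed.

Lemma sim_upd_addr N m R a i v : a < narr -> sim N m R ->
  sim N (wr m a i v) (upd R (addr a i) v).
Proof.
move=> Ha [H0 Hm]; split=> [|b j Hb]; first by rewrite upd_neq // /addr /ntmp; lia.
by rewrite /upd addr_inj // /wr Hm.
Qed.

Lemma low_eq_upd t R R' r v : t <= r -> low_eq t R R' -> low_eq t R (upd R' r v).
Proof. by move=> Hr HR j Hj; rewrite upd_neq ?HR //; lia. Qed.

Lemma low_eq_trans t R R' R'' : low_eq t R R' -> low_eq t R' R'' -> low_eq t R R''.
Proof. by move=> H1 H2 j Hj; rewrite H2 ?H1. Qed.

Lemma low_eqW t t' R R' : t' <= t -> low_eq t R R' -> low_eq t' R R'.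
Proof. by move=> Ht H j Hj; apply: H; lia. Qed.

Lemma addr_ge a i : ntmp <= addr a i.
Proof. by rewrite /addr; lia. Qed.

Lemma sim_eqm N m m' R : (forall a i, m a i = m' a i) -> sim N m R -> sim N m' R.
Proof. by move=> E [H0 Hm]; split=> // a i Ha; rewrite Hm. Qed.

(** [t] and [b] vary because a subexpression is compiled at a later address and with its temporaries
    above the values still needed, which [low_eq] protects. The store must be the same before and
    after; this is why a sum saves and restores its variable. *)
Definition expr_ok (e : expr) : Prop := forall prog N m R t b,
  code_at prog b (cexp e t b) -> sim N m R -> 0 < t -> t + eheight e <= ntmp -> earr e ->
  exists2 R', reaches prog (ecost N e) (b, R) (b + size (cexp e t b), R')
    & [/\ sim N m R', R' t = eval N m e & low_eq t R R'].

Lemma addr_code_ok prog N m R t b a i :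
  code_at prog b (addr_code a t) -> sim N m R -> 0 < t -> t.+1 < ntmp -> R t = i ->
  exists2 R', reaches prog 7 (b, R) (b + 7, R')
    & [/\ sim N m R', R' t = addr a i & low_eq t R R'].
Proof.
move=> /= [H1 [H2 [H3 [H4 [H5 [H6 [H7 _]]]]]]] Hs t0 tT Hi.
eexists.
  do 7! (apply: reaches_step; [eassumption|rewrite /=]).
  rewrite -[b.+4.+3]/(b.+4.+3) (_ : b + 7 = b.+4.+3); last by lia.
  exact: reaches0.
split.
- by do ! (apply: sim_upd_tmp; [lia|lia|]).
- rewrite !upd_eq !(@upd_neq _ t.+1 _ t) ?upd_eq; try lia.
  by rewrite /addr /narr Hi; lia.
- by do ! (apply: low_eq_upd; [lia|]).
Qed.

Lemma wr_wr m x i v w a j : wr (wr m x i v) x i w a j = wr m x i w a j.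
Proof. by rewrite /wr /=; case: ((a == x) && (j == i)). Qed.

Lemma wr_id m x i a j : wr m x i (m x i) a j = m a j.
Proof. by rewrite /wr; case: ifP => // /andP[/eqP -> /eqP ->]. Qed.

Lemma eheight_gt0 e : 0 < eheight e.
Proof. by elim: e => //= *; lia. Qed.

(* The state when [k] iterations remain; the scalar [x] is saved in [t.+2] during the loop. *)
Lemma sum_loop_ok x e0 : expr_ok e0 -> forall prog N m R0 t b,
  code_at prog b (cexp (ESum x e0) t b) -> 0 < t -> t.+3 + eheight e0 <= ntmp ->
  x < narr -> earr e0 -> forall k R v, k <= N ->
  sim N (wr m x 0 v) R -> R t = \sum_(0 <= i < N - k) eval N (wr m x 0 i) e0 ->
  R t.+1 = N - k -> R t.+2 = m x 0 -> low_eq t R0 R ->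
  exists2 R', reaches prog (2 + k * (ecost N e0 + 9)) (b + 3, R)
                (b + 7 + size (cexp e0 t.+3 (b + 7)) + 5, R')
    & [/\ exists v', sim N (wr m x 0 v') R',
          R' t = \sum_(0 <= i < N) eval N (wr m x 0 i) e0,
          R' t.+2 = m x 0 & low_eq t R0 R'].
Proof.
move=> IH prog N m R0 t b Hc t0 tT Hx Ha.
have h0 := eheight_gt0 e0.
set c0 := cexp e0 t.+3 (b + 7) in Hc *.
move: (Hc) => /= [_ [_ [_ [H3 [H4 [H5 [H6]]]]]]].
rewrite -/c0 => /code_at_cat[Hc0 /= [G0 [G1 [G2 [G3 [G4 _]]]]]].
have e3 : b + 3 = b.+3 by lia.
have e7 : b + 7 = b.+4.+3 by lia.
elim=> [|k IHk] R v kN Hs Ht Ht1 Ht2 Hlow.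
- exists (upd R t.+3 0).
    rewrite e3; apply: reaches_step; [eassumption|rewrite /=].
    apply: reaches_step; [eassumption|rewrite /=].
    rewrite Ht1 (proj1 Hs) subn0 subnn upd_eq eqxx; exact: reaches0.
  split; [exists v| | |]; rewrite ?upd_neq //; try lia.
  - by apply: sim_upd_tmp => //; lia.
  - by rewrite Ht subn0.
  - by apply: low_eq_upd => //; lia.
- set R2 := upd (upd (upd R t.+3 (N - R t.+1)) t.+3 0) (addr x 0) (N - k.+1).
  have Hs2 : sim N (wr m x 0 (N - k.+1)) R2.
    apply: (@sim_eqm N (wr (wr m x 0 v) x 0 (N - k.+1))) => [a j|]; first exact: wr_wr.
    by apply: sim_upd_addr => //; do ! (apply: sim_upd_tmp; [lia|rewrite /ntmp in tT *; lia|]).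
  have AG := addr_ge x 0; rewrite /ntmp in tT AG.
  have Hl2 : low_eq t.+3 R R2.
    by do ! (apply: low_eq_upd; [lia|]).
  have [|||R3 Hr3 [Hs3 Hv3 Hl3]] := IH prog N _ R2 t.+3 (b + 7) _ Hs2 _ _ Ha.
  - by rewrite -/c0 e7.
  - by [].
  - by [].
  set R4 := upd (upd (upd (upd R3 t (R3 t + R3 t.+3)) t.+3 1) t.+1 (R3 t.+1).+1) t.+3 0.
  have Ht3 : R3 t = R t by rewrite Hl3 ?Hl2 //; lia.
  have Ht31 : R3 t.+1 = R t.+1 by rewrite Hl3 ?Hl2 //; lia.
  have Ht32 : R3 t.+2 = R t.+2 by rewrite Hl3 ?Hl2 //; lia.
  have [||||||R' Hr' Hfin] := IHk R4 (N - k.+1).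
  - lia.
  - by do ! (apply: sim_upd_tmp; [lia|rewrite /ntmp; lia|]).
  - rewrite /R4; get_upd; rewrite Ht3 Hv3 Ht.
    have -> : N - k = (N - k.+1).+1 by lia.
    by rewrite big_nat_recr //=.
  - by rewrite /R4; get_upd; rewrite Ht31 Ht1; lia.
  - by rewrite /R4; get_upd; rewrite Ht32.
  - do 4! (apply: low_eq_upd; [lia|]).
    by apply: low_eq_trans Hlow _; apply: (@low_eq_trans _ _ R2); [apply: low_eqW Hl2|apply: low_eqW Hl3]; lia.
  exists R' => //.
  have -> : 2 + k.+1 * (ecost N e0 + 9) = 4 + (ecost N e0 + (5 + (2 + k * (ecost N e0 + 9)))) by lia.
  apply: (@reaches_trans _ _ _ _ (b + 7, R2)).
    rewrite e3; apply: reaches_step; [eassumption|rewrite /=].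
    apply: reaches_step; [eassumption|rewrite /=].
    rewrite upd_eq (proj1 Hs) Ht1 (_ : (N - (N - k.+1) == 0) = false); last by lia.
    apply: reaches_step; [eassumption|rewrite /=].
    apply: reaches_step; [eassumption|rewrite /=].
    rewrite /R2 e7; get_upd; rewrite Ht1 addn0.
    exact: reaches0.
  apply: reaches_trans Hr3 _; rewrite -/c0.
  apply: (@reaches_trans _ _ _ _ (b + 3, R4)) Hr'.
  rewrite -e7 in G0 G1 G2 G3 G4.
  do 4! (apply: reaches_step; [eassumption|rewrite /=]).
  apply: reaches_step; [eassumption|rewrite /=].
  rewrite upd_eq eqxx /R4; get_upd; rewrite addn1.
  exact: reaches0.
Qed.

Lemma binop_ok (op : nat -> nat -> nat) (ins : nat -> instr) e1 e2 :
  (forall t pc R, step_instr (ins t) pc R = (pc.+1, upd R t (op (R t) (R t.+1)))) ->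
  expr_ok e1 -> expr_ok e2 -> forall prog N m R t b,
  let c1 := cexp e1 t b in let c := c1 ++ cexp e2 t.+1 (b + size c1) ++ [:: ins t] in
  code_at prog b c -> sim N m R -> 0 < t -> t + maxn (eheight e1) (eheight e2).+1 <= ntmp ->
  earr e1 && earr e2 ->
  exists2 R', reaches prog (ecost N e1 + ecost N e2 + 1) (b, R) (b + size c, R')
    & [/\ sim N m R', R' t = op (eval N m e1) (eval N m e2) & low_eq t R R'].
Proof.
move=> Hins IH1 IH2 prog N m R t b c1; set c2 := cexp e2 _ _; rewrite [let c := _ in _]/=.
move=> /code_at_cat[Hc1 /code_at_cat[Hc2 /= [H0 _]]] Hs t0 tT /andP[A1 A2].
have g1 := eheight_gt0 e1; have g2 := eheight_gt0 e2.
have [|R1 Hr1 [Hs1 Hv1 Hl1]] := IH1 _ _ _ _ _ _ Hc1 Hs t0 _ A1; first by lia.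
have [||R2 Hr2 [Hs2 Hv2 Hl2]] := IH2 _ _ _ _ _ _ Hc2 Hs1 _ _ A2; [lia|lia|].
exists (upd R2 t (op (R2 t) (R2 t.+1))).
  rewrite !size_cat /= !addnA (addn1 (_ + size c2)).
  apply: (@reaches_trans _ (ecost N e1 + ecost N e2) 1).
    exact: reaches_trans Hr1 Hr2.
  by apply: reaches_step; [eassumption|rewrite Hins; exact: reaches0].
split.
- by apply: sim_upd_tmp => //; lia.
- by get_upd; rewrite Hv2 Hl2 // Hv1.
- by apply: low_eq_upd => //; apply: low_eq_trans Hl1 _; apply: low_eqW Hl2; lia.
Qed.

Lemma cexp_ok e : expr_ok e.
Proof.
elim: e => [c||e1 IH1 e2 IH2|e1 IH1 e2 IH2|a e IHe|e0 IH0 e1 IH1 e2 IH2|x e IHe]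
  prog N m R t b.
- move=> /= [H0 _] Hs t0 tT _; exists (upd R t c).
    apply: reaches_step; [eassumption|rewrite /= addn1]; exact: reaches0.
  split; [by apply: sim_upd_tmp => //; lia|exact: upd_eq|exact: low_eq_upd].
- move=> /= [H0 [H1 _]] Hs t0 tT _.
  exists (upd (upd R t 0) t (upd R t 0 0 + upd R t 0 t)).
    apply: reaches_step; [eassumption|].
    apply: reaches_step; [eassumption|rewrite /= addn2]; exact: reaches0.
  split.
  + by do 2! (apply: sim_upd_tmp; [lia|lia|]).
  + by get_upd; rewrite (proj1 Hs) addn0.
  + by do 2! (apply: low_eq_upd; [lia|]).
- exact: (binop_ok (op := addn) (ins := fun t => IAdd t t t.+1) _ IH1 IH2).
- exact: (binop_ok (op := subn) (ins := fun t => ISub t t t.+1) _ IH1 IH2).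
- rewrite -[cexp _ t b]/(cexp e t b ++ addr_code a t ++ [:: ILoad t t]); set c1 := cexp e t b.
  move=> /code_at_cat[Hc1 /code_at_cat[Hc2 [H0 _]]] Hs t0 tT /andP[A1 A2].
  have g1 := eheight_gt0 e; rewrite /= in tT.
  have [|R1 Hr1 [Hs1 Hv1 Hl1]] := IHe _ _ _ _ _ _ Hc1 Hs t0 _ A2; first by lia.
  have [|R2 Hr2 [Hs2 Hv2 Hl2]] := addr_code_ok Hc2 Hs1 t0 _ Hv1; first by lia.
  exists (upd R2 t (R2 (R2 t))).
    have -> : b + size (c1 ++ addr_code a t ++ [:: ILoad t t]) = (b + size c1 + 7).+1.
      by rewrite !size_cat /=; lia.
    apply: reaches_trans Hr1 _; rewrite -/c1.
    apply: (@reaches_trans _ 7 1) Hr2 _.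
    by apply: reaches_step; [exact: H0|exact: reaches0].
  split.
  + by apply: sim_upd_tmp => //; lia.
  + by get_upd; rewrite Hv2 (proj2 Hs2).
  + by apply: low_eq_upd => //; apply: low_eq_trans Hl1 Hl2.
- rewrite [cexp _ _ _]/=; set c0 := cexp e0 t b; set b1 := b + _ + 1.
  set c1 := cexp e1 t b1; set b2 := b1 + _ + 2; set c2 := cexp e2 t b2.
  move=> /code_at_cat[Hc0 [HJ /code_at_cat[Hc1 [K0 [K1 Hc2]]]]] Hs t0 tT /and3P[A0 A1 A2].
  have g0 := eheight_gt0 e0; rewrite /= in tT.
  have [|R0 Hr0 [Hs0 Hv0 Hl0]] := IH0 _ _ _ _ _ _ Hc0 Hs t0 _ A0; first by lia.
  have E1 : b1 = (b + size c0).+1 by rewrite /b1; lia.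
  have E2 : b2 = (b1 + size c1).+2 by rewrite /b2; lia.
  rewrite -E1 -?E2 in Hc1 K0 K1 Hc2.
  have -> : b + size (c0 ++ [:: IJz t b2] ++ c1 ++ [:: IConst t.+1 0; IJz t.+1 (b2 + size c2)] ++ c2)
     = b2 + size c2 by rewrite !size_cat /=; lia.
  rewrite /=; case: eqP => Hz.
  + have [|R2 Hr2 [Hs2 Hv2 Hl2]] := IH2 _ _ _ _ _ _ Hc2 Hs0 t0 _ A2; first by lia.
    exists R2; last by split=> //; apply: low_eq_trans Hl0 Hl2.
    apply: (@reaches_leq _ (ecost N e0 + (ecost N e2).+1)); first by lia.
    apply: reaches_trans Hr0 _; apply: reaches_step; [eassumption|].
    by rewrite /= Hv0 Hz.
  + have [|R1 Hr1 [Hs1 Hv1 Hl1]] := IH1 _ _ _ _ _ _ Hc1 Hs0 t0 _ A1; first by lia.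
    exists (upd R1 t.+1 0).
      apply: (@reaches_leq _ (ecost N e0 + (ecost N e1 + 2).+1)); first by lia.
      apply: reaches_trans Hr0 _; apply: reaches_step; [eassumption|].
      rewrite /= Hv0 (introF eqP Hz) -E1.
      apply: reaches_trans Hr1 _.
      do 2! (apply: reaches_step; [eassumption|rewrite /=]).
      rewrite upd_eq eqxx; exact: reaches0.
    split; first by apply: sim_upd_tmp => //; lia.
    * by get_upd.
    * by apply: low_eq_upd; [lia|apply: low_eq_trans Hl0 Hl1].
- move=> Hc Hs t0 /= tT /andP[Hx Ha]; have Hc' := Hc.
  have g1 := eheight_gt0 e.
  move: Hc' => /= [H0 [H1 [H2 _]]].
  set R0 := upd (upd (upd R t 0) t.+1 0) t.+2 (m x 0).
  have A0 := addr_ge x 0.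
  have tT' : t.+3 + eheight e <= ntmp by lia.
  (* Before the first round the invariant of the loop holds with the old value of [x] in the place
     of a loop value. *)
  have S1 : sim N (wr m x 0 (m x 0)) R0.
    apply: (@sim_eqm _ m) => [a i|]; first by rewrite wr_id.
    by do 3! (apply: sim_upd_tmp; [lia|lia|]).
  have S2 : R0 t = \sum_(0 <= i < N - N) eval N (wr m x 0 i) e.
    by rewrite /R0; get_upd; rewrite subnn big_geq.
  have S3 : R0 t.+1 = N - N by rewrite /R0; get_upd; rewrite subnn.
  have S4 : R0 t.+2 = m x 0 by rewrite /R0; get_upd.
  have S5 : low_eq t R R0 by do 3! (apply: low_eq_upd; [lia|]).
  have [R1 Hr1 [[v Hs1] Hv1 Hv2 Hl1]] :=
    sum_loop_ok IHe Hc t0 tT' Hx Ha (leqnn N) S1 S2 S3 S4 S5.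
  have e7 : b + 7 = b.+4.+3 by lia.
  have e3 : b.+3 = b + 3 by lia.
  move: (Hc) => /= [_ [_ [_ [_ [_ [_ [_]]]]]]].
  rewrite -e7; set c0 := cexp e t.+3 (b + 7).
  move=> /code_at_cat[_ /= [_ [_ [_ [_ [_ [K1 [K2 _]]]]]]]].
  set R2 := upd (upd R1 t.+1 0) (addr x 0) (upd R1 t.+1 0 t.+2 + upd R1 t.+1 0 t.+1).
  exists R2.
    apply: (@reaches_leq _ (3 + ((2 + N * (ecost N e + 9)) + 2))); first by lia.
    apply: (@reaches_trans _ _ _ _ (b + 3, R0)).
      do 3! (apply: reaches_step; [eassumption|rewrite /=]).
      rewrite -e3 /R0; get_upd; rewrite (proj2 Hs) // addn0; exact: reaches0.
    apply: reaches_trans Hr1 _.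
    have -> : b + 7 + size (cexp e t.+3 (b + 7)) + 5 = (b + 7 + size c0).+4.+1 by rewrite /c0; lia.
    do 2! (apply: reaches_step; [eassumption|rewrite /=]).
    have -> : b + (size (c0 ++ [:: IAdd t t t.+3; IConst t.+3 1; IAdd t.+1 t.+1 t.+3; IConst t.+3 0;
          IJz t.+3 (b + 3);
          IConst t.+1 0; IAdd (addr x 0) t.+2 t.+1])).+4.+3 = (b + 7 + size c0).+4.+3.
      by rewrite size_cat /=; lia.
    exact: reaches0.
  split.
  + apply: (@sim_eqm _ (wr (wr m x 0 v) x 0 (m x 0))) => [a i|]; first by rewrite wr_wr wr_id.
    rewrite /R2; get_upd; rewrite Hv2 addn0.
    by apply: sim_upd_addr => //; apply: sim_upd_tmp => //; lia.
  + by rewrite /R2; get_upd; rewrite Hv1.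
  + by do 2! (apply: low_eq_upd; [lia|]).
Qed.

Definition cmd_ok (c : cmd) : Prop := forall prog N m R t b,
  code_at prog b (ccmd c t b) -> sim N m R -> 0 < t -> t + cheight c <= ntmp -> carr c ->
  exists2 R', reaches prog (ccost N c) (b, R) (b + size (ccmd c t b), R')
    & sim N (exec N c m) R' /\ low_eq t R R'.

(** The induction is on the number [k] of rounds that remain, with [N - k] in the temporary [t].
    Unlike in a sum, the store is arbitrary at each round and [x] is not restored. *)
Lemma for_loop_ok x c : cmd_ok c -> forall prog N R0 t b,
  code_at prog b (ccmd (CFor x c) t b) -> 0 < t -> t.+2 + cheight c <= ntmp ->
  x < narr -> carr c -> forall k R m, k <= N ->
  sim N m R -> R t = N - k -> low_eq t R0 R ->
  exists2 R', reaches prog (2 + k * (ccost N c + 8)) (b + 1, R)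
                (b + size (ccmd (CFor x c) t b), R')
    & sim N (foldl (fun m i => exec N c (wr m x 0 i)) m (iota (N - k) k)) R'
      /\ low_eq t R0 R'.
Proof.
move=> IH prog N R0 t b Hc t0 tT Hx Ha.
have -> : b + size (ccmd (CFor x c) t b) = b + 5 + size (ccmd c t.+1 (b + 5)) + 4.
  by rewrite /= size_cat /=; lia.
move: (Hc) => /= [_ [H1 [H2 [H3 [H4]]]]].
set c0 := ccmd c t.+1 (b + 5).
move=> /code_at_cat[Hc0 /= [G0 [G1 [G2 [G3 _]]]]].
have e1 : b + 1 = b.+1 by lia.
have e5 : b + 5 = b.+4.+1 by lia.
elim=> [|k IHk] R m kN Hs Ht Hlow.
- exists (upd R t.+1 0).
    rewrite e1; do 2! (apply: reaches_step; [eassumption|rewrite /=]).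
    rewrite Ht (proj1 Hs) subn0 subnn upd_eq eqxx; exact: reaches0.
  split; first by apply: sim_upd_tmp => //; lia.
  by apply: low_eq_upd => //; lia.
- set R2 := upd (upd (upd R t.+1 (N - R t)) t.+1 0) (addr x 0) (N - k.+1).
  have AG := addr_ge x 0.
  have Hs2 : sim N (wr m x 0 (N - k.+1)) R2.
    by apply: sim_upd_addr => //; do 2! (apply: sim_upd_tmp; [lia|lia|]).
  have Hl2 : low_eq t.+1 R R2 by do 3! (apply: low_eq_upd; [lia|]).
  have [|||R3 Hr3 [Hs3 Hl3]] := IH prog N _ R2 t.+1 (b + 5) _ Hs2 _ _ Ha.
  - by rewrite -/c0 e5.
  - by [].
  - by lia.
  set R4 := upd (upd (upd R3 t.+1 1) t (R3 t).+1) t.+1 0.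
  have Ht3 : R3 t = R t by rewrite Hl3 ?Hl2 //; lia.
  have [|||| R' Hr' Hfin] := IHk R4 (exec N c (wr m x 0 (N - k.+1))).
  - by lia.
  - by do 3! (apply: sim_upd_tmp; [lia|lia|]).
  - by rewrite /R4; get_upd; rewrite Ht3 Ht; lia.
  - do 3! (apply: low_eq_upd; [lia|]).
    by apply: low_eq_trans Hlow _; apply: (@low_eq_trans _ _ R2);
       [apply: low_eqW Hl2|apply: low_eqW Hl3]; lia.
  exists R'; last first.
    by move: Hfin; rewrite (_ : N - k = (N - k.+1).+1) //; lia.
  have -> : 2 + k.+1 * (ccost N c + 8) = 4 + (ccost N c + (4 + (2 + k * (ccost N c + 8)))) by lia.
  apply: (@reaches_trans _ _ _ _ (b + 5, R2)).
    rewrite e1; do 2! (apply: reaches_step; [eassumption|rewrite /=]).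
    rewrite upd_eq (proj1 Hs) Ht (_ : (N - (N - k.+1) == 0) = false); last by lia.
    do 2! (apply: reaches_step; [eassumption|rewrite /=]).
    rewrite /R2 e5; get_upd; rewrite Ht addn0; exact: reaches0.
  apply: reaches_trans Hr3 _; rewrite -/c0.
  apply: (@reaches_trans _ _ _ _ (b + 1, R4)) Hr'.
  rewrite -e5 in G0 G1 G2 G3.
  do 4! (apply: reaches_step; [eassumption|rewrite /=]).
  rewrite upd_eq eqxx /R4; get_upd; rewrite !addn1; exact: reaches0.
Qed.

Lemma ccmd_ok c : cmd_ok c.
Proof.
elim: c => [|a i v|c1 IH1 c2 IH2|e0 c1 IH1 c2 IH2|x c IHc] prog N m R t b.
- move=> _ Hs _ _ _; exists R; last by [].
  rewrite /= addn0; exact: reaches0.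
- rewrite -[ccmd _ t b]/((cexp i t b ++ addr_code a t) ++
    cexp v t.+1 (b + size (cexp i t b ++ addr_code a t)) ++ [:: IStore t t.+1]).
  set ci := cexp i t b ++ addr_code a t; set cv := cexp v t.+1 (b + size ci).
  move=> /code_at_cat[/code_at_cat[Hc1 Hc2] /code_at_cat[Hc3 [H0 _]]] Hs t0 tT /and3P[Ax A1 A2].
  have g1 := eheight_gt0 i; have g2 := eheight_gt0 v; rewrite /= in tT.
  have [|R1 Hr1 [Hs1 Hv1 Hl1]] := cexp_ok Hc1 Hs t0 _ A1; first by lia.
  have [|R2 Hr2 [Hs2 Hv2 Hl2]] := addr_code_ok Hc2 Hs1 t0 _ Hv1; first by lia.
  have [||R3 Hr3 [Hs3 Hv3 Hl3]] := cexp_ok Hc3 Hs2 _ _ A2; [lia|lia|].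
  have AG := addr_ge a (eval N m i).
  exists (upd R3 (addr a (eval N m i)) (eval N m v)); last split.
  + apply: (@reaches_leq _ (ecost N i + (7 + (ecost N v + 1)))); first by rewrite /=; lia.
    apply: reaches_trans Hr1 _; apply: reaches_trans Hr2 _.
    have -> : b + size (ci ++ cv ++ [:: IStore t t.+1]) = (b + size ci + size cv).+1.
      by rewrite (size_cat ci) (size_cat cv) /=; lia.
    have -> : b + size (cexp i t b) + 7 = b + size ci by rewrite /ci size_cat /=; lia.
    apply: reaches_trans Hr3 _.
    apply: reaches_step; [exact: H0|rewrite /= Hl3 // Hv2 Hv3].
    exact: reaches0.
  + exact: sim_upd_addr.
  + apply: low_eq_upd; first by lia.
    apply: low_eq_trans Hl1 _; apply: low_eq_trans Hl2 _; apply: low_eqW Hl3; lia.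
- move=> /= /code_at_cat[Hc1 Hc2] Hs t0 tT /andP[A1 A2].
  have [|R1 Hr1 [Hs1 Hl1]] := IH1 _ _ _ _ _ _ Hc1 Hs t0 _ A1; first by lia.
  have [|R2 Hr2 [Hs2 Hl2]] := IH2 _ _ _ _ _ _ Hc2 Hs1 t0 _ A2; first by lia.
  exists R2; first by rewrite size_cat addnA; apply: reaches_trans Hr1 Hr2.
  by split=> //; apply: low_eq_trans Hl1 Hl2.
- rewrite [ccmd _ _ _]/=; set c0 := cexp e0 t b; set b1 := b + _ + 1.
  set d1 := ccmd c1 t b1; set b2 := b1 + _ + 2; set d2 := ccmd c2 t b2.
  move=> /code_at_cat[Hc0 [HJ /code_at_cat[Hc1 [K0 [K1 Hc2]]]]] Hs t0 tT /and3P[A0 A1 A2].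
  have g0 := eheight_gt0 e0; rewrite /= in tT.
  have [|R0 Hr0 [Hs0 Hv0 Hl0]] := cexp_ok Hc0 Hs t0 _ A0; first by lia.
  have E1 : b1 = (b + size c0).+1 by rewrite /b1; lia.
  have E2 : b2 = (b1 + size d1).+2 by rewrite /b2; lia.
  rewrite -E1 -?E2 in Hc1 K0 K1 Hc2.
  have -> : b + size (c0 ++ [:: IJz t b2] ++ d1 ++ [:: IConst t 0; IJz t (b2 + size d2)] ++ d2)
     = b2 + size d2 by rewrite !size_cat /=; lia.
  rewrite /=; case: eqP => Hz.
  + have [|R2 Hr2 [Hs2 Hl2]] := IH2 _ _ _ _ _ _ Hc2 Hs0 t0 _ A2; first by lia.
    exists R2; last by split=> //; apply: low_eq_trans Hl0 Hl2.
    apply: (@reaches_leq _ (ecost N e0 + (ccost N c2).+1)); first by lia.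
    apply: reaches_trans Hr0 _; apply: reaches_step; [eassumption|].
    by rewrite /= Hv0 Hz.
  + have [|R1 Hr1 [Hs1 Hl1]] := IH1 _ _ _ _ _ _ Hc1 Hs0 t0 _ A1; first by lia.
    exists (upd R1 t 0).
      apply: (@reaches_leq _ (ecost N e0 + (ccost N c1 + 2).+1)); first by lia.
      apply: reaches_trans Hr0 _; apply: reaches_step; [eassumption|].
      rewrite /= Hv0 (introF eqP Hz) -E1.
      apply: reaches_trans Hr1 _.
      do 2! (apply: reaches_step; [eassumption|rewrite /=]).
      rewrite upd_eq eqxx; exact: reaches0.
    split; first by apply: sim_upd_tmp => //; lia.
    by apply: low_eq_upd; [lia|apply: low_eq_trans Hl0 Hl1].
- move=> Hc Hs t0 /= tT /andP[Hx Ha].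
  have tT' : t.+2 + cheight c <= ntmp by lia.
  have S1 : sim N m (upd R t 0) by apply: sim_upd_tmp => //; lia.
  have S2 : upd R t 0 t = N - N by rewrite upd_eq subnn.
  have S3 : low_eq t R (upd R t 0) by apply: low_eq_upd.
  have [R1 Hr1 [Hs1 Hl1]] := for_loop_ok IHc Hc t0 tT' Hx Ha (leqnn N) S1 S2 S3.
  exists R1; last by rewrite subnn in Hs1.
  rewrite -[3 + _]/(1 + (2 + N * (ccost N c + 8))).
  apply: reaches_trans Hr1.
  case: Hc => H0 _; apply: reaches_step; [exact: H0|rewrite /= addn1].
  exact: reaches0.
Qed.

(** * Loading the input into arrays *)

Lemma add_repeat_ok prog r k b R : 0 < r -> code_at prog b (nseq k (IAdd r r 0)) ->
  exists2 R', reaches prog k (b, R) (b + k, R')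
    & R' r = R r + k * R 0 /\ forall j, j != r -> R' j = R j.
Proof.
move=> r0; elim: k b R => [|k IHk] b R /=.
  by move=> _; exists R; rewrite ?mul0n !addn0; first exact: reaches0.
move=> [H0 Hc]; have [R' Hr' [E1 E2]] := IHk _ (upd R r (R r + R 0)) Hc.
exists R'.
  by apply: reaches_step; [eassumption|rewrite /= addnS -addSn].
split=> [|j Hj]; last by rewrite E2 // upd_neq.
by rewrite E1 upd_eq upd_neq; lia.
Qed.

(* The input occupies the registers from [1] on, and is moved to array [0] from its last cell
   down.  Its first four cells lie in temporaries that the loop itself uses; the second to
   fourth are first copied behind the end of the input, and the first one is not needed. *)
Definition load_loop (b : nat) : seq instr :=
  [:: IConst 1 4; ISub 1 0 1; IJz 1 (b + 42); ILoad 1 0; IConst 3 ntmp]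
  ++ nseq narr (IAdd 3 3 0) ++
  [:: IStore 3 1; IConst 1 1; ISub 0 0 1; IConst 1 0; IJz 1 b].

Definition prelude : seq instr :=
  [:: IConst 1 (ntmp + narr)] ++ nseq narr (IAdd 1 1 0) ++
  [:: IStore 1 2; IConst 2 narr; IAdd 1 1 2; IStore 1 3; IAdd 1 1 2; IStore 1 4;
      IConst 2 0; IAdd 2 2 0] ++ load_loop 41 ++
  [:: IConst 1 0; IAdd (addr 1 0) 2 1; IAdd 0 2 2; IAdd 0 0 0].

(** The target [addr 0 j] lies above [j], so going down never overwrites a number that is still to
    be moved. [X] stands for the input and [Y] for what has been placed behind it in the array. *)
Lemma load_loop_ok prog b L (X Y : nat -> nat) : code_at prog b (load_loop b) ->
  forall k R, k <= L -> R 0 = k -> R 2 = L ->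
  (forall j, 4 < j <= k -> R j = X j) ->
  (forall j, 4 < j -> k < j <= L -> R (addr 0 j) = X j) ->
  (forall j, L < j -> R (addr 0 j) = Y j) ->
  exists2 R', reaches prog (3 + k * 42) (b, R) (b + 42, R')
    & [/\ R' 2 = L, forall j, 4 < j <= L -> R' (addr 0 j) = X j
        & forall j, L < j -> R' (addr 0 j) = Y j].
Proof.
have [rep Erep] : exists rep, rep = nseq narr (IAdd 3 3 0) by eexists.
rewrite /load_loop -Erep.
move=> /= [H0 [H1 [H2 [H3 [H4 /code_at_cat[Hrep]]]]]].
rewrite Erep size_nseq in Hrep * => /= [[G0 [G1 [G2 [G3 [G4 _]]]]]].
have Ag j : 64 <= addr 0 j by apply: addr_ge.
elim=> [|k IHk] R kL E0 E2 HX HXk HY.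
  exists (upd (upd R 1 4) 1 (upd R 1 4 0 - upd R 1 4 1)).
    do 3! (apply: reaches_step; [eassumption|rewrite /=]).
    get_upd; rewrite E0 /=; exact: reaches0.
  split=> [|j Hj|j Hj]; first by get_upd.
  - by have Aj := Ag j; get_upd; apply: HXk; lia.
  - by have Aj := Ag j; get_upd; apply: HY.
(* By truncated subtraction of 4 the loop stops at every counter value up to 4, not only at 0. *)
case: (ltnP k 4) => Hk.
  exists (upd (upd R 1 4) 1 (upd R 1 4 0 - upd R 1 4 1)).
    apply: (@reaches_leq _ 3); first by lia.
    do 3! (apply: reaches_step; [eassumption|rewrite /=]).
    get_upd; rewrite E0 (_ : (k.+1 - 4 == 0)); last by lia.
    exact: reaches0.
  split=> [|j Hj|j Hj]; first by get_upd.
  - by have Aj := Ag j; get_upd; apply: HXk; lia.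
  - by have Aj := Ag j; get_upd; apply: HY.
set R1 := upd (upd (upd (upd R 1 4) 1 (k.+1 - 4)) 1 (X k.+1)) 3 ntmp.
have [//|R2 Hr2 [E3 En]] := add_repeat_ok R1 _ Hrep.
have F0 : R2 0 = k.+1 by rewrite En // /R1; get_upd.
have F1 : R2 1 = X k.+1 by rewrite En // /R1; get_upd.
have F2 : R2 2 = L by rewrite En // /R1; get_upd.
have F3 : R2 3 = addr 0 k.+1.
  by rewrite E3 /R1 /addr; get_upd; rewrite E0.
have Fj j : 4 < j -> R2 j = R j by move=> Hj; rewrite En /R1; [get_upd|lia].
set R3 := upd (upd (upd (upd R2 (addr 0 k.+1) (X k.+1)) 1 1) 0 k) 1 0.
have Ak := addr_ge 0 k.+1; rewrite /ntmp in Ak.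
have [|||j Hj|j Hj1 Hj2|j Hj|R' Hr' Hfin] := IHk R3.
- by lia.
- by rewrite /R3; get_upd.
- by rewrite /R3; get_upd.
- rewrite /R3; do 3! (rewrite upd_neq; last by lia).
  rewrite upd_neq; last by rewrite /addr /ntmp /narr; lia.
  by rewrite Fj ?HX; lia.
- have Aj := addr_ge 0 j; rewrite /ntmp in Aj.
  rewrite /R3; do 3! (rewrite upd_neq; last by lia).
  case: (eqVneq j k.+1) => [->|njk]; first exact: upd_eq.
  by rewrite upd_neq ?addr_inj // Fj ?HXk //; lia.
- have Aj := addr_ge 0 j; rewrite /ntmp in Aj.
  rewrite /R3; do 3! (rewrite upd_neq; last by lia).
  by rewrite upd_neq ?addr_inj // ?Fj ?HY //; lia.
exists R' => //.
have -> : 3 + k.+1 * 42 = 5 + (narr + (5 + (3 + k * 42))) by rewrite /narr; lia.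
apply: (@reaches_trans _ _ _ _ (b.+4.+1, R1)).
  do 3! (apply: reaches_step; [eassumption|rewrite /=]).
  get_upd; rewrite E0 (_ : (k.+1 - 4 == 0) = false); last by lia.
  do 2! (apply: reaches_step; [eassumption|rewrite /=]).
  have -> : upd (upd R 1 4) 1 (k.+1 - 4) 0 = k.+1 by get_upd.
  rewrite /R1; get_upd; rewrite HX; [exact: reaches0|lia].
apply: reaches_trans Hr2 _; apply: reaches_trans Hr'.
do 5! (apply: reaches_step; [eassumption|rewrite /=]).
rewrite upd_eq /= /R3 F1 F3; get_upd; rewrite F0 subn1; exact: reaches0.
Qed.

Definition prog_of (c : cmd) (res : nat) : seq instr :=
  let pre := prelude in
  let main := ccmd c 1 (size pre) in
  pre ++ main ++ [:: IConst 1 0; IAdd 0 (addr res 0) 1; IHalt].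

(** Nothing is said about other cells: numbers of the input left behind in the registers show up in
    them, so every other array must be initialised before it is read. *)
Definition loaded (x : seq nat) (m : store) : Prop :=
  [/\ forall i, 4 < i <= size x -> m 0 i = nth 0 x i.-1,
      [/\ m 0 (size x).+1 = nth 0 x 1, m 0 (size x).+2 = nth 0 x 2
        & m 0 (size x).+3 = nth 0 x 3]
    & m 1 0 = size x].

Lemma prelude_ok prog x : code_at prog 0 prelude -> 4 <= size x ->
  exists R', [/\ reaches prog (100 + 42 * size x) (init_config x) (size prelude, R'),
    R' 0 = 4 * size x & loaded x (fun a i => R' (addr a i))].
Proof.
have [rep Erep] : exists rep, rep = nseq narr (IAdd 1 1 0) by eexists.
have [lp Elp] : exists lp, lp = load_loop 41 by eexists.
have Hsz : size prelude = 87 by [].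
rewrite Hsz /prelude -Erep -Elp.
move=> /= [H0 /code_at_cat[Hrep]].
rewrite Erep size_nseq in Hrep * => /= [[H1 [H2 [H3 [H4 [H5 [H6 [H7 [H8 /code_at_cat[Hlp]]]]]]]]]].
have -> : size lp = 42 by rewrite Elp.
rewrite Elp in Hlp => /= [[G0 [G1 [G2 [G3 _]]]]] Hx.
set L := size x in Hx *.
set I0 := fun i : nat => if i == 0 then L else nth 0 x i.-1.
have [//|R1 Hr1 [E1 En]] := add_repeat_ok (upd I0 1 (ntmp + narr)) _ Hrep.
have e1 : R1 1 = addr 0 L.+1.
  by rewrite E1; get_upd; rewrite /I0 eqxx /addr /narr /ntmp; lia.
have ej j : j != 1 -> R1 j = I0 j by move=> Hj; rewrite En // upd_neq.
pose R2 := upd (upd R1 (addr 0 L.+1) (I0 2)) 2 narr.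
pose R3 := upd (upd R2 1 (addr 0 L.+2)) (addr 0 L.+2) (I0 3).
pose R4 := upd (upd R3 1 (addr 0 L.+3)) (addr 0 L.+3) (I0 4).
pose R5 := upd (upd R4 2 0) 2 L.
have Ag j : 64 <= addr 0 j by apply: addr_ge.
have F0 : R5 0 = L.
  by have := Ag L.+1; have := Ag L.+2; have := Ag L.+3; move=> *;
     rewrite /R5 /R4 /R3 /R2; get_upd; rewrite ej.
have F2 : R5 2 = L by rewrite /R5; get_upd.
have FX j : 4 < j <= L -> R5 j = nth 0 x j.-1.
  move=> Hj; rewrite /R5 /R4 /R3 /R2.
  do ! (rewrite upd_neq; last by rewrite /addr /ntmp /narr; lia).
  by rewrite ej ?/I0; [case: eqP => //; lia|lia].
have [FL1 FL2 FL3] : [/\ R5 (addr 0 L.+1) = nth 0 x 1, R5 (addr 0 L.+2) = nth 0 x 2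
    & R5 (addr 0 L.+3) = nth 0 x 3].
  split; rewrite /R5 /R4 /R3 /R2; do ! (rewrite upd_neq; last by rewrite /addr /ntmp /narr; lia);
    exact: upd_eq.
have [|R6 Hr6 [K2 KX KY]] := load_loop_ok (X := fun j => nth 0 x j.-1)
  (Y := fun j => R5 (addr 0 j)) Hlp (leqnn L) F0 F2 FX _ (fun _ _ => erefl).
  by move=> j; lia.
have Aj1 j : addr 0 j != addr 1 0 by rewrite addr_inj.
exists (upd (upd (upd (upd R6 1 0) (addr 1 0) L) 0 (L + L)) 0 (4 * L)); split.
- apply: (@reaches_leq _ (1 + (32 + (8 + ((3 + L * 42) + 4))))); first by lia.
  apply: (@reaches_trans _ _ _ _ (1, upd I0 1 (ntmp + narr))).
    by apply: reaches_step; [eassumption|exact: reaches0].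
  apply: reaches_trans Hr1 _.
  apply: (@reaches_trans _ _ _ _ (41, R5)).
    do 8! (apply: reaches_step; [eassumption|rewrite /=]).
    have Z : R1 2 = I0 2 by rewrite ej.
    rewrite e1 Z -/R2.
    have -> : R2 1 + R2 2 = addr 0 L.+2.
      by rewrite /R2; have := Ag L.+1 => *; get_upd; rewrite e1 /addr /narr; lia.
    have -> : upd R2 1 (addr 0 L.+2) 1 = addr 0 L.+2 by rewrite upd_eq.
    have -> : upd R2 1 (addr 0 L.+2) 3 = I0 3.
      by rewrite /R2; have := Ag L.+1 => *; get_upd; rewrite ej.
    rewrite -/R3.
    have -> : R3 1 + R3 2 = addr 0 L.+3.
      rewrite /R3 /R2; have := Ag L.+1; have := Ag L.+2 => *; get_upd.
      by rewrite /addr /narr; lia.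
    have -> : upd R3 1 (addr 0 L.+3) 1 = addr 0 L.+3 by rewrite upd_eq.
    have -> : upd R3 1 (addr 0 L.+3) 4 = I0 4.
      by rewrite /R3 /R2; have := Ag L.+1; have := Ag L.+2 => *; get_upd; rewrite ej.
    rewrite -/R4.
    have -> : upd R4 2 0 2 + upd R4 2 0 0 = L.
      rewrite /R4 /R3 /R2; have := Ag L.+1; have := Ag L.+2; have := Ag L.+3 => *; get_upd.
      by rewrite ej.
    exact: reaches0.
  apply: reaches_trans Hr6 _.
  do 4! (apply: reaches_step; [eassumption|rewrite /=]).
  have A10 : 64 <= addr 1 0 by apply: addr_ge.
  have -> : upd R6 1 0 2 + upd R6 1 0 1 = L by get_upd; rewrite K2 addn0.
  have -> : upd (upd R6 1 0) (addr 1 0) L 2 = L by get_upd.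
  rewrite upd_eq (_ : L + L + (L + L) = 4 * L); last by lia.
  exact: reaches0.
- exact: upd_eq.
- split=> [i Hi||].
  + have := Ag i => *; get_upd.
    rewrite upd_neq // upd_neq ?KX //; lia.
  + by split; do 2! (rewrite upd_neq; last by rewrite /addr /ntmp; lia);
      rewrite upd_neq // (upd_neq _ _ (_ : _ != 1)) ?KY ?FL1 ?FL2 ?FL3 //;
      rewrite /addr /ntmp; lia.
  + by do 2! (rewrite upd_neq; last by rewrite /addr /ntmp; lia); rewrite upd_eq.
Qed.

Lemma prog_of_ok c res x : (cheight c).+1 <= ntmp -> carr c -> res < narr ->
  4 <= size x ->
  exists2 m, loaded x m & exists t,
    [/\ t <= 102 + 42 * size x + ccost (4 * size x) c,
        halted (prog_of c res) (run (prog_of c res) t (init_config x))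
      & accepts (run (prog_of c res) t (init_config x))
          = (exec (4 * size x) c m res 0 != 0)].
Proof.
move=> Hh Ha Hres Hx.
have [prog Eprog] : exists prog, prog = prog_of c res by eexists.
have [pre Epre] : exists pre, pre = prelude by eexists.
have Hc : code_at prog 0 prog by have := code_at_self [::] prog [::]; rewrite cats0.
rewrite -Eprog; rewrite {2}Eprog /prog_of -Epre in Hc.
case/code_at_cat: Hc => Hpre; rewrite add0n.
move=> /code_at_cat[Hmain [H0 [H1 [H2 _]]]].
have [R1 [Hr1 HN HL]] : exists R', [/\ reaches prog (100 + 42 * size x) (init_config x) (size pre, R'),
    R' 0 = 4 * size x & loaded x (fun a i => R' (addr a i))].
  by rewrite Epre in Hpre *; apply: prelude_ok.
exists (fun a i => R1 (addr a i)) => //.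
have Hs : sim (4 * size x) (fun a i => R1 (addr a i)) R1 by [].
have [R2 Hr2 [Hs2 _]] := ccmd_ok Hmain Hs isT Hh Ha.
have {Hr1 Hr2} : reaches prog (100 + 42 * size x + (ccost (4 * size x) c + 2)) (init_config x)
  ((size pre + size (ccmd c 1 (size pre))).+2,
   upd (upd R2 1 0) 0 (upd R2 1 0 (addr res 0) + upd R2 1 0 1)).
  apply: reaches_trans Hr1 _; apply: reaches_trans Hr2 _.
  by do 2! (apply: reaches_step; [eassumption|rewrite /=]); exact: reaches0.
move=> [t Ht Et]; exists t; split; first by lia.
  by rewrite Et /halted /= H2.
rewrite Et /accepts /=; have := addr_ge res 0; rewrite /ntmp => ?; get_upd.
by rewrite (proj2 Hs2) // addn0.
Qed.

Lemma size_le_input_size x : size x <= input_size x.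
Proof.
rewrite /input_size; elim: x => [|a x IH] /=; first by [].
by rewrite big_cons -addn1 addnC; apply: leq_add.
Qed.

(* The factor [4] makes room for the at most [2 n + 2 n] vertices of the matching problem. *)
Lemma poly_time_of_cmd (promise P : instance -> Prop) c res :
  (cheight c).+1 <= ntmp -> carr c -> res < narr ->
  (forall I m, promise I -> loaded (encode I) m ->
     exec (4 * size (encode I)) c m res 0 != 0 <-> P I) ->
  poly_time_decidable promise P.
Proof.
move=> Hh Ha Hres HP.
have [K [d Hcost]] := ccost_poly c.
exists (prog_of c res), (144 + K * 4 ^ d), d.+1 => I HI.
set x := encode I.
have Hx : 4 <= size x by rewrite /x /encode size_cat /=.
have [m Hm [t [Ht Hhalt Hacc]]] := prog_of_ok Hh Ha Hres Hx.
exists t; split; last by split=> //; rewrite Hacc; exact: HP.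
(* Every number has at least one bit, and no loop depends on the value of a number, so the length of
   the list controls the time. *)
have Hs := size_le_input_size x.
set S := (input_size x).+1.
apply: leq_trans Ht _.
have S1 : 0 < S ^ d by rewrite expn_gt0.
have : ccost (4 * size x) c <= K * 4 ^ d * S ^ d.
  apply: leq_trans (Hcost _) _; rewrite -mulnA -expnMn.
  apply: leq_mul => //.
  apply: (@leq_trans ((4 * S) ^ d)) => //.
  by case: (d) => // d'; rewrite leq_exp2r // /S; lia.
have : 102 + 42 * size x <= 144 * S by rewrite /S; lia.
have S2 : S <= S ^ d.+1 by rewrite expnS; nia.
have S3 : S ^ d <= S ^ d.+1 by rewrite expnS /S; nia.
move=> H1 H2; rewrite mulnDl; apply: leq_add.
  by apply: leq_trans H1 _; rewrite leq_mul2l S2.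
by apply: leq_trans H2 _; rewrite leq_mul2l S3 orbT.
Qed.

(** * Matchings *)

Lemma involution_even (T : finType) (S : {set T}) (f : T -> T) :
  (forall w, w \in S -> [/\ f w \in S, f (f w) = w & f w != w]) -> ~~ odd #|S|.
Proof.
elim: {S}#|S| {-2}S (leqnn #|S|) => [|n IHn] S leSn Hf.
  by move: leSn; rewrite leqn0 => /eqP ->.
have [-> | [w wS]] := set_0Vmem S; first by rewrite cards0.
have [fwS ffw fww] := Hf w wS.
have fwS' : f w \in S :\ w by rewrite !inE fww.
have Ecard : #|S| = #|S :\ w :\ f w|.+2.
  by rewrite (cardsD1 w S) wS (cardsD1 (f w) (S :\ w)) fwS'.
rewrite Ecard /= negbK; apply: IHn => [|u]; first by lia.
rewrite !inE => /and3P[ufw uw uS]; have [fuS ffu fuu] := Hf u uS.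
split=> //; rewrite fuS andbT; apply/andP; split.
- by apply: contra uw => /eqP E; rewrite -ffu E ffw.
- by apply: contra ufw => /eqP E; rewrite -ffu E.
Qed.

Lemma odd_sum_card (T : finType) (A : {set T}) (F : T -> nat) :
  (forall i, i \in A -> odd (F i)) -> odd (\sum_(i in A) F i) = odd #|A|.
Proof.
move=> HF; rewrite -sum1_card.
by elim/big_rec2: _ => // i m n iA E; rewrite !oddD E HF.
Qed.

Section Matching.
Variables (T : finType) (e : rel T).
Hypotheses (e_sym : symmetric e) (e_irr : irreflexive e).

(** As an involution whose fixed points are the exposed vertices, a matching is changed by updating
    a function at a few points. *)
Definition matching (M : T -> T) : Prop :=
  (forall v, M (M v) = v) /\ forall v, M v != v -> e v (M v).

Definition join (M : T -> T) (h t : T) : T -> T :=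
  fun w => if w == t then h else if w == h then t else M w.

(* When [h] is exposed and [t] is matched, moves the hole from [h] to the mate of [t]. *)
Definition hmove (M : T -> T) (h t : T) : T -> T :=
  fun w => if w == M t then M t else join M h t w.

Lemma e_neq u v : e u v -> u != v.
Proof. by apply: contraTneq => ->; rewrite e_irr. Qed.

Lemma matching_eq M M' : M =1 M' -> matching M -> matching M'.
Proof. by move=> E [H1 H2]; split=> v; rewrite -!E; [exact: H1|exact: H2]. Qed.

Lemma matching_join M h t : matching M -> M h = h -> M t = t -> e h t ->
  matching (join M h t) /\
  forall w, (join M h t w == w) = [&& M w == w, w != h & w != t].
Proof.
move=> [M1 M2] Mh Mt eht; have ht := e_neq eht; split.
  split=> v; rewrite /join.
  - case: (eqVneq v t) => [->|vt]; first by rewrite (negbTE ht) eqxx.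
    case: (eqVneq v h) => [->|vh]; first by rewrite eqxx.
    have -> : (M v == t) = false by apply: contraNF vt => /eqP E; rewrite -(M1 v) E Mt.
    have -> : (M v == h) = false by apply: contraNF vh => /eqP E; rewrite -(M1 v) E Mh.
    exact: M1.
  - case: (eqVneq v t) => [->|vt]; first by rewrite e_sym.
    by case: (eqVneq v h) => [->|vh] //; apply: M2.
move=> w; rewrite /join; case: (eqVneq w t) => [->|wt].
  by rewrite (negbTE ht) !andbF.
case: (eqVneq w h) => [->|wh]; last by rewrite !andbT.
by rewrite andbF eq_sym (negbTE ht).
Qed.

Lemma matching_hmove M h t : matching M -> M h = h -> M t != t -> e h t ->
  matching (hmove M h t) /\
  forall w, (hmove M h t w == w) = (w == M t) || ((M w == w) && (w != h)).
Proof.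
move=> [M1 M2] Mh Mt eht; have ht := e_neq eht; set z := M t in Mt *.
have Mz : M z = t by exact: M1.
have zh : z != h by apply: contra ht => /eqP E; rewrite -Mz E Mh.
split.
  split=> v; rewrite /hmove /join -/z.
  - case: (eqVneq v z) => [->|vz]; first by rewrite eqxx.
    case: (eqVneq v t) => [->|vt]; first by rewrite eq_sym (negbTE zh) (negbTE ht) eqxx.
    case: (eqVneq v h) => [->|vh]; first by rewrite eq_sym (negbTE Mt) eqxx.
    have -> : (M v == z) = false by apply: contraNF vt => /eqP E; rewrite -(M1 v) E Mz.
    have -> : (M v == t) = false by apply: contraNF vz => /eqP E; rewrite -(M1 v) E.
    have -> : (M v == h) = false by apply: contraNF vh => /eqP E; rewrite -(M1 v) E Mh.
    exact: M1.
  - case: (eqVneq v z) => [->|vz]; first by rewrite eqxx.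
    case: (eqVneq v t) => [->|vt]; first by rewrite e_sym.
    by case: (eqVneq v h) => [->|vh] //; apply: M2.
move=> w; rewrite /hmove /join -/z; case: (eqVneq w z) => [->|wz]; first by rewrite eqxx.
case: (eqVneq w t) => [->|wt] /=; first by rewrite -/z (negbTE Mt) (negbTE ht).
by case: (eqVneq w h) => [->|wh] /=; rewrite ?andbT ?andbF // eq_sym (negbTE ht).
Qed.

(* [Mt x] is the matching obtained from [M] by moving its hole from the root [r] to [x].  The
   fibres of [c] in [D] are the odd classes; by [pi_two] each [a] in [A] is matched into at
   most two of them. *)
Record phase_inv (M : T -> T) (r : T) (D : {set T}) (Mt : T -> T -> T)
    (A : {set T}) (c : T -> T) : Prop := PhaseInv {
  pi_M : matching M;
  pi_r : M r = r;
  pi_rD : r \in D;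
  pi_lab : forall w, w \in D -> c w \in D;
  pi_odd : forall l, l \in c @: D -> odd #|[set w in D | c w == l]|;
  pi_card : #|c @: D| = #|A|.+1;
  pi_dis : forall w, w \in A -> w \notin D;
  pi_fix : forall w, w \in D :|: A -> M w = w -> w = r;
  pi_DA : forall w, w \in D :|: A -> M w \in D :|: A;
  pi_mt : forall x, x \in D -> matching (Mt x);
  pi_expo : forall x w, x \in D ->
    (Mt x w == w) = (w == x) || ((M w == w) && (w != r));
  pi_out : forall x w, x \in D -> w \notin D :|: A -> Mt x w = M w;
  pi_A : forall x a, x \in D -> a \in A -> Mt x a \in D;
  pi_cross : forall x w, x \in D -> w \in D -> Mt x w \in D -> c (Mt x w) = c w;
  pi_two : forall a x1 x2 x3, a \in A -> x1 \in D -> x2 \in D -> x3 \in D ->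
    c (Mt x1 a) != c (Mt x2 a) ->
    c (Mt x3 a) = c (Mt x1 a) \/ c (Mt x3 a) = c (Mt x2 a) }.

(** * Growing [D] from an exposed root *)

Section Phase.
Variables (M : T -> T) (r : T) (D : {set T}) (Mt : T -> T -> T).
Variables (A : {set T}) (c : T -> T).
Hypothesis PI : phase_inv M r D Mt A c.

Lemma mt_inv x u : x \in D -> Mt x (Mt x u) = u.
Proof. by move=> xD; have [H _] := pi_mt PI xD; apply: H. Qed.

Lemma mt_self x : x \in D -> Mt x x = x.
Proof. by move=> xD; apply/eqP; rewrite (pi_expo PI) // eqxx. Qed.

Lemma mt_nofix x w : x \in D -> w \in D :|: A -> w != x -> Mt x w != w.
Proof.
move=> xD wDA wx; rewrite (pi_expo PI) // (negbTE wx) /=; apply/negP => /andP[/eqP Mw].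
by rewrite (pi_fix PI wDA Mw) eqxx.
Qed.

Lemma mt_DA x w : x \in D -> w \in D :|: A -> Mt x w \in D :|: A.
Proof.
move=> xD wDA; apply/negPn/negP => H.
have E := pi_out PI xD H; rewrite mt_inv // in E.
by case/negP: H; rewrite -((pi_M PI).1 (Mt x w)) -E; apply: (pi_DA PI).
Qed.

(* By [special_ex] and [special_inj] below, [special x] is a transversal of the classes. *)
Definition special (x : T) : {set T} := [set w in D | (w == x) || (Mt x w \in A)].

Lemma special_self x : x \in D -> x \in special x.
Proof. by move=> xD; rewrite inE xD eqxx. Qed.

Lemma special_mate x a : x \in D -> a \in A -> Mt x a \in special x.
Proof. by move=> xD aA; rewrite inE (pi_A PI) // mt_inv // aA orbT. Qed.

Lemma card_special x : x \in D -> #|special x| = #|A|.+1.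
Proof.
move=> xD.
have -> : special x = x |: (Mt x @: A).
  apply/setP=> w; rewrite !inE; apply/andP/orP => [[wD /orP[->|wA]]|[/eqP ->|/imsetP[a aA ->]]].
  - by left.
  - by right; rewrite -(mt_inv w xD); apply: imset_f.
  - by rewrite xD eqxx.
  - by rewrite (pi_A PI) // mt_inv // aA orbT.
rewrite cardsU1 card_imset; last by apply: (can_inj (g := Mt x)) => u; apply: mt_inv.
case: imsetP => // -[a aA E]; have := pi_dis PI aA.
by rewrite -(mt_inv a xD) -E mt_self // xD.
Qed.

Lemma special_notin x w : x \in D -> w \in D -> w \notin special x ->
  [/\ Mt x w \in D, c (Mt x w) = c w & Mt x w != w].
Proof.
move=> xD wD; rewrite inE wD /= negb_or => /andP[wx wA].
have wDA : w \in D :|: A by rewrite inE wD.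
have uD : Mt x w \in D by have := mt_DA xD wDA; rewrite inE (negbTE wA) orbF.
by split=> //; [apply: (pi_cross PI)|apply: mt_nofix].
Qed.

(** On a class without special vertices [Mt x] would be an involution without fixed points, against
    the odd size of the class. *)
Lemma special_ex x l : x \in D -> l \in c @: D -> exists2 s, s \in special x & c s = l.
Proof.
move=> xD lD.
have [/exists_inP[s ss /eqP cs]|] := boolP [exists s in special x, c s == l]; first by exists s.
move=> /exists_inPn Hn.
have /negP[] : ~~ odd #|[set w in D | c w == l]|; last exact: (pi_odd PI).
apply: (involution_even (f := Mt x)) => w.
rewrite !inE => /andP[wD /eqP cw].
have ws : w \notin special x by apply/negP => /Hn; rewrite cw eqxx.
by have [uD cu uw] := special_notin xD wD ws; rewrite uD cu cw eqxx mt_inv.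
Qed.

(** There are as many special vertices as classes, by [card_special] and [pi_card], and every class
    contains one. *)
Lemma special_inj x : x \in D -> {in special x &, injective c}.
Proof.
move=> xD; apply/imset_injP; rewrite card_special // -(pi_card PI).
apply/eqP; congr #|pred_of_set _|; apply/setP=> l; apply/imsetP/idP => [[s]|].
  by rewrite inE => /andP[sD _] ->; apply: imset_f.
by move=> /(special_ex xD)[s ss <-]; exists s.
Qed.

(** A perfect matching [f] cannot pair off an odd class internally, and by stuckness it can leave a
    class only into [A]. So every class has a vertex that [f] sends into [A], and there are more
    classes than vertices of [A]. *)
Lemma stuck_no_perfect (pres : pred T) :
  (forall u v, e u v -> pres u) -> pres r ->
  (forall x y, x \in D -> e x y -> y \in A \/ y \in D /\ c y = c x) ->
  ~ exists f : T -> T, forall v, pres v -> e v (f v) /\ f (f v) = v.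
Proof.
move=> Hpres prer stuck [f Hf].
have presD x : x \in D -> pres x.
  move=> xD; case: (eqVneq x r) => [-> //|xr]; apply: (Hpres x (M x)).
  apply: (pi_M PI).2; apply: contra xr => /eqP Mx.
  by apply/eqP; apply: (pi_fix PI) => //; rewrite inE xD.
pose B := [set w in D | f w \in A].
have HB : c @: D \subset c @: B.
  apply/subsetP=> l lD; apply: contraT => Hn.
  have /negP[] : ~~ odd #|[set w in D | c w == l]|; last exact: (pi_odd PI).
  apply: (involution_even (f := f)) => w.
  rewrite !inE => /andP[wD /eqP cw]; have [ew fw] := Hf w (presD w wD).
  have [fA|[fD cf]] := stuck _ _ wD ew.
    by case/negP: Hn; rewrite -cw; apply: imset_f; rewrite inE wD.
  by rewrite fD cf cw eqxx fw eq_sym e_neq.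
have := leq_trans (subset_leq_card HB) (leq_imset_card c B).
rewrite (pi_card PI) ltnNge => /negP; apply.
rewrite -(@card_in_imset _ _ f B); last first.
  move=> u v; rewrite !inE => /andP[uD _] /andP[vD _] E.
  by rewrite -(Hf u (presD u uD)).2 E (Hf v (presD v vD)).2.
by apply: subset_leq_card; apply/subsetP=> _ /imsetP[w + ->]; rewrite inE => /andP[].
Qed.

(* [V] is the component of [y] in the union of [Mt x] and [Mt y].  All classes that it meets
   are merged, together with the vertices of [A] in it, into the class of [x]. *)
Section Merge.
Variables (x y : T) (V : {set T}) (Mt' : T -> T -> T).
Hypotheses (xD : x \in D) (yD : y \in D) (xV : x \in V) (yV : y \in V).
Hypothesis V_DA : V \subset D :|: A.
Hypothesis V_x : forall w, w \in V -> Mt x w \in V.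
Hypothesis V_y : forall w, w \in V -> Mt y w \in V.
Hypothesis V_min : forall Q : {set T}, y \in Q ->
  (forall w, w \in Q -> Mt x w \in Q) -> (forall w, w \in Q -> Mt y w \in Q) ->
  V \subset Q.
Hypothesis Mt'_old : forall z, z \in D -> Mt' z =1 Mt z.
Hypothesis Mt'_matching : forall z, z \in V -> z \notin D -> matching (Mt' z).
Hypothesis Mt'_expo : forall z w, z \in V -> z \notin D ->
  (Mt' z w == w) = (w == z) || ((M w == w) && (w != r)).
Hypothesis Mt'_out : forall z w, z \in V -> z \notin D -> w \notin V -> Mt' z w = Mt x w.

Let met := c @: (V :&: D).
Let c' w := if (w \in V) || (c w \in met) then c x else c w.

(** The complement of [Q] in [V] is closed under both involutions and contains [y], so by minimality
    it is all of [V]. *)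
Lemma V_min_disjoint (Q : {set T}) : Q \subset V -> y \notin Q ->
  (forall w, w \in Q -> Mt x w \in Q) -> (forall w, w \in Q -> Mt y w \in Q) ->
  Q = set0.
Proof.
move=> QV yQ Qx Qy; apply/setP=> w; rewrite inE; apply/negP=> wQ.
have : V \subset V :\: Q.
  apply: V_min => [|u|u]; rewrite !inE ?yQ // => /andP[uQ uV].
  - by rewrite V_x // andbT; apply: contra uQ => /Qx; rewrite (mt_inv _ xD).
  - by rewrite V_y // andbT; apply: contra uQ => /Qy; rewrite (mt_inv _ yD).
by move=> /subsetP/(_ w (subsetP QV w wQ)); rewrite inE wQ.
Qed.

Lemma mem_met w : w \in V -> w \in D -> c w \in met.
Proof. by move=> wV wD; apply: imset_f; rewrite inE wV. Qed.

(* Otherwise the part of [V] in the class [l] is even by [Mt x], whereas [Mt y] makes it odd,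
   unless it is closed under both matchings, against the minimality of [V]. *)
Lemma met_special l : l \in met -> l != c x -> exists s, [/\ s \in V, s \in special x & c s = l].
Proof.
move=> lmet lx.
have lD : l \in c @: D by case/imsetP: lmet => w /setIP[_ wD] ->; apply: imset_f.
have [s ss cs] := special_ex xD lD; exists s; split=> //.
apply: contraT => sV.
pose Q := [set w in D | c w == l] :&: V.
have Qx w : w \in Q -> Mt x w \in Q /\ Mt x w != w.
  rewrite !inE -andbA => /and3P[wD /eqP cw wV].
  have ws : w \notin special x.
    by apply/negP => ws; case/negP: sV; rewrite (special_inj xD ss ws) // cs cw.
  by have [uD cu uw] := special_notin xD wD ws; rewrite uD cu cw eqxx V_x.
have Qne : Q != set0.
  case/imsetP: lmet => w /setIP[wV wD] El; apply/set0Pn; exists w.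
  by rewrite !inE wD El eqxx.
have Qeven : ~~ odd #|Q|.
  by apply: (involution_even (f := Mt x)) => w /Qx[]; rewrite mt_inv.
have [s' ss' cs'] := special_ex yD lD.
have s'D : s' \in D by move: ss'; rewrite inE => /andP[].
have Qy w : w \in Q -> w != s' -> Mt y w \in Q /\ Mt y w != w.
  rewrite !inE -andbA => /and3P[wD /eqP cw wV] ws'.
  have ws : w \notin special y.
    by apply/negP => ws; case/negP: ws'; apply/eqP; apply: (special_inj yD) => //; rewrite cs' cw.
  by have [uD cu uw] := special_notin yD wD ws; rewrite uD cu cw eqxx V_y.
have [s'V|s'V] := boolP (s' \in V); last first.
  case/negP: Qne; apply/eqP; apply: V_min_disjoint => [||w /Qx[]|w wQ] //.
  - by apply/subsetP=> w /setIP[].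
  - apply: contra s'V => yQ.
    rewrite (special_inj yD ss' (special_self yD)) // cs'.
    by move: yQ; rewrite !inE => /andP[/andP[_ /eqP ->]].
  - have ws' : w != s' by apply: contraNneq s'V => <-; move: wQ => /setIP[].
    by have [] := Qy w wQ ws'.
have s'Q : s' \in Q by rewrite !inE s'D cs' eqxx.
have : ~~ odd #|Q :\ s'|.
  apply: (involution_even (f := Mt y)) => w; rewrite in_setD1 => /andP[ws' wQ].
  have [uQ uw] := Qy w wQ ws'; split=> //; last exact: mt_inv.
  rewrite in_setD1 uQ andbT; apply/eqP => E.
  move: ss'; rewrite -E inE mt_inv // => /andP[uD /orP[/eqP E'|wA]].
    by case/negP: ws'; rewrite -E E' -(mt_inv w yD) E' mt_self.
  by have := pi_dis PI wA; move: wQ; rewrite !inE => /andP[/andP[->]].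
by move: Qeven; rewrite (cardsD1 s' Q) s'Q add1n /= negbK => ->.
Qed.

(** If both mates of [a] were in one class [l], they would be the special vertices of [l] for [x]
    and for [y]. Then [a] together with the part of [l] in [V] would be closed under both matchings
    without containing [y], against the minimality of [V]. *)
Lemma met_neq a : a \in A -> a \in V -> c (Mt x a) != c (Mt y a).
Proof.
move=> aA aV; apply/negP => /eqP E.
have := special_mate xD aA; have := special_mate yD aA.
have aD := pi_dis PI aA.
move El: (c (Mt x a)) E => l; move Es: (Mt x a) El => s; move Es': (Mt y a) => s'.
move=> cs /esym cs' ss' ss.
have nx : c x != l.
  apply/eqP => cx; have E := special_inj xD (special_self xD) ss (etrans cx (esym cs)).
  by move: aD; rewrite -(mt_inv a xD) Es -E mt_self // xD.
have ny : c y != l.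
  apply/eqP => cy; have E := special_inj yD (special_self yD) ss' (etrans cy (esym cs')).
  by move: aD; rewrite -(mt_inv a yD) Es' -E mt_self // yD.
pose Q := a |: [set w in D | c w == l] :&: V.
have Qz z b : z \in D -> Mt z a = b -> b \in special z -> c b = l ->
    (forall w, w \in V -> Mt z w \in V) -> forall w, w \in Q -> Mt z w \in Q.
  move=> zD Eb sb cb Vz w; rewrite !inE => /orP[/eqP ->|/andP[/andP[wD /eqP cw] wV]].
    rewrite Eb cb eqxx; move: (sb); rewrite inE => /andP[-> _] /=.
    by rewrite -Eb Vz ?orbT.
  have [ws|ws] := boolP (w \in special z).
    by rewrite (special_inj zD ws sb) ?cw // -Eb mt_inv // eqxx.
  by have [uD cu _] := special_notin zD wD ws; rewrite uD cu cw eqxx Vz ?orbT.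
suff : Q = set0 by move/setP/(_ a); rewrite !inE eqxx.
apply: V_min_disjoint.
- by apply/subsetP=> w; rewrite !inE => /orP[/eqP ->|/andP[]].
- rewrite !inE (negbTE ny) andbF orbF.
  by apply: contraNneq aD => <-.
- exact: (Qz x s).
- exact: (Qz y s').
Qed.

(** Every met class except that of [x] has its special vertex for [x] in [V], and the mate of that
    vertex is in [A :&: V]; this is a bijection. Merging thus removes equally many classes and
    vertices of [A], which preserves [pi_card]. *)
Lemma card_met : #|met| = #|A :&: V|.+1.
Proof.
rewrite (cardsD1 (c x)) mem_met //= add1n; congr _.+1.
rewrite -(@card_in_imset _ _ (fun a => c (Mt x a)) (A :&: V)).
  congr #|pred_of_set _|; apply/setP=> l; rewrite !inE; apply/andP/imsetP => [[lx lmet]|[a /setIP[aA aV] ->]].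
    have [s [sV ss cs]] := met_special lmet lx; exists (Mt x s); last by rewrite mt_inv.
    rewrite inE V_x // andbT; move: ss; rewrite inE => /andP[_ /orP[/eqP E|//]].
    by rewrite -cs E eqxx in lx.
  split; last by apply: mem_met; [exact: V_x|exact: (pi_A PI)].
  apply/eqP => E; have := special_inj xD (special_mate xD aA) (special_self xD) E.
  move=> E'; have := pi_dis PI aA; rewrite -(mt_inv a xD) E' mt_self // xD //.
move=> a b /setIP[aA _] /setIP[bA _] E.
rewrite -(mt_inv a xD) -(mt_inv b xD).
by rewrite (special_inj xD (special_mate xD aA) (special_mate xD bA) E).
Qed.

Lemma DA_merge : (D :|: V) :|: (A :\: V) = D :|: A.
Proof.
apply/setP=> w; have := subsetP V_DA w; rewrite !inE.
by case: (w \in D) => //=; case: (w \in V) => //= H; rewrite H.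
Qed.

Lemma c'E w : w \in D -> c' w = if c w \in met then c x else c w.
Proof. by move=> wD; rewrite /c'; case: (boolP (w \in V)) => //= wV; rewrite mem_met. Qed.

Lemma c'V w : w \in V -> c' w = c x.
Proof. by rewrite /c' => ->. Qed.

Lemma Mt'_V z w : z \in V -> z \notin D -> (Mt' z w \in V) = (w \in V).
Proof.
move=> zV zD; have Hout u : u \notin V -> Mt' z u \notin V.
  by move=> uV; rewrite Mt'_out //; apply: contra uV => /V_x; rewrite mt_inv.
apply/idP/idP; first by apply: contraTT; apply: Hout.
apply: contraTT => /Hout; have [H _] := Mt'_matching zV zD.
by rewrite H.
Qed.

Lemma Mt'_A z a : z \in D :|: V -> a \in A -> a \notin V -> Mt' z a \in D.
Proof.
move=> + aA aV; have [zD _|zD] := boolP (z \in D); first by rewrite Mt'_old // (pi_A PI).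
by rewrite inE (negbTE zD) => zV; rewrite Mt'_out // (pi_A PI).
Qed.

(** Here [pi_two] is used: the two classes into which [a] can be matched are those of its mates
    under [Mt x] and [Mt y], and both are met. So [a] can join the merged class without violating
    [pi_cross] for any older matching. *)
Lemma merge_cross_A z a : z \in D -> a \in A -> a \in V -> c' (Mt z a) = c x.
Proof.
move=> zD aA aV; rewrite c'E ?(pi_A PI) //.
have mx : c (Mt x a) \in met by apply: mem_met; [exact: V_x|exact: (pi_A PI)].
have my : c (Mt y a) \in met by apply: mem_met; [exact: V_y|exact: (pi_A PI)].
by have [-> | ->] := pi_two PI aA xD yD zD (met_neq aA aV); rewrite ?mx ?my.
Qed.

Lemma merge_labels : c' @: (D :|: V) = c x |: (c @: D :\: met).
Proof.
apply/setP=> l; rewrite !inE; apply/imsetP/idP => [[w wDV ->]|].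
  have [wD|wD] := boolP (w \in D); last first.
    by move: wDV; rewrite inE (negbTE wD) => /c'V ->; rewrite eqxx.
  rewrite c'E //; case: ifP => [_|->]; first by rewrite eqxx.
  by rewrite imset_f ?orbT.
case/orP => [/eqP ->|/andP[lmet /imsetP[w wD El]]].
  by exists x; rewrite ?c'V // inE xD.
by exists w; rewrite ?inE ?wD // c'E // -El (negbTE lmet).
Qed.

(** The merged class consists of the vertices of [A :&: V] and of one more odd class than there are
    such vertices. *)
Lemma merge_odd l : l \in c' @: (D :|: V) -> odd #|[set w in D :|: V | c' w == l]|.
Proof.
rewrite merge_labels !inE; have [-> _|lx /= /andP[lmet lD]] := eqVneq l (c x); last first.
  have -> : [set w in D :|: V | c' w == l] = [set w in D | c w == l]; last exact: (pi_odd PI).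
  apply/setP=> w; rewrite !inE; have [wD|wD] := boolP (w \in D) => /=.
    rewrite c'E //; case: ifP => // cw.
    by rewrite eq_sym (negbTE lx); apply/esym/negbTE; apply: contraNneq lmet => <-.
  by apply/negbTE/negP => /andP[/c'V ->]; rewrite eq_sym (negbTE lx).
have -> : [set w in D :|: V | c' w == c x] = (A :&: V) :|: [set w in D | c w \in met].
  apply/setP=> w; rewrite !inE; have [wD|wD] := boolP (w \in D) => /=.
    have -> /= : (w \in A) = false by apply/negbTE; apply: contraL wD; apply: (pi_dis PI).
    rewrite c'E //; case: ifP => [_|cw]; first by rewrite eqxx.
    by apply: contraFF cw => /eqP ->; apply: mem_met.
  rewrite orbF; apply/andP/andP => [[wV _]|[wA wV]]; last by rewrite c'V // eqxx.
  by split=> //; have := subsetP V_DA w wV; rewrite inE (negbTE wD).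
rewrite cardsU (_ : (A :&: V) :&: _ = set0) ?cards0 ?subn0; last first.
  apply/setP=> w; rewrite !inE; apply/negbTE/negP => /andP[/andP[wA _] /andP[wD _]].
  by have := pi_dis PI wA; rewrite wD.
rewrite oddD.
have -> : #|[set w in D | c w \in met]| = \sum_(l in met) #|[set w in D | c w == l]|.
  rewrite -sum1_card (partition_big c (mem met)) => [|w]; last by rewrite inE => /andP[].
  apply: eq_bigr => l' l'met; rewrite -sum1_card; apply: eq_bigl => w.
  rewrite !inE; case: eqP => [->|_]; last by rewrite !andbF.
  by rewrite (l'met : l' \in met) !andbT.
rewrite odd_sum_card => [|l' l'met]; first by rewrite card_met /= addbN addbb.
by apply: (pi_odd PI); case/imsetP: l'met => w /setIP[_ wD] ->; apply: imset_f.
Qed.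

Lemma merge_inv : phase_inv M r (D :|: V) Mt' (A :\: V) c'.
Proof.
split.
- exact: (pi_M PI).
- exact: (pi_r PI).
- by rewrite inE (pi_rD PI).
- move=> w; rewrite !inE /c'; case: ifP => [_ _|]; first by rewrite (pi_lab PI xD).
  by case: (w \in V) => //= _; rewrite orbF => wD; rewrite (pi_lab PI).
- exact: merge_odd.
- rewrite merge_labels cardsU1 !inE mem_met // add1n; congr _.+1.
  have := cardsID V A; have := cardsID met (c @: D).
  have -> : c @: D :&: met = met.
    by apply/setIidPr/subsetP=> _ /imsetP[w /setIP[_ wD] ->]; apply: imset_f.
  by rewrite card_met (pi_card PI); lia.
- move=> w; rewrite !inE => /andP[wV wA].
  by rewrite (negbTE wV) orbF; apply: (pi_dis PI).
- by move=> w; rewrite DA_merge; apply: (pi_fix PI).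
- by move=> w; rewrite DA_merge; apply: (pi_DA PI).
- move=> z; rewrite inE; have [zD _|zD /= zV] := boolP (z \in D); last exact: Mt'_matching.
  by apply: matching_eq (pi_mt PI zD) => w; rewrite Mt'_old.
- move=> z w; rewrite inE; have [zD _|zD /= zV] := boolP (z \in D); last exact: Mt'_expo.
  by rewrite Mt'_old // (pi_expo PI).
- move=> z w; rewrite DA_merge inE => + wDA.
  have [zD _|zD /= zV] := boolP (z \in D); first by rewrite Mt'_old // (pi_out PI).
  rewrite Mt'_out ?(pi_out PI) //; apply: contra wDA; exact: subsetP V_DA w.
- move=> z a zDV; rewrite !inE => /andP[aV aA]; by rewrite Mt'_A.
- move=> z w zDV wDV uDV.
  have [zD|zD] := boolP (z \in D); last first.
    have zV : z \in V by move: zDV; rewrite inE (negbTE zD).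
    have [wV|wV] := boolP (w \in V); first by rewrite !c'V ?Mt'_V.
    have uV : Mt' z w \notin V by rewrite Mt'_V.
    have wD : w \in D by move: wDV; rewrite inE (negbTE wV) orbF.
    have uD : Mt' z w \in D by move: uDV; rewrite inE (negbTE uV) orbF.
    rewrite Mt'_out // in uV uD *.
    by rewrite !c'E // (pi_cross PI).
  rewrite Mt'_old // in uDV *.
  (* The vertices that are new in [D :|: V] come from [A], so an old matching sends them into met
     classes. *)
  have VD u : u \in D :|: V -> u \notin D -> u \in V /\ u \in A.
    rewrite inE => /orP[-> //|uV] uD; split=> //.
    by have := subsetP V_DA u uV; rewrite inE (negbTE uD).
  have [wD|wD] := boolP (w \in D); last first.
    by have [wV wA] := VD w wDV wD; rewrite merge_cross_A // c'V.
  have [uD|uD] := boolP (Mt z w \in D); first by rewrite !c'E // (pi_cross PI).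
  have [uV uA] := VD _ uDV uD.
  by rewrite c'V // -{1}(mt_inv w zD) merge_cross_A.
- move=> a x1 x2 x3; rewrite inE => /andP[aV aA] D1 D2 D3.
  have HE z : z \in D :|: V -> exists2 z', z' \in D & Mt' z a = Mt z' a.
    move=> zDV; have [zD|zD] := boolP (z \in D); first by exists z; rewrite ?Mt'_old.
    exists x => //; apply: Mt'_out => //.
    by move: zDV; rewrite inE (negbTE zD).
  have [z1 Dz1 ->] := HE x1 D1; have [z2 Dz2 ->] := HE x2 D2; have [z3 Dz3 ->] := HE x3 D3.
  rewrite !c'E ?(pi_A PI) // => H.
  have c12 : c (Mt z1 a) != c (Mt z2 a) by apply: contraNneq H => ->.
  by have [-> | ->] := pi_two PI aA Dz1 Dz2 Dz3 c12; [left|right].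
Qed.

(** This is the case of an edge that changes nothing: the walk meets no vertex of [A], so [card_met]
    leaves a single class. The conclusion is one of the two alternatives in [stuck_no_perfect]. *)
Lemma merge_trivial : V \subset D -> c y = c x.
Proof.
move=> VD; have A0 : A :&: V = set0.
  apply/setP=> w; rewrite !inE; apply/negbTE/negP => /andP[wA /(subsetP VD) wD].
  by have := pi_dis PI wA; rewrite wD.
have /eqP/cards1P[l El] : #|met| = 1 by rewrite card_met A0 cards0.
by have := mem_met xV xD; have := mem_met yV yD; rewrite El !inE => /eqP -> /eqP ->.
Qed.

End Merge.

Definition exposed (N : T -> T) : {set T} := [set v | N v == v].

(** No vertex becomes exposed that was not so in [M], and the root is now matched. *)
Lemma augment x y : x \in D -> e x y -> Mt x y = y ->
  matching (join (Mt x) x y) /\ #|exposed (join (Mt x) x y)| < #|exposed M|.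
Proof.
move=> xD exy xy.
have [Hm He] := matching_join (pi_mt PI xD) (mt_self xD) xy exy.
split=> //; apply/proper_card/properP; split.
  apply/subsetP=> w; rewrite !inE He (pi_expo PI) // => /and3P[+ wx _].
  by rewrite (negbTE wx) => /andP[].
exists r; first by rewrite inE (pi_r PI).
rewrite inE He (pi_expo PI) // eqxx andbF orbF.
by case: eqP.
Qed.

Lemma mate_outside x y : x \in D -> y \notin D -> y \notin A -> Mt x y \notin D :|: A.
Proof.
move=> xD yD yA; have yDA : y \notin D :|: A by rewrite inE negb_or yD.
by rewrite (pi_out PI) //; apply: contra yDA => /(pi_DA PI); rewrite (pi_M PI).1.
Qed.

(** The old matchings agree with [M] outside [D :|: A] and so match [y] to [z], whereas the new one
    matches [y] to [x]. Hence [y] enters [A] with two possible mates, as [pi_two] allows, and [z]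
    forms a class of its own. *)
Lemma grow x y (Mt' : T -> T -> T) : x \in D -> e x y -> y \notin D -> y \notin A -> Mt x y != y ->
  let z := Mt x y in
  (forall w, w \in D -> Mt' w =1 Mt w) -> Mt' z =1 hmove (Mt x) x y ->
  phase_inv M r (z |: D) Mt' (y |: A) (fun w => if w == z then z else c w).
Proof.
move=> xD exy yD yA xy z Hold Hnew.
have Ez : Mt x y = z by [].
rewrite Ez in xy; clearbody z.
have yDA : y \notin D :|: A by rewrite inE negb_or yD.
have zE : z = M y by rewrite -Ez (pi_out PI).
have Mz : M z = y by rewrite zE (pi_M PI).1.
have zDA : z \notin D :|: A by rewrite -Ez mate_outside.
have zD : z \notin D by apply: contra zDA; rewrite inE => ->.
have zA : z \notin A by apply: contra zDA; rewrite inE orbC => ->.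
have xy' : Mt x y != y by rewrite Ez.
have [Wm We] := matching_hmove (pi_mt PI xD) (mt_self xD) (xy' : Mt x y != y) exy.
set W := hmove (Mt x) x y in Hnew Wm We.
have yx : y != x by apply: contraNneq yD => ->.
have zx : z != x by apply: contraNneq zD => ->.
have Wy : W y = x by rewrite /W /hmove /join Ez eq_sym (negbTE xy) eqxx.
have Wz : W z = z by rewrite /W /hmove Ez eqxx.
have Wx : W x = y.
  by rewrite /W /hmove /join Ez ![x == _]eq_sym (negbTE zx) (negbTE yx) eqxx.
have Wout w : w != x -> w != y -> w != z -> W w = Mt x w.
  by move=> wx wy wz; rewrite /W /hmove /join Ez (negbTE wx) (negbTE wy) (negbTE wz).
have nD w : w \in D -> (w == z) = false by move=> wD; apply/negbTE; apply: contraNneq zD => <-.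
have Mty w : w \in D -> Mt w y = z by move=> wD; rewrite (pi_out PI) // -zE.
have Mtz w : w \in D -> Mt w z = y by move=> wD; rewrite (pi_out PI) // Mz.
have AE w : w \in A -> [/\ w != x, w != y & w != z].
  move=> wA; split; [|by apply: contraNneq yA => <-|by apply: contraNneq zA => <-].
  by apply: contraTneq wA => ->; apply/negP => /(pi_dis PI); rewrite xD.
have DAE : (z |: D) :|: (y |: A) = z |: (y |: (D :|: A)).
  by apply/setP=> w; rewrite !inE; case: (w == z); case: (w == y); case: (w \in D).
split.
- exact: (pi_M PI).
- exact: (pi_r PI).
- by rewrite inE (pi_rD PI) orbT.
- move=> w; rewrite !inE; case: eqP => [_ _|_ /= wD]; first by rewrite eqxx.
  by rewrite (pi_lab PI) ?orbT.
- move=> l /imsetP[w]; rewrite !inE; case: eqP => [_ _ -> |_ /= wD ->].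
    rewrite (_ : [set _ in _ | _] = [set z]) ?cards1 //.
    apply/setP=> u; rewrite !inE; case: (eqVneq u z) => [_|uz] /=; first by rewrite eqxx.
    by apply/negbTE/negP => /andP[/(pi_lab PI)/nD ->].
  rewrite (_ : [set _ in _ | _] = [set u in D | c u == c w]); first by apply: (pi_odd PI); apply: imset_f.
  apply/setP=> u; rewrite !inE; case: (eqVneq u z) => [->|uz] //=.
  by rewrite eq_sym nD ?(pi_lab PI) // (negbTE zD).
- rewrite cardsU1 yA add1n -(pi_card PI) imsetU1 eqxx.
  have -> : (fun w => if w == z then z else c w) @: D = c @: D.
    by apply: eq_in_imset => w /nD ->.
  rewrite cardsU1 (_ : z \notin _) //; apply/negP => /imsetP[w wD E].
  by have := pi_lab PI wD; rewrite -E (negbTE zD).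
- move=> w; rewrite !inE => /orP[/eqP ->|wA]; first by rewrite negb_or yD eq_sym xy.
  by have [_ _ wz] := AE w wA; rewrite negb_or wz (pi_dis PI).
- move=> w; rewrite DAE !inE => /or3P[/eqP ->|/eqP ->|wDA].
  + by rewrite Mz => E; rewrite E eqxx in xy.
  + by rewrite -zE => E; case/eqP: xy.
  + by apply: (pi_fix PI); rewrite inE.
- move=> w; rewrite DAE !inE => /or3P[/eqP ->|/eqP ->|wDA].
  + by rewrite Mz eqxx orbT.
  + by rewrite -zE eqxx.
  + by have := pi_DA PI (w := w); rewrite !inE => /(_ wDA) ->; rewrite !orbT.
- move=> w; rewrite inE => /orP[/set1P ->|wD]; first by apply: matching_eq Wm => u; rewrite Hnew.
  by apply: matching_eq (pi_mt PI wD) => u; rewrite Hold.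
- move=> w u; rewrite inE => /orP[/set1P ->|wD]; last by rewrite Hold // (pi_expo PI).
  rewrite Hnew We Ez; case: (eqVneq u z) => //= uz.
  rewrite (pi_expo PI) //; case: (eqVneq u x) => [->|ux] /=; last by rewrite andbT.
  apply/esym/negbTE/negP => /andP[/eqP Mx]; rewrite (pi_fix PI _ Mx) ?eqxx //.
  by rewrite inE xD.
- move=> w u; rewrite DAE inE => wzD; rewrite !inE !negb_or => /and3P[uz uy uDA].
  have uDA' : u \notin D :|: A by rewrite inE negb_or.
  case/orP: wzD => [/set1P ->|wD]; last by rewrite Hold // (pi_out PI).
  rewrite Hnew Wout ?(pi_out PI) //.
  by apply: contraNneq uDA' => ->; rewrite inE xD.
- move=> w a; rewrite !inE => /orP[/eqP ->|wD] /orP[/eqP ->|aA].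
  + by rewrite Hnew Wy xD orbT.
  + by have [ax ay az] := AE a aA; rewrite Hnew Wout // (pi_A PI) ?orbT.
  + by rewrite Hold // Mty // eqxx.
  + by rewrite Hold // (pi_A PI) ?orbT.
- move=> w u; rewrite !inE => /orP[/eqP ->|wD] /orP[/eqP ->|uD].
  + by rewrite Hnew Wz eqxx.
  + rewrite Hnew; case: (eqVneq u x) => [->|ux].
      by rewrite Wx (negbTE yD) orbF => /eqP E; rewrite E eqxx in xy.
    have uy : u != y by apply: contraNneq yD => <-.
    have uz : u != z by rewrite nD.
    rewrite Wout // => /orP[/eqP E|vD].
      by case/negP: uy; rewrite -(mt_inv u xD) E Mtz.
    by rewrite !nD // (pi_cross PI).
  + by rewrite Hold // Mtz // (negbTE yD) orbF => /eqP E; rewrite E eqxx in xy.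
  + rewrite Hold // => /orP[/eqP E|vD]; last by rewrite !nD // (pi_cross PI).
    by case/negP: yD; rewrite -(Mtz w wD) -E mt_inv.
- move=> a x1 x2 x3; rewrite inE => /orP[/set1P ->|aA] D1 D2 D3.
  + have HE w : w \in z |: D -> Mt' w y = x /\ w = z \/ Mt' w y = z.
      rewrite !inE => /orP[/eqP ->|wD]; first by left; rewrite Hnew Wy.
      by right; rewrite Hold // Mty.
    by case: (HE _ D1) => [[-> _]|->]; case: (HE _ D2) => [[-> _]|->];
       case: (HE _ D3) => [[-> _]|->]; rewrite ?eqxx //; auto.
  + have HE w : w \in z |: D -> exists2 w', w' \in D & Mt' w a = Mt w' a.
      rewrite !inE => /orP[/eqP ->|wD]; last by exists w; rewrite ?Hold.
      by exists x => //; have [ax ay az] := AE a aA; rewrite Hnew Wout.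
    have [z1 Dz1 ->] := HE x1 D1; have [z2 Dz2 ->] := HE x2 D2; have [z3 Dz3 ->] := HE x3 D3.
    by rewrite !nD ?(pi_A PI) //; apply: (pi_two PI).
Qed.

Lemma phase_inv_ext (Mt' : T -> T -> T) :
  (forall u, u \in D -> Mt' u =1 Mt u) -> phase_inv M r D Mt' A c.
Proof.
move=> E; case: PI => *; split=> //.
- by move=> u uD; apply: (@matching_eq (Mt u)) => [w|]; rewrite ?E //; apply: (pi_mt PI).
- by move=> u w uD; rewrite E // (pi_expo PI).
- by move=> u w uD wDA; rewrite E // (pi_out PI).
- by move=> u a uD aA; rewrite E // (pi_A PI).
- by move=> u w uD; rewrite E //; apply: (pi_cross PI).
- by move=> a x1 x2 x3 aA D1 D2 D3; rewrite !E //; apply: (pi_two PI).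
Qed.

(** * Alternating walks in the union of two stored matchings *)

Section Walk.
Variables (x y : T).
Hypotheses (xD : x \in D) (yD : y \in D) (exy : e x y).

(* [V] is the set of vertices visited so far, [h] the current hole of [W] and [t] the next
   vertex of the alternating walk from [y] towards [x] in the union of [Mt y] and [Mt x]. *)
Record walk_inv (V : {set T}) (W : T -> T) (h t : T) (D' : {set T}) (Mt' : T -> T -> T) : Prop :=
  WalkInv {
  wi_x : x \in V;
  wi_h : h \in V;
  wi_t : t \notin V;
  wi_tD : t \in D;
  wi_e : e h t;
  wi_y : y \in t |: V;
  wi_V : V \subset D :|: A;
  wi_Mx : forall w, w \in V -> Mt x w \in V;
  wi_My : forall w, w \in V -> w != x -> w != h -> [/\ Mt y w \in V, Mt y w != x & Mt y w != h];
  wi_ht : (h = x /\ t = y) \/ (h != x /\ Mt y h = t);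
  wi_min : forall Q : {set T}, y \in Q -> (forall w, w \in Q -> Mt x w \in Q) ->
    (forall w, w \in Q -> Mt y w \in Q) -> t |: V \subset x |: Q;
  wi_sp : forall w, w \in t |: V -> w \in D -> w != x ->
    exists2 s, s \in t |: V & s \in special y /\ c s = c w;
  wi_W : matching W;
  wi_We : forall w, (W w == w) = (w == h) || ((M w == w) && (w != r));
  wi_Wout : forall w, w \notin V -> W w = Mt x w;
  wi_D' : D' = D :|: V;
  wi_old : forall z, z \in D -> Mt' z =1 Mt z;
  wi_new : forall z, z \in V -> z \notin D ->
    [/\ matching (Mt' z),
        forall w, (Mt' z w == w) = (w == z) || ((M w == w) && (w != r))
      & forall w, w \notin V -> Mt' z w = Mt x w] }.

Lemma walk_start : walk_inv [set x] (Mt x) x y D Mt.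
Proof.
have yx : y != x by rewrite eq_sym e_neq.
split=> //.
- exact: set11.
- exact: set11.
- by rewrite inE.
- by rewrite !inE eqxx.
- by apply/subsetP=> w /set1P ->; rewrite inE xD.
- by move=> w /set1P ->; rewrite mt_self // set11.
- by move=> w /set1P ->; rewrite eqxx.
- by left.
- by move=> Q yQ _ _; apply/subsetP=> w; rewrite !inE => /orP[/eqP ->|->]; rewrite ?yQ ?orbT.
- move=> w; rewrite !inE => /orP[/eqP ->|/eqP ->]; last by rewrite eqxx.
  by move=> _ _; exists y; rewrite ?inE ?eqxx ?yD //; split=> //; rewrite inE yD eqxx.
- exact: (pi_mt PI).
- by move=> w; apply: (pi_expo PI).
- by apply/esym/setUidPl/subsetP=> w /set1P ->.
- by move=> z /set1P ->; rewrite xD.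
Qed.

(** A row that is already meaningful is never replaced, so during a walk the rows of the old [D],
    and in particular those of [x] and [y], stay as they were. *)
Definition walk_table (D' : {set T}) (Mt' : T -> T -> T) (z : T) (W : T -> T) : T -> T -> T :=
  if z \in D' then Mt' else fun u => if u == z then W else Mt' u.

(** The next vertex [t1] is again in [D]. If [z] is in [A], this is [pi_A]; otherwise [wi_sp] places
    the only special vertex for [y] in the class of [z] among the earlier vertices, so [z] is not
    special. When [t1] is [x], the visited set is closed under both matchings and the merge
    applies. *)
Lemma walk_step V W h t D' Mt' Mt'' : walk_inv V W h t D' Mt' ->
  let z := Mt x t in let W1 := hmove W h t in let t1 := Mt y z in
  let V1 := z |: (t |: V) in
  (forall u, u \in z |: D' -> Mt'' u =1 walk_table D' Mt' z W1 u) ->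
  [/\ W t = z, z != t, #|V1| = #|V|.+2
    & if t1 == x then exists A' c', [/\ phase_inv M r (z |: D') Mt'' A' c', D \subset z |: D'
           & z |: D' = D -> phase_inv M r (z |: D') Mt'' A c /\ c y = c x]
      else walk_inv V1 W1 z t1 (z |: D') Mt''].
Proof.
move=> WI z W1 t1 V1 Htab.
have := WI; case=> xV hV tV tD eht yV VDA VMx VMy Vht Vmin Vsp Wm We Wout D'E Hold Hnew.
have tx : t != x by apply: contraNneq tV => ->.
have tDA : t \in D :|: A by rewrite inE tD.
have zt : z != t by apply: mt_nofix.
have xz : Mt x z = t by apply: mt_inv.
have zV : z \notin V by apply: contra tV => /VMx; rewrite xz.
have Wt : W t = z by rewrite Wout.
have zDA : z \in D :|: A by apply: mt_DA.
have V1E w : (w \in V1) = [|| w == z, w == t | w \in V] by rewrite !inE.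
have cV1 : #|V1| = #|V|.+2.
  by rewrite cardsU1 inE negb_or in_set1 zt zV cardsU1 tV !add1n.
have Wt' : W t != t by rewrite Wt.
have Wh : W h = h by apply/eqP; rewrite We eqxx.
have [W1m W1e] := matching_hmove Wm Wh Wt' eht; rewrite -/W1 in W1m W1e.
have W1e' w : (W1 w == w) = (w == z) || ((M w == w) && (w != r)).
  rewrite W1e Wt We; case: (eqVneq w h) => [->|wh] /=; last by rewrite andbT.
  rewrite orbF; apply/esym; case: eqP => //= _; apply/negbTE/negP => /andP[/eqP Mh hr].
  by case/negP: hr; apply/eqP/(pi_fix PI) => //; apply: subsetP VDA h hV.
have W1out w : w \notin V1 -> W1 w = Mt x w.
  rewrite V1E !negb_or => /and3P[wz wt wV].
  rewrite /W1 /hmove /join Wt (negbTE wz) (negbTE wt) -Wout //.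
  by case: eqP wV => [->|//]; rewrite hV.
have V1DA : V1 \subset D :|: A.
  by apply/subsetP=> w; rewrite V1E => /or3P[/eqP ->|/eqP ->|/(subsetP VDA)].
have V1Mx w : w \in V1 -> Mt x w \in V1.
  rewrite !V1E => /or3P[/eqP ->|/eqP ->|wV]; first by rewrite xz eqxx orbT.
    by rewrite -/z eqxx.
  by rewrite VMx // !orbT.
have zx : z != x by apply: contraNneq zV => ->.
have V1My w : w \in V1 -> w != x -> w != z -> [/\ Mt y w \in V1, Mt y w != x & Mt y w != z].
  move=> + wx wz; rewrite V1E (negbTE wz) /= => /orP[/eqP ->|wV].
    case: Vht => [[_ Ety]|[hx Eh]].
      by rewrite -Ety mt_self // V1E eqxx orbT [t == z]eq_sym.
    rewrite -Eh (mt_inv h yD) V1E hV !orbT; split=> //.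
    by apply: contraNneq zV => <-.
  case: (eqVneq w h) => [wh|wh]; last first.
    have [uV ux uh] := VMy w wV wx wh; rewrite V1E uV !orbT; split=> //.
    by apply: contraNneq zV => <-.
  case: Vht => [[hx _]|[hx Eh]]; first by rewrite wh hx eqxx in wx.
  by rewrite wh Eh V1E eqxx orbT [t == z]eq_sym.
have yV1 : y \in V1 by move: yV; rewrite V1E !inE => ->; rewrite orbT.
have zy : z != y.
  by apply: contraTneq yV => <-; rewrite !inE negb_or zt.
have t1z : t1 != z by apply: mt_nofix.
(* A visited vertex other than [x] and [z] has a mate under [Mt y] different from [z], whereas the
   mate of [t1] is [z]. *)
have t1V : t1 != x -> t1 \notin V1.
  move=> t1x; apply/negP => t1V1; have [_ _] := V1My t1 t1V1 t1x t1z.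
  by rewrite /t1 mt_inv // eqxx.
have spz : z \in D -> exists2 s, s \in t |: V & s \in special y /\ c s = c z.
  move=> zD; have Ec : c z = c t by apply: (pi_cross PI).
  by rewrite Ec; apply: Vsp; rewrite ?inE ?eqxx.
have zsp : z \in D -> z \notin special y.
  move=> zD; have [s sV [ss cs]] := spz zD; apply/negP => zs.
  move: sV; rewrite (special_inj yD ss zs cs) !inE => /orP[|zV'].
    by rewrite (negbTE zt).
  by rewrite zV' in zV.
have t1D : t1 \in D.
  have [zD|zD] := boolP (z \in D); first by have [] := special_notin yD zD (zsp zD).
  by apply: (pi_A PI) => //; move: zDA; rewrite inE (negbTE zD).
have z1E : z |: D' = D :|: V1.
  apply/setP=> w; rewrite D'E !inE; case: (w == z) => /=; first by rewrite orbT.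
  by case: (eqVneq w t) => [->|] //=; rewrite tD.
have zD'E : (z \in D') = (z \in D) by rewrite D'E inE (negbTE zV) orbF.
have tabE u w : u \in z |: D' -> Mt'' u w = if (u == z) && (z \notin D) then W1 w else Mt' u w.
  by move=> uD; rewrite Htab // /walk_table zD'E; case: (z \in D) => /=; rewrite ?andbF //= andbT; case: eqP.
have inD1 u : u \in D -> u \in z |: D' by move=> uD; rewrite z1E inE uD.
have inV1 u : u \in V1 -> u \in z |: D' by move=> uV; rewrite z1E inE uV orbT.
have Nold u : u \in D -> Mt'' u =1 Mt u.
  move=> uD w; rewrite tabE ?inD1 //; case: eqP => [E|_] /=; last exact: Hold.
  by rewrite -E uD /=; apply: Hold.
have Nnew u : u \in V1 -> u \notin D ->
    [/\ matching (Mt'' u),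
        forall w, (Mt'' u w == w) = (w == u) || ((M w == w) && (w != r))
      & forall w, w \notin V1 -> Mt'' u w = Mt x w].
  move=> uV1 uD; have uz1 := inV1 u uV1.
  case: (eqVneq u z) => [E|uz].
    have HE w : Mt'' u w = W1 w by rewrite tabE // E eqxx -E uD.
    split=> [|w|w wV1]; rewrite ?HE; last exact: W1out.
    - by apply: matching_eq W1m => w; rewrite HE.
    - by rewrite W1e' E.
  have HE w : Mt'' u w = Mt' u w by rewrite tabE // (negbTE uz).
  have uV : u \in V.
    by move: uV1; rewrite V1E (negbTE uz) /= => /orP[/eqP E|//]; rewrite E tD in uD.
  have [N1 N2 N3] := Hnew u uV uD; split=> [|w|w wV1]; rewrite ?HE //.
  - by apply: matching_eq N1 => w; rewrite HE.
  - by rewrite N3 //; move: wV1; rewrite V1E !negb_or => /and3P[].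
(* The vertex [x] is excepted because only the end of the walk shows that it is in the component of
   [y]. *)
have V1min (Q : {set T}) : y \in Q -> (forall w, w \in Q -> Mt x w \in Q) ->
    (forall w, w \in Q -> Mt y w \in Q) -> t1 |: V1 \subset x |: Q.
  move=> yQ Qx Qy; have H := Vmin Q yQ Qx Qy.
  have tQ : t \in Q by have := subsetP H t; rewrite !inE eqxx (negbTE tx); apply.
  have zQ : z \in Q by apply: Qx.
  apply/subsetP=> w; rewrite in_setU1 V1E => /or4P[/eqP ->|/eqP ->|/eqP ->|wV].
  - by rewrite inE Qy ?orbT.
  - by rewrite inE zQ orbT.
  - by rewrite inE tQ orbT.
  - by apply: (subsetP H); rewrite inE wV orbT.
split=> //; case: (eqVneq t1 x) => [t1x|t1x]; last first.
  have spt1 : t1 \in D -> exists2 s, s \in t1 |: V1 & s \in special y /\ c s = c t1.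
    move=> _; have [zD|zD] := boolP (z \in D).
      have [s sV [ss cs]] := spz zD; exists s; first by rewrite !inE in sV *; rewrite sV !orbT.
      by split=> //; rewrite cs; have [_ ->] := special_notin yD zD (zsp zD).
    exists t1; first by rewrite inE set11.
    by split=> //; apply: special_mate => //; move: zDA; rewrite inE (negbTE zD).
  split=> //.
  - by rewrite V1E xV !orbT.
  - by rewrite V1E eqxx.
  - exact: t1V.
  - have [_ H] := pi_mt PI yD; exact: H.
  - by rewrite inE yV1 orbT.
  - by right.
  - move=> w; rewrite in_setU1 V1E => /or4P[/eqP ->|/eqP ->|wt|wV] wD wx.
    + exact: spt1.
    + have [s sV H] := spz wD; exists s => //; by rewrite !inE in sV *; rewrite sV !orbT.
    + have [|s sV H] := Vsp w _ wD wx; first by rewrite !inE wt.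
      by exists s => //; rewrite !inE in sV *; rewrite sV !orbT.
    + have [|s sV H] := Vsp w _ wD wx; first by rewrite !inE wV orbT.
      by exists s => //; rewrite !inE in sV *; rewrite sV !orbT.
have xV1 : x \in V1 by rewrite V1E xV !orbT.
have V1y w : w \in V1 -> Mt y w \in V1.
  case: (eqVneq w x) => [->|wx]; first by rewrite (_ : Mt y x = z) ?V1E ?eqxx // -t1x /t1 mt_inv.
  case: (eqVneq w z) => [->|wz]; first by rewrite -/t1 t1x.
  by move=> wV1; have [] := V1My w wV1 wx wz.
have V1min' (Q : {set T}) : y \in Q -> (forall w, w \in Q -> Mt x w \in Q) ->
    (forall w, w \in Q -> Mt y w \in Q) -> V1 \subset Q.
  move=> yQ Qx Qy; have H := V1min Q yQ Qx Qy.
  have zQ : z \in Q.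
    by have := subsetP H z; rewrite inE V1E eqxx orbT !inE (negbTE zx); apply.
  have xQ : x \in Q by rewrite -t1x Qy.
  apply/subsetP=> w wV1; have : w \in x |: Q := subsetP H w (setU1r t1 wV1).
  by rewrite in_setU1 => /orP[/eqP ->|].
have N1 u (uV : u \in V1) (uD : u \notin D) := let: And3 a _ _ := Nnew u uV uD in a.
have N2 u w (uV : u \in V1) (uD : u \notin D) := let: And3 _ a _ := Nnew u uV uD in a w.
have N3 u w (uV : u \in V1) (uD : u \notin D) := let: And3 _ _ a := Nnew u uV uD in a w.
have PI' := merge_inv xD yD xV1 yV1 V1DA V1Mx V1y V1min' Nold N1 N2 N3.
rewrite z1E; do 2! eexists; split; first exact: PI'.
  exact: subsetUl.
move=> ED; have V1D : V1 \subset D by rewrite -ED subsetUr.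
split; last exact: (merge_trivial xD yD xV1 yV1 V1Mx V1y V1min' V1D).
by rewrite ED; apply: phase_inv_ext.
Qed.

End Walk. End Phase. End Matching.

(** * Deletion as a perfect matching problem *)

(** Only the [d] last elements fail the test. Selecting by rank singles out a set of prescribed size
    that a program can compute by counting. *)
Lemma card_rank n (E : {set 'I_n}) d :
  #|[set v in E | d < #|[set w in E | v <= w]|]| = #|E| - d.
Proof.
elim: {E}#|E| {-2}E (erefl #|E|) => [|m IH] E cE.
  move/eqP: cE; rewrite cards_eq0 => /eqP ->.
  by rewrite cards0 sub0n; apply: eq_card0 => v; rewrite !inE.
have [v0 v0E] : exists v0, v0 \in E by apply/set0Pn; rewrite -card_gt0 cE.
case: (@arg_minnP _ v0 (fun v => v \in E) (fun v => val v) v0E) => v vE vmin.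
have cE' : #|E :\ v| = m by move: cE; rewrite (cardsD1 v) vE => -[].
have Ev : [set w in E | v <= w] = E.
  by apply/setP=> w; rewrite !inE; case: (boolP (w \in E)) => //= /vmin.
have Eu u : u \in E :\ v -> [set w in E | u <= w] = [set w in E :\ v | u <= w].
  rewrite !inE => /andP[uv uE]; apply/setP=> w; rewrite !inE.
  case: (eqVneq w v) => [->|//]; rewrite vE /=.
  have := vmin u uE; rewrite leq_eqVlt => /orP[/eqP/val_inj E1|]; last by rewrite ltnNge => /negbTE.
  by rewrite E1 eqxx in uv.
have -> : [set u in E | d < #|[set w in E | u <= w]|] =
    (if d < #|E| then [set v] else set0) :|: [set u in E :\ v | d < #|[set w in E :\ v | u <= w]|].
  apply/setP=> u; rewrite !inE; case: (eqVneq u v) => [->|uv].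
    by rewrite vE Ev /= orbF; case: ifP => H; rewrite inE ?eqxx.
  have -> /= : (u \in (if d < #|E| then [set v] else set0)) = false.
    by case: ifP; rewrite inE // (negbTE uv).
  by case: (boolP (u \in E)) => //= uE; rewrite Eu // !inE uv.
rewrite cardsU (_ : _ :&: _ = set0); last first.
  apply/setP=> u; rewrite !inE; case: ifP => _; rewrite !inE //.
  by case: (eqVneq u v).
rewrite cards0 subn0 IH // cE' cE; case: ifP => H; rewrite ?cards1 ?cards0; lia.
Qed.

(** * Assembling perfect matchings from pieces *)

Section PerfectMatching.
Variables (S : finType) (e : rel S).
Hypothesis e_sym : symmetric e.

Definition perfectly_matched (X : {set S}) : Prop :=
  exists f : S -> S, forall v, v \in X -> [/\ f v \in X, e v (f v) & f (f v) = v].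

Lemma perfectly_matched0 : perfectly_matched set0.
Proof. by exists id => v; rewrite inE. Qed.

Lemma perfectly_matchedU (X Y : {set S}) : [disjoint X & Y] -> perfectly_matched X -> perfectly_matched Y ->
  perfectly_matched (X :|: Y).
Proof.
move=> dXY [f Hf] [h Hh]; exists (fun v => if v \in X then f v else h v) => v.
rewrite inE; case: (boolP (v \in X)) => [vX _|vX /= vY].
  by have [fX ev fv] := Hf v vX; rewrite inE fX.
have [hY ev hv] := Hh v vY; rewrite inE hY orbT.
by rewrite (disjointFl dXY hY).
Qed.

Lemma perfectly_matched_pair x y : e x y -> perfectly_matched [set x; y].
Proof.
move=> exy; exists (fun v => if v == x then y else x) => v; rewrite !inE => /orP[]/eqP ->.
  rewrite eqxx eqxx orbT; split=> //.
  by case: eqP => [->|].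
case: (eqVneq y x) => [E|yx]; first by rewrite E eqxx; split=> //; rewrite -{2}E.
by rewrite eqxx; split=> //; rewrite e_sym.
Qed.

(** Vertices of equal colour on the two sides are completely joined, so a greedy choice keeps the
    colour counts equal. *)
Lemma perfectly_matched_bipartite (X Y : {set S}) (col : S -> nat) : [disjoint X & Y] ->
  (forall x y, x \in X -> y \in Y -> col x = col y -> e x y) ->
  (forall c, #|[set x in X | col x == c]| = #|[set y in Y | col y == c]|) ->
  perfectly_matched (X :|: Y).
Proof.
elim: {X}#|X| {-2}X (erefl #|X|) Y => [|m IH] X cX Y dXY He Hc.
  have X0 : X = set0 by apply/eqP; rewrite -cards_eq0 cX.
  suff -> : Y = set0 by rewrite X0 setU0; apply: perfectly_matched0.
  apply/setP=> y; rewrite inE; apply/negP => yY.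
  have := Hc (col y); rewrite X0 (_ : [set _ in set0 | _] = set0); last first.
    by apply/setP=> u; rewrite !inE.
  rewrite cards0 => /esym/eqP; rewrite cards_eq0 => /eqP/setP/(_ y).
  by rewrite !inE yY eqxx.
have [x xX] : exists x, x \in X by apply/set0Pn; rewrite -card_gt0 cX.
have [y] : exists y, y \in [set y in Y | col y == col x].
  by apply/set0Pn; rewrite -card_gt0 -Hc card_gt0; apply/set0Pn; exists x; rewrite inE xX eqxx.
rewrite inE => /andP[yY /eqP cyx].
have exy : e x y by apply: He.
have -> : X :|: Y = [set x; y] :|: ((X :\ x) :|: (Y :\ y)).
  apply/setP=> u; rewrite !inE; case: (eqVneq u x) => [->|_]; first by rewrite xX.
  by case: (eqVneq u y) => [->|_]; rewrite ?yY ?orbT.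
have xY : x \notin Y by rewrite (disjointFr dXY xX).
have yX : y \notin X by rewrite (disjointFl dXY yY).
apply: perfectly_matchedU; last 1 first.
- apply: IH => [||u v|c].
  + by move: cX; rewrite (cardsD1 x) xX => -[].
  + by apply: disjointW dXY; apply: subD1set.
  + by rewrite !inE => /andP[_ uX] /andP[_ vY]; apply: He.
  + have Hm (Z : {set S}) z : z \in Z -> #|[set u in Z :\ z | col u == c]| =
        #|[set u in Z | col u == c]| - (col z == c).
      move=> zZ; rewrite (cardsD1 z [set u in Z | _]) inE zZ /= addKn.
      by apply: eq_card => u; rewrite !inE andbA.
    by rewrite !Hm // Hc cyx.
- rewrite -setI_eq0; apply/eqP/setP=> u; rewrite !inE.
  case: (eqVneq u x) => [->|_] /=; first by rewrite (negbTE xY) andbF.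
  by case: (eqVneq u y) => [->|_] //=; rewrite (negbTE yX) /= ?andbF.
- exact: perfectly_matched_pair.
Qed.

Lemma perfectly_matched_clique (X : {set S}) : ~~ odd #|X| ->
  (forall x y, x \in X -> y \in X -> x != y -> e x y) -> perfectly_matched X.
Proof.
elim: {X}#|X| {-2}X (leqnn #|X|) => [|m IH] X cX oX He.
  have -> : X = set0 by apply/eqP; rewrite -cards_eq0 -leqn0.
  exact: perfectly_matched0.
have [->|[x xX]] := set_0Vmem X; first exact: perfectly_matched0.
have [E|[y yX]] := set_0Vmem (X :\ x).
  by move: oX; rewrite (cardsD1 x) xX E cards0.
have -> : X = [set x; y] :|: (X :\ x :\ y).
  apply/setP=> u; rewrite !inE; case: (eqVneq u x) => [->|_]; first by rewrite xX.
  by case: (eqVneq u y) => [->|_] //; move: yX; rewrite inE => /andP[].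
have Ec : #|X| = #|X :\ x :\ y|.+2 by rewrite (cardsD1 x) xX (cardsD1 y (X :\ x)) yX.
move: (yX); rewrite !inE => /andP[yx yX'].
apply: perfectly_matchedU.
- rewrite -setI_eq0; apply/eqP/setP=> u; rewrite !inE.
  by case: (eqVneq u x) => //= _; rewrite ?andbF //; case: (eqVneq u y).
- by apply: perfectly_matched_pair; apply: He => //; rewrite eq_sym.
- apply: IH; first by lia.
    by move: oX; rewrite Ec /= negbK.
  by move=> u v; rewrite !inE => /and3P[_ _ uX] /and3P[_ _ vX]; apply: He.
Qed.

End PerfectMatching.

(** * The graph of an election whose voters are paired *)

Section Reduction.
Variables (n nc : nat) (F : 'I_n -> nat) (pt : 'I_n -> 'I_n) (p k : nat).
Hypothesis F_lt : forall v, F v < nc.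
Hypothesis ptK : involutive pt.

Definition color_card (X : {set 'I_n}) (c : nat) : nat := #|[set v in X | F v == c]|.

Lemma eq_card_colors (A B : {set 'I_n}) :
  (forall c, color_card A c = color_card B c) -> #|A| = #|B|.
Proof.
have H (X : {set 'I_n}) : #|X| = \sum_(c < nc) color_card X c.
  rewrite -sum1_card (partition_big (fun v => Ordinal (F_lt v)) predT) //=.
  apply: eq_bigr => c _; rewrite /color_card -sum1_card; apply: eq_bigl => v.
  by rewrite inE -val_eqE.
by move=> E; rewrite !H; apply: eq_bigr => c _.
Qed.

Definition deleted (V' : {set 'I_n}) : {set 'I_n} :=
  [set w | [exists v in V', (w == v) || (w == pt v)]].

Definition can_win : Prop := exists V' : {set 'I_n},
  #|V'| <= k /\ forall c, c < nc -> color_card (~: deleted V') c <= color_card (~: deleted V') p.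

Definition supporters (c : nat) : nat := color_card setT c.
Definition excess (c : nat) : nat := supporters c - supporters p.

Definition eligible : {set 'I_n} := [set v | (F v != p) && (F (pt v) != p)].

(* The [excess c] last voters of each candidate [c] in [B]. *)
Definition last_of (B : {set 'I_n}) : {set 'I_n} :=
  [set v in B | #|[set w in B | (F w == F v) && (v <= w)]| <= excess (F v)].

(** It supplies the number of voters to be chosen: under [feasible] its size is the sum of all
    excesses. *)
Definition required : {set 'I_n} := last_of eligible.
Definition spare : {set 'I_n} :=
  [set v in eligible | excess (F v) < #|[set w in eligible | (F w == F v) && (v <= w)]|].
(* Truncating [k] at [n] keeps the number of dummies polynomial. *)
Definition budget2 : nat := (minn k n).*2.
Definition ndummy : nat := budget2 - #|required|.
Definition feasible : Prop := forall v, excess (F v) <= color_card eligible (F v).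

Lemma card_above (B : {set 'I_n}) c :
  #|[set v in B | (F v == c) && (excess c < #|[set w in B | (F w == c) && (v <= w)]|)]|
    = color_card B c - excess c.
Proof.
rewrite -(card_rank [set v in B | F v == c] (excess c)); apply: eq_card => v.
rewrite !inE -andbA; case: (v \in B) => //=; case: (F v == c) => //=.
congr (_ < _); apply: eq_card => w; by rewrite !inE andbA.
Qed.

Lemma card_spare c : color_card spare c = color_card eligible c - excess c.
Proof.
rewrite -card_above; apply: eq_card => v; rewrite !inE.
by case: (F v =P c) => [->|_]; rewrite /= ?andbT ?andbF /= ?andbF ?andbT.
Qed.

Lemma card_last_of (B : {set 'I_n}) c : excess c <= color_card B c ->
  color_card (last_of B) c = excess c.
Proof.
move=> le_c; have := card_above B c.
pose Z := [set v : 'I_n | excess c < #|[set w in B | (F w == c) && (v <= w)]|].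
have := cardsID Z [set v in B | F v == c].
rewrite -/(color_card B c) => E H.
have E1 : #|[set v in B | F v == c] :&: Z|
    = color_card B c - excess c.
  by rewrite -H; apply: eq_card => v; rewrite !inE andbA.
have E2 : #|[set v in B | F v == c] :\: Z|
    = color_card (last_of B) c.
  apply: eq_card => v; rewrite !inE -leqNgt andbC -!andbA.
  by case: (F v =P c) => [->|_]; rewrite /= ?andbT ?andbF /= ?andbF ?andbT.
by move: E; rewrite E1 E2; lia.
Qed.

Lemma pt_eligible v : (pt v \in eligible) = (v \in eligible).
Proof. by rewrite !inE ptK andbC. Qed.

Lemma color_cardC X c : color_card (~: X) c = supporters c - color_card X c.
Proof.
rewrite /supporters /color_card -(cardsID X [set v in setT | F v == c]).
have -> : [set v in setT | F v == c] :&: X = [set v in X | F v == c].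
  by apply/setP=> v; rewrite !inE andbC.
by rewrite addKn; apply: eq_card => v; rewrite !inE.
Qed.

Lemma color_cardS (X Y : {set 'I_n}) c : X \subset Y -> color_card X c <= color_card Y c.
Proof.
move=> XY; apply/subset_leq_card/subsetP=> v; rewrite !inE => /andP[vX ->].
by rewrite (subsetP XY v vX).
Qed.

(* Eligible voters, slack vertices (indexed by [spare]) and dummies. *)
Definition vertex : Type := ('I_n + 'I_n + 'I_ndummy)%type.

Definition half_adj (a b : vertex) : bool :=
  match a, b with
  | inl (inl u), inl (inl v) => [&& u \in eligible, v \in eligible, pt u == v & u != v]
  | inl (inl u), inl (inr v) => [&& u \in eligible, v \in spare & F u == F v]
  | inl (inl u), inr _ => u \in eligible
  | inr i, inr j => i != j
  | _, _ => false
  end.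

Definition adj (a b : vertex) : bool := half_adj a b || half_adj b a.

Definition part (Z1 Z2 : {set 'I_n}) (Z3 : {set 'I_ndummy}) : {set vertex} := [set a |
  match a with inl (inl u) => u \in Z1 | inl (inr u) => u \in Z2 | inr i => i \in Z3 end].

Definition present : {set vertex} := part eligible spare setT.

Lemma in_part Z1 Z2 Z3 (a : vertex) : (a \in part Z1 Z2 Z3) =
  match a with inl (inl u) => u \in Z1 | inl (inr u) => u \in Z2 | inr i => i \in Z3 end.
Proof. by rewrite inE. Qed.

Lemma partU Z1 Z2 Z3 Y1 Y2 Y3 :
  part Z1 Z2 Z3 :|: part Y1 Y2 Y3 = part (Z1 :|: Y1) (Z2 :|: Y2) (Z3 :|: Y3).
Proof. by apply/setP=> -[[u|u]|i]; rewrite !inE. Qed.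

Lemma part_disjoint Z1 Z2 Z3 Y1 Y2 Y3 :
  Z1 :&: Y1 = set0 -> Z2 :&: Y2 = set0 -> Z3 :&: Y3 = set0 ->
  [disjoint part Z1 Z2 Z3 & part Y1 Y2 Y3].
Proof.
move=> /setP E1 /setP E2 /setP E3; rewrite -setI_eq0; apply/eqP/setP.
move=> -[[u|u]|i]; rewrite in_setI !in_part in_set0.
- by have := E1 u; rewrite !inE.
- by have := E2 u; rewrite !inE.
- by have := E3 i; rewrite !inE.
Qed.

Lemma card_part_voter (P : pred vertex) Z :
  #|[set a in part Z set0 set0 | P a]| = #|[set u in Z | P (inl (inl u))]|.
Proof.
rewrite -(card_imset [set u in Z | _] (f := fun u => inl (inl u) : vertex)) => [|u v []] //.
apply: eq_card => a; rewrite !inE; apply/idP/imsetP => [|[u + ->]]; last by rewrite inE.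
by case: a => [[u|u]|i]; rewrite ?in_set0 // => H; exists u; rewrite ?inE.
Qed.

Lemma card_part_slack (P : pred vertex) Z :
  #|[set a in part set0 Z set0 | P a]| = #|[set u in Z | P (inl (inr u))]|.
Proof.
rewrite -(card_imset [set u in Z | _] (f := fun u => inl (inr u) : vertex)) => [|u v []] //.
apply: eq_card => a; rewrite !inE; apply/idP/imsetP => [|[u + ->]]; last by rewrite inE.
by case: a => [[u|u]|i]; rewrite ?in_set0 // => H; exists u; rewrite ?inE.
Qed.

Lemma card_part_dummy (P : pred vertex) Z :
  #|[set a in part set0 set0 Z | P a]| = #|[set i in Z | P (inr i)]|.
Proof.
rewrite -(card_imset [set u in Z | _] (f := fun u => inr u : vertex)) => [|u v []] //.
apply: eq_card => a; rewrite !inE; apply/idP/imsetP => [|[u + ->]]; last by rewrite inE.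
by case: a => [[u|u]|i]; rewrite ?in_set0 // => H; exists i; rewrite ?inE.
Qed.

Lemma adj_sym : symmetric adj.
Proof. by move=> a b; rewrite /adj orbC. Qed.

(** * From a winning deletion to a perfect matching *)

Section Deletion.
Variable V' : {set 'I_n}.
Hypothesis card_V' : #|V'| <= k.
Hypothesis V'_wins : forall c, c < nc ->
  color_card (~: deleted V') c <= color_card (~: deleted V') p.
Let X := deleted V'.

Lemma pt_deleted w : (pt w \in X) = (w \in X).
Proof.
have H u : u \in X -> pt u \in X.
  rewrite !inE => /exists_inP[v vV]; case/orP => /eqP ->; apply/exists_inP; exists v => //.
    by rewrite eqxx orbT.
  by rewrite ptK eqxx.
by apply/idP/idP => [/H|]; [rewrite ptK|exact: H].
Qed.

(** For [c != p], a deleted voter of [c] outside [eligible] has a partner who supports [p] and is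
    deleted as well. As [pt] is injective, these deletions cost [p] at least as many votes as [c],
    so the eligible ones must make up for the whole excess. *)
Lemma deleted_excess c : excess c <= color_card (X :&: eligible) c.
Proof.
have [E|cp] := eqVneq c p; first by rewrite /excess E subnn.
have [cn|cn] := ltnP c nc; last first.
  suff -> : excess c = 0 by [].
  rewrite /excess /supporters /color_card (_ : [set _ in _ | _] = set0) ?cards0 //.
  by apply/setP=> v; rewrite !inE; apply/negbTE; have := F_lt v; apply: contraTneq => ->; lia.
have := V'_wins cn; rewrite !color_cardC -/X => Hw.
have H1 : color_card X c <= supporters c by apply: color_cardS; apply: subsetT.
have H2 : color_card X p <= supporters p by apply: color_cardS; apply: subsetT.
suff : color_card X c <= color_card (X :&: eligible) c + color_card X p by rewrite /excess; lia.
rewrite /color_card -(cardsID eligible [set v in X | F v == c]) leq_add //.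
  by apply/subset_leq_card/subsetP=> v; rewrite !inE => /andP[/andP[-> ->] ->].
rewrite -(card_imset _ (can_inj ptK)); apply/subset_leq_card/subsetP=> _ /imsetP[v + ->].
rewrite !inE -/X => /and3P[+ vX /eqP cv]; rewrite cv cp /= negbK => ->.
by rewrite andbT; have := pt_deleted v; rewrite !inE => ->.
Qed.

Let U := last_of (X :&: eligible).

Lemma color_U c : color_card U c = excess c.
Proof. exact: card_last_of (deleted_excess c). Qed.

Lemma U_eligible u : u \in U -> u \in eligible.
Proof. by rewrite inE => /andP[/setIP[]]. Qed.

Lemma U_deleted u : u \in U -> u \in V' \/ pt u \in V'.
Proof.
rewrite inE => /andP[/setIP[+ _] _]; rewrite inE => /exists_inP[v vV /orP[]/eqP ->]; first by left.
by right; rewrite ptK.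
Qed.

Lemma excess_eligible c : excess c <= color_card eligible c.
Proof. by apply: leq_trans (deleted_excess c) _; apply: color_cardS; apply: subsetIr. Qed.

Lemma card_U : #|U| = #|required|.
Proof.
apply: eq_card_colors => c; rewrite color_U card_last_of //; exact: excess_eligible.
Qed.

Let Un := [set u in U | (pt u \notin U) || (pt u == u)].

(** A bundle with one chosen voter counts once in [U] and once in [Un], a bundle with two counts
    twice in [U], and each of them contains a member of [V']. The count is done by two injections
    into [V'], one for [U :&: V'] with [Un :\: V'], the other for the rest. *)
Lemma card_U_Un : #|U| + #|Un| <= #|V'|.*2.
Proof.
have ptS (Z : {set 'I_n}) : #|pt @: Z| = #|Z| by apply: card_imset; apply: can_inj ptK.
rewrite -(cardsID V' U) -(cardsID V' Un) -addnn.
have ptV u : u \in U -> u \notin V' -> pt u \in V'.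
  by move=> /U_deleted[->|].
have D1 : #|U :&: V'| + #|Un :\: V'| <= #|V'|.
  rewrite -(ptS (Un :\: V')) -cardsUI (_ : _ :&: (pt @: _) = set0) ?cards0 ?addn0.
    apply/subset_leq_card/subsetP=> v /setUP[/setIP[] //|/imsetP[u /setDP[uUn uV] ->]].
    by apply: ptV => //; move: uUn; rewrite inE => /andP[].
  apply/setP=> v; rewrite in_set0; apply/negbTE/negP => /setIP[/setIP[vU vV] /imsetP[u /setDP[uUn uV] E]].
  move: uUn; rewrite inE -E vU /= => /andP[_ /eqP E']; by rewrite E' in vV; rewrite vV in uV.
have D2 : #|U :\: V'| + #|Un :&: V'| <= #|V'|.
  rewrite -(ptS (U :\: V')) addnC -cardsUI (_ : _ :&: (pt @: _) = set0) ?cards0 ?addn0.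
    apply/subset_leq_card/subsetP=> v /setUP[/setIP[] //|/imsetP[u /setDP[uU uV] ->]].
    exact: ptV.
  apply/setP=> v; rewrite in_set0; apply/negbTE/negP => /setIP[/setIP[vUn vV] /imsetP[u /setDP[uU uV] E]].
  move: vUn; rewrite inE E ptK uU /= => /andP[_ /eqP E']; by rewrite E -E' in vV; rewrite vV in uV.
lia.
Qed.

Lemma deletion_required : #|required| + #|Un| <= budget2.
Proof.
rewrite -card_U; apply: leq_trans card_U_Un _; rewrite /budget2 leq_double leq_min card_V' /=.
by have := max_card (mem V'); rewrite card_ord.
Qed.

Lemma deletion_matching : perfectly_matched adj present.
Proof.
have HUn : #|Un| <= ndummy by have := deletion_required; rewrite /ndummy; lia.
pose Pd := U :\: Un.
pose D1 : {set 'I_ndummy} := [set i : 'I_ndummy | i < #|Un|].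
have cD1 : #|D1| = #|Un|.
  have wI : injective (widen_ord HUn) by move=> i j /(congr1 val) /= /val_inj.
  rewrite -[RHS](card_ord #|Un|) -(card_imset predT wI).
  apply: eq_card => i; rewrite inE; apply/idP/imsetP => [Hi|[j _ ->]]; last exact: ltn_ord j.
  by exists (Ordinal Hi) => //; apply: val_inj.
have in_Un v : (v \in Un) = (v \in U) && ((pt v \notin U) || (pt v == v)) by exact: in_set.
have HPd v : v \in Pd -> [/\ v \in U, pt v \in Pd & pt v != v].
  move=> /setDP[vU]; rewrite in_Un vU /= negb_or negbK => /andP[ptU ptv].
  by split=> //; apply/setDP; rewrite in_Un ptU ptK vU /= (eq_sym v) (negbTE ptv).
have evenPd : ~~ odd #|Pd|.
  by apply: (involution_even (f := pt)) => v /HPd[_ ? ?]; rewrite ptK.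
have cPd : #|Pd| = #|U| - #|Un|.
  rewrite cardsD; congr (_ - #|pred_of_set _|); apply/setIidPr/subsetP=> v.
  by rewrite in_Un => /andP[].
have cUn : #|Un| <= #|U| by apply/subset_leq_card/subsetP=> v; rewrite in_Un => /andP[].
(* The four pieces: chosen pairs; voters not chosen, with the slack vertices; chosen voters without
   a chosen partner, with as many dummies; the remaining dummies. *)
have -> : present = part Pd set0 set0 :|: ((part (eligible :\: U) set0 set0 :|: part set0 spare set0)
    :|: ((part Un set0 set0 :|: part set0 set0 D1) :|: part set0 set0 (~: D1))).
  apply/setP=> -[[u|u]|i]; rewrite !in_setU !in_part !in_set0 ?orbF ?orFb //.
  - rewrite !in_setD.
    have [uU|uU] := boolP (u \in U); first by rewrite U_eligible //= andbT; case: (u \in Un).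
    by rewrite andbF /= in_Un (negbTE uU) orbF.
  - by rewrite in_setT in_setC orbN.
have PdUn : Pd :&: Un = set0 by apply/setP=> v; rewrite !in_setI !in_setD in_set0; case: (v \in Un); rewrite ?andbF.
have UnU : Un :\: U = set0 by apply/setP=> v; rewrite in_setD in_set0 in_Un; case: (v \in U).
have ElU (Z : {set 'I_n}) : Z \subset U -> (eligible :\: U) :&: Z = set0.
  move=> ZU; apply/setP=> v; rewrite in_setI in_setD in_set0.
  by case: (boolP (v \in Z)) => [/(subsetP ZU) ->|]; rewrite ?andbF.
have PdU : Pd \subset U by apply: subsetDl.
have UnU' : Un \subset U by apply/subsetP=> v; rewrite in_Un => /andP[].
apply: perfectly_matchedU.
- by rewrite !partU !setU0 !set0U; apply: part_disjoint; rewrite ?set0I ?setI0 // setIUr PdUn setU0 setIC ElU.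
- exists (fun a => if a is inl (inl u) then inl (inl (pt u)) else a) => -[[v|v]|i]; rewrite in_part ?in_set0 //.
  move=> vP; have [vU ptP ptv] := HPd v vP; have [ptU _ _] := HPd _ ptP.
  rewrite in_part ptK; split=> //; apply/orP; left.
  by rewrite /= !U_eligible // eqxx eq_sym.
apply: perfectly_matchedU.
- by rewrite !partU !setU0 !set0U; apply: part_disjoint; rewrite ?set0I ?setI0 // ElU.
- apply: (@perfectly_matched_bipartite _ _ adj_sym _ _ (fun a => if a is inl (inl u) then F u else if a is inl (inr u) then F u else 0)).
  + by apply: part_disjoint; rewrite ?set0I ?setI0.
  + move=> [[u|u]|i] [[v|v]|j]; rewrite !in_part ?in_set0 // => /setDP[uE _] vS Fuv.
    by rewrite /adj /= uE vS Fuv eqxx.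
  + move=> c; rewrite card_part_voter card_part_slack -/(color_card spare c) card_spare.
    have <- : color_card U c = excess c by apply: color_U.
    have in_col (Z : {set 'I_n}) v : (v \in [set u in Z | F u == c]) = (v \in Z) && (F v == c).
      exact: in_set.
    rewrite /color_card -(cardsID U [set u in eligible | F u == c]).
    have -> : [set u in eligible | F u == c] :&: U = [set v in U | F v == c].
      apply/setP=> v; rewrite in_setI !in_col.
      by case: (boolP (v \in U)) => [/U_eligible ->|]; rewrite ?andbF ?andbT.
    rewrite addKn; apply: eq_card => v; rewrite in_setD !in_col in_setD.
    by rewrite andbA.
apply: perfectly_matchedU.
- rewrite !partU !setU0 !set0U; apply: part_disjoint; rewrite ?set0I ?setI0 //.
  by rewrite setICr.
- apply: (@perfectly_matched_bipartite _ _ adj_sym _ _ (fun=> 0)).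
  + by apply: part_disjoint; rewrite ?set0I ?setI0.
  + move=> [[u|u]|i] [[v|v]|j]; rewrite !in_part ?in_set0 // => /(subsetP UnU')/U_eligible uE _ _.
    by rewrite /adj /= uE.
  + move=> c; rewrite card_part_voter card_part_dummy.
    case: (0 == c); last by rewrite !eq_card0 // => v; rewrite !inE andbF.
    rewrite (_ : [set u in Un | true] = Un); last by apply/setP=> u; rewrite in_set andbT.
    by rewrite (_ : [set u in D1 | true] = D1) //; apply/setP=> u; rewrite in_set andbT.
apply: (@perfectly_matched_clique _ _ adj_sym).
- have -> : part set0 set0 (~: D1) = [set a in part set0 set0 (~: D1) | true].
    by apply/setP=> a; rewrite in_set andbT.
  rewrite card_part_dummy (_ : [set _ in _ | _] = ~: D1); last by apply/setP=> u; rewrite in_set andbT.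
  rewrite cardsCs setCK card_ord cD1 /ndummy -card_U.
  have := deletion_required; rewrite -card_U => H.
  (* The chosen voters outside [Un] come in pairs, so an even number of dummies remains. *)
  have : odd #|U| = odd #|Un|.
    by move: evenPd; rewrite cPd oddB //; case: (odd #|U|); case: (odd #|Un|).
  rewrite /budget2 in H *; rewrite !oddB ?odd_double //; try lia.
- by move=> [[u|u]|i] [[v|v]|j]; rewrite !in_part ?in_set0 // => _ _ ij; rewrite /adj /= ij.
Qed.
End Deletion.

(** * From a perfect matching to a winning deletion *)

Section Converse.
Hypothesis feas : feasible.
Variable f : vertex -> vertex.
Hypothesis f_ok : forall v, v \in present -> [/\ f v \in present, adj v (f v) & f (f v) = v].

Let vt (u : 'I_n) : vertex := inl (inl u).
Let slack (a : vertex) : bool := if a is inl (inr _) then true else false.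
Let dummy (a : vertex) : bool := if a is inr _ then true else false.

Lemma vt_present u : (vt u \in present) = (u \in eligible).
Proof. by rewrite in_part. Qed.

Lemma mate_voter u v : u \in eligible -> f (vt u) = vt v -> v = pt u /\ pt u != u.
Proof.
rewrite -vt_present => /f_ok[_ + _] E; rewrite E /adj /=.
case/orP => /and4P[_ _ /eqP E1]; first by rewrite -E1 eq_sym.
by rewrite -E1 ptK.
Qed.

Lemma mate_slack u v : u \in eligible -> f (vt u) = inl (inr v) -> v \in spare /\ F u = F v.
Proof.
rewrite -vt_present => /f_ok[_ + _] E; rewrite E /adj /= orbF.
by case/and3P => _ -> /eqP ->.
Qed.

Lemma mate_of_slack v : v \in spare ->
  exists u, [/\ u \in eligible, F u = F v & f (vt u) = inl (inr v)].
Proof.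
move=> vS; have : inl (inr v) \in present by rewrite in_part.
move/f_ok => [_]; rewrite /adj /=.
case E: (f (inl (inr v))) => [[u|u]|i] //= /and3P[uE _ /eqP Fuv] E'.
by exists u.
Qed.

Lemma excess_le_eligible c : excess c <= color_card eligible c.
Proof.
have [/existsP[v /eqP <-]|/existsPn H] := boolP [exists v, F v == c]; first exact: feas.
rewrite /excess /supporters /color_card (_ : [set v in setT | F v == c] = set0) ?cards0 //.
by apply/setP=> v; rewrite !inE (negbTE (H v)).
Qed.

Let U := [set u in eligible | ~~ slack (f (vt u))].

Lemma in_U u : (u \in U) = (u \in eligible) && ~~ slack (f (vt u)).
Proof. exact: in_set. Qed.

Lemma f_inj : {in present &, injective f}.
Proof. by move=> a b /f_ok[_ _ Ea] /f_ok[_ _ Eb] E; rewrite -Ea E. Qed.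

(** Every slack vertex is matched, and only to an eligible voter of its colour, so the voters of [c]
    that are not chosen correspond to the slack vertices of [c]. *)
Lemma color_slack c :
  #|[set u in eligible | slack (f (vt u)) && (F u == c)]| = color_card spare c.
Proof.
(* The value [u] is a default that does not occur on the set in question. *)
pose h u := if f (vt u) is inl (inr v) then v else u.
rewrite -(@card_in_imset _ _ h) => [|u v].
  apply: eq_card => v; rewrite [RHS]in_set; apply/imsetP/andP => [[u]|[vS /eqP cv]].
    rewrite in_set => /and3P[uE + /eqP cu] ->; rewrite /h.
    case E: (f (vt u)) => [[w|w]|i] //= _.
    by have [wS Fw] := mate_slack uE E; rewrite -Fw cu wS.
  have [u [uE Fu E]] := mate_of_slack vS; exists u; last by rewrite /h E.
  by rewrite in_set uE E Fu cv /=.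
rewrite !in_set => /and3P[uE su _] /and3P[vE sv _]; rewrite /h.
move: su sv; case Eu: (f (vt u)) => [[w|w]|i] //; case Ev: (f (vt v)) => [[w'|w']|i'] // _ _ Ew.
have : vt u = vt v; last by case.
by apply: f_inj; [rewrite vt_present inE|rewrite vt_present inE|rewrite Eu Ev Ew].
Qed.

Lemma color_kept c : color_card U c = excess c.
Proof.
have Hd := excess_le_eligible c; have := color_slack c; rewrite card_spare => Hs.
have := cardsID [set u | slack (f (vt u))] [set u in eligible | F u == c].
have -> : [set u in eligible | F u == c] :&: [set u | slack (f (vt u))] =
    [set u in eligible | slack (f (vt u)) && (F u == c)].
  by apply/setP=> u; rewrite !inE; case: (F u != p); case: (F (pt u) != p); case: (slack _); case: (F u == c).
have -> : [set u in eligible | F u == c] :\: [set u | slack (f (vt u))] = [set v in U | F v == c].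
  by apply/setP=> u; rewrite !inE; case: (F u != p); case: (F (pt u) != p); case: (slack _); case: (F u == c).
by rewrite Hs -/(color_card eligible c) -/(color_card U c); lia.
Qed.

Lemma card_kept : #|U| = #|required|.
Proof.
by apply: eq_card_colors => c; rewrite color_kept card_last_of //; apply: excess_le_eligible.
Qed.

Let Un := [set u in U | dummy (f (vt u))].

Lemma in_unpaired u : (u \in Un) = (u \in U) && dummy (f (vt u)).
Proof. exact: in_set. Qed.

Lemma card_unpaired : #|Un| <= ndummy.
Proof.
have vtI : injective vt by move=> u v [].
rewrite -(card_imset Un vtI) -(@card_in_imset _ _ f); last first.
  move=> a b /imsetP[u + ->] /imsetP[v + ->]; rewrite !in_unpaired !in_U -!andbA.
  by move=> /andP[uE _] /andP[vE _]; apply: f_inj; rewrite vt_present.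
rewrite -[leqRHS](card_ord ndummy) -(card_imset predT (f := fun i => inr i : vertex)) => [|i j []] //.
apply/subset_leq_card/subsetP=> _ /imsetP[_ /imsetP[u + ->] ->].
rewrite in_unpaired => /andP[_]; case: (f (vt u)) => // i _.
exact: imset_f.
Qed.

Lemma kept_paired u : u \in U -> u \notin Un -> pt u \in U /\ pt u \notin Un /\ pt u != u.
Proof.
move=> uU; rewrite in_unpaired uU /=; move: (uU); rewrite in_U => /andP[uE].
case E: (f (vt u)) => [[v|v]|i] //= _ _; have [Ev pu] := mate_voter uE E.
have [_ _ E'] := f_ok (etrans (vt_present u) uE).
rewrite E Ev in E'; rewrite in_unpaired in_U pt_eligible uE.
by rewrite -[inl (inl _)]/(vt _) in E'; rewrite E'.
Qed.

(** Every voter of [Un] is deleted, and of each chosen pair the smaller voter, which makes at most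
    half of [#|U| + #|Un|] voters. The number of dummies bounds [#|Un|], and all bundles concerned
    are eligible, so [p] keeps its score. *)
Lemma matching_wins : #|required| <= budget2 -> can_win.
Proof.
move=> Hreq.
pose L := [set u in U :\: Un | u < pt u].
have in_L u : (u \in L) = [&& u \notin Un, u \in U & u < pt u].
  by rewrite in_set in_setD -andbA.
exists (Un :|: L); split.
  have cL : #|L|.*2 <= #|U| - #|Un|.
    have UnU : #|U :&: Un| = #|Un|.
      by congr #|pred_of_set _|; apply/setIidPr/subsetP=> u; rewrite in_unpaired => /andP[].
    rewrite -UnU -cardsD -addnn -{2}(card_imset L (can_inj ptK)) -cardsUI.
    rewrite (_ : _ :&: _ = set0) ?cards0 ?addn0.
      apply/subset_leq_card/subsetP=> u /setUP[|/imsetP[v + ->]]; rewrite in_L => /and3P[n1 n2 _].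
        by rewrite in_setD n1.
      by have [p1 [p2 _]] := kept_paired n2 n1; rewrite in_setD p1 p2.
    apply/setP=> u; rewrite in_set0; apply/negbTE/negP => /setIP[+ /imsetP[v + E]].
    rewrite !in_L => /and3P[_ _ H1] /and3P[_ _ H2].
    by rewrite E ptK in H1; lia.
  have UnU : #|Un| <= #|U| by apply/subset_leq_card/subsetP=> u; rewrite in_unpaired => /andP[].
  have := card_unpaired; rewrite /ndummy -card_kept; rewrite -card_kept in Hreq.
  have [+ _] := leq_card_setU Un L; rewrite /budget2 in Hreq *; move: Hreq cL.
  have : minn k n <= k by rewrite geq_minl.
  by lia.
move=> c _; rewrite !color_cardC.
have Udel : U \subset deleted (Un :|: L).
  apply/subsetP=> u uU; rewrite inE; apply/exists_inP.
  have [uUn|uUn] := boolP (u \in Un); first by exists u; rewrite ?in_setU ?uUn ?eqxx.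
  have [pU [pUn pu]] := kept_paired uU uUn.
  have [H|H] := ltnP u (pt u); first by exists u; rewrite ?in_setU ?in_L ?uU ?uUn ?H ?orbT ?eqxx.
  exists (pt u); last by rewrite ptK eqxx orbT.
  by rewrite in_setU in_L pU pUn ptK /= ltn_neqAle H (inj_eq val_inj) pu orbT.
have del_eligible : deleted (Un :|: L) \subset eligible.
  apply/subsetP=> w; rewrite inE => /exists_inP[v + E].
  have H : v \in U -> w \in eligible.
    by rewrite in_U => /andP[vE _]; case/orP: E => /eqP ->; rewrite ?pt_eligible.
  by case/setUP; [rewrite in_unpaired => /andP[/H]|rewrite in_L => /and3P[_ /H]].
have Ep : color_card (deleted (Un :|: L)) p = 0.
  apply/eqP; rewrite -leqn0; apply: leq_trans (color_cardS p del_eligible) _.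
  rewrite leqn0 cards_eq0; apply/eqP/setP=> v; rewrite !inE; by case: (F v == p); rewrite ?andbF.
rewrite Ep subn0; have := color_cardS c Udel; rewrite color_kept /excess; lia.
Qed.
End Converse.

(** The first two conditions ensure that the truncated differences giving the numbers of slack
    vertices and of dummies are true differences. *)
Theorem can_winE : can_win <->
  [/\ feasible, #|required| <= budget2 & perfectly_matched adj present].
Proof.
split=> [[V' [cV' HV']]|[Hf Hr [f Hm]]]; last exact: (matching_wins Hf Hm Hr).
split; last exact: deletion_matching cV' HV'.
- by move=> v; apply: excess_eligible HV' _.
- exact: leq_trans (leq_addr _ _) (deletion_required cV' HV').
Qed.

End Reduction.

(** * The matching program *)

Fixpoint cwrites (c : cmd) : seq nat :=
  match c with
  | CSkip => [::]
  | CWr a _ _ => [:: a]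
  | CSeq c1 c2 => cwrites c1 ++ cwrites c2
  | CIf _ c1 c2 => cwrites c1 ++ cwrites c2
  | CFor x c => x :: cwrites c
  end.

Lemma for_ind N x c (Q : nat -> store -> Prop) m :
  Q 0 m -> (forall k m', k < N -> Q k m' -> Q k.+1 (exec N c (wr m' x 0 k))) ->
  Q N (exec N (CFor x c) m).
Proof.
move=> Q0 QS; rewrite /=.
have : forall j k m', k + j = N -> Q k m' ->
    Q N (foldl (fun m i => exec N c (wr m x 0 i)) m' (iota k j)).
  elim=> [|j IH] k m' E Qk /=; first by rewrite addn0 in E; rewrite -E.
  by apply: IH; [lia|apply: QS => //; lia].
by move=> /(_ N 0 m erefl Q0).
Qed.

Lemma exec_frame N c m a i : a \notin cwrites c -> exec N c m a i = m a i.
Proof.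
elim: c m => [|b ei ev|c1 IH1 c2 IH2|e c1 IH1 c2 IH2|x c IH] m /=.
- by [].
- by rewrite inE /wr => /negbTE ->.
- by rewrite mem_cat negb_or => /andP[H1 H2]; rewrite IH2 // IH1.
- by rewrite mem_cat negb_or => /andP[H1 H2]; case: ifP => _; [rewrite IH2|rewrite IH1].
- rewrite inE negb_or => /andP[ax ac].
  by apply: (@for_ind N x c (fun _ m' => m' a i = m a i)) => // k m' _ E;
     rewrite IH // /wr (negbTE ax).
Qed.

(** Both expressions are evaluated while [a] is partly overwritten, so their values are required not
    to depend on [a]; injectivity of [fi] keeps a cell from being written twice. *)
Lemma exec_table N x a ei ev (fi fv : nat -> nat) m : a != x ->
  (forall i j, i < N -> j < N -> fi i = fi j -> i = j) ->
  (forall m' i, i < N -> (forall b j, b != a -> b != x -> m' b j = m b j) -> m' x 0 = i ->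
     eval N m' ei = fi i /\ eval N m' ev = fv i) ->
  let m1 := exec N (CFor x (CWr a ei ev)) m in
  [/\ forall i, i < N -> m1 a (fi i) = fv i,
      forall j, (forall i, i < N -> j != fi i) -> m1 a j = m a j
    & forall b j, b != a -> b != x -> m1 b j = m b j].
Proof.
move=> ax finj Hev m1.
have : [/\ forall i, i < N -> m1 a (fi i) = fv i,
      forall j, (forall i, i < N -> j != fi i) -> m1 a j = m a j
    & forall b j, b != a -> b != x -> m1 b j = m b j].
  apply: (@for_ind N x (CWr a ei ev) (fun k m1 =>
     [/\ forall i, i < k -> m1 a (fi i) = fv i,
      forall j, (forall i, i < k -> j != fi i) -> m1 a j = m a j
    & forall b j, b != a -> b != x -> m1 b j = m b j])); first by split.
  move=> k m' kN [H1 H2 H3] /=.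
  have [||Ei Ev] := Hev (wr m' x 0 k) k kN _ _.
  - by move=> b j ba bx; rewrite /wr (negbTE bx) /= H3.
  - by rewrite /wr !eqxx.
  rewrite Ei Ev; split=> [i ik|j Hj|b j ba bx].
  - rewrite /wr eqxx (negbTE ax) /=; case: eqP => [/finj E|nE].
      by rewrite E //; lia.
    by apply: H1; rewrite ltn_neqAle -ltnS ik andbT; apply: contra_notN nE => /eqP ->.
  - rewrite /wr eqxx (negbTE ax) /= (negbTE (Hj k _)) //=.
    by apply: H2 => i ik; apply: Hj; lia.
  - by rewrite /wr (negbTE ba) (negbTE bx) /= H3.
by [].
Qed.

Definition var (a : nat) : expr := ERd a (ECst 0).
Definition set_var (a : nat) (e : expr) : cmd := CWr a (ECst 0) e.
(** The sum of the two truncated differences is the distance of the values. *)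
Definition e_eq (a b : expr) : expr := EIf (EAdd (ESub a b) (ESub b a)) (ECst 0) (ECst 1).
Definition e_not (a : expr) : expr := EIf a (ECst 0) (ECst 1).
Definition e_and (a b : expr) : expr := EIf a b (ECst 0).
Definition e_or (a b : expr) : expr := EIf a (ECst 1) b.
Definition e_lt (a b : expr) : expr := ESub b a.

Lemma eval_eq N m a b : (eval N m (e_eq a b) != 0) = (eval N m a == eval N m b).
Proof. by rewrite /=; case: ifP => H; apply/esym; lia. Qed.

Lemma eval_not N m a : (eval N m (e_not a) != 0) = ~~ (eval N m a != 0).
Proof. by rewrite /=; case: (eval N m a). Qed.

Lemma eval_and N m a b : (eval N m (e_and a b) != 0) = (eval N m a != 0) && (eval N m b != 0).
Proof. by rewrite /=; case: (eval N m a). Qed.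

Lemma eval_or N m a b : (eval N m (e_or a b) != 0) = (eval N m a != 0) || (eval N m b != 0).
Proof. by rewrite /=; case: (eval N m a). Qed.

Lemma eval_lt N m a b : (eval N m (e_lt a b) != 0) = (eval N m a < eval N m b).
Proof. by rewrite /=; lia. Qed.

Definition B1 := 23.
(* Multiplication by [N], correct only when [e] evaluates to at most [N]. *)
Definition e_mulN (e : expr) : expr := ESum B1 (EIf (e_lt (var B1) e) EN (ECst 0)).
Definition e_idx (e i : expr) : expr := EAdd (e_mulN e) i.

Lemma eval_mulN N m e : (forall i, eval N (wr m B1 0 i) e = eval N m e) ->
  eval N m e <= N -> eval N m (e_mulN e) = eval N m e * N.
Proof.
move=> Hw He; rewrite [LHS]/=.
under eq_bigr => i _ do rewrite Hw {1}/wr !eqxx /=.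
rewrite (big_cat_nat _ (n := eval N m e)) //=.
rewrite (eq_big_nat _ _ (F2 := fun=> N)) => [|i Hi]; last by rewrite ifF //; lia.
rewrite [X in _ + X](eq_big_nat _ _ (F2 := fun=> 0)) => [|i Hi]; last by rewrite ifT //; lia.
by rewrite !sum_nat_const_nat subn0 muln0 addn0.
Qed.

(* Arrays: the current matching [MATE], the membership table [DD] of [D], the matchings [MT]
   with [Mt x] in row [x], and the matching [WW] of the current walk.  The others are
   scalars: the walk from [VX] towards [VY] has its hole at [VH] and next vertex [VT], [GO]
   tells whether it continues, [YD] whether [VY] is in [D], and [FND] whether the matching
   has been augmented. *)
Definition MATE := 6.
Definition DD := 7.
Definition MT := 8.
Definition WW := 9.
Definition VX := 10.
Definition VY := 11.
Definition VH := 12.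
Definition VT := 13.
Definition VZ := 14.
Definition GO := 15.
Definition YD := 16.
Definition FND := 17.
Definition RT := 18.
Definition VI := 19.
Definition VJ := 20.
Definition PH := 21.
Definition PASS := 22.
Definition RES := 26.

Definition copy_row (src : expr) : cmd :=
  CFor VI (CWr WW (var VI) (ERd MT (e_idx src (var VI)))).
Definition copy_to_row (dst : expr) (a : nat) : cmd :=
  CFor VI (CWr MT (e_idx dst (var VI)) (ERd a (var VI))).
Definition copy_array (a b : nat) : cmd := CFor VI (CWr a (var VI) (ERd b (var VI))).

Lemma idx_eq N x y x' y' : y < N -> y' < N -> (x * N + y == x' * N + y') = (x == x') && (y == y').
Proof.
move=> yN yN'; case: (ltngtP x x') => H; last by rewrite H eqn_add2l.
- by apply/eqP => E; have := leq_mul H (leqnn N); rewrite mulSn; lia.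
- by apply/eqP => E; have := leq_mul H (leqnn N); rewrite mulSn; lia.
Qed.

Lemma wr_neq m a i v b j : b != a -> wr m a i v b j = m b j.
Proof. by rewrite /wr => /negbTE ->. Qed.

Lemma wr_eq m a i v : wr m a i v a i = v.
Proof. by rewrite /wr !eqxx. Qed.

Ltac rd := repeat (rewrite wr_eq || (rewrite wr_neq; [|by []])).

Lemma wrE m a i v j : wr m a i v a j = if j == i then v else m a j.
Proof. by rewrite /wr eqxx. Qed.

Lemma exec_seq N c1 c2 m : exec N (CSeq c1 c2) m = exec N c2 (exec N c1 m).
Proof. by []. Qed.

Lemma exec_if N e c1 c2 m :
  exec N (CIf e c1 c2) m = if eval N m e != 0 then exec N c1 m else exec N c2 m.
Proof. by rewrite /=; case: ifP. Qed.

Lemma exec_wr N a i v m : exec N (CWr a i v) m = wr m a (eval N m i) (eval N m v).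
Proof. by []. Qed.

Lemma eval_var N m a : eval N m (var a) = m a 0.
Proof. by []. Qed.

(** * Programs for a walk, a pass, a phase and a maximal sequence of phases *)

Section Program.
Variables (adjE presE : expr).

Definition walk_found : cmd :=
  CSeq (set_var FND (ECst 1)) (CSeq (copy_array MATE WW) (set_var GO (ECst 0))).

Definition walk_move : cmd :=
  CSeq (CWr WW (var VZ) (var VZ))
  (CSeq (set_var VH (var VZ))
  (CSeq (CIf (ERd DD (var VZ)) CSkip
           (CSeq (CWr DD (var VZ) (ECst 1)) (copy_to_row (var VZ) WW)))
  (CIf (var YD)
     (CSeq (set_var VT (ERd MT (e_idx (var VY) (var VZ))))
           (set_var GO (e_not (e_eq (var VT) (var VX)))))
     (set_var GO (ECst 0))))).

(** The mate of [VT] is read in the row of [VX], which agrees with [WW] on vertices not yet visited;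
    if it is [VT] itself, the new edge augments. The walk goes beyond one step only if [VY] was in
    [D] at the start, since otherwise the row of [VY] had no meaning. *)
Definition walk_body : cmd :=
  CIf (var GO)
   (CSeq (set_var VZ (ERd MT (e_idx (var VX) (var VT))))
   (CSeq (CWr WW (var VH) (var VT))
   (CSeq (CWr WW (var VT) (var VH))
   (CIf (e_eq (var VZ) (var VT)) walk_found walk_move))))
   CSkip.

Definition walk : cmd :=
  CSeq (copy_row (var VX))
  (CSeq (set_var VH (var VX))
  (CSeq (set_var VT (var VY))
  (CSeq (set_var GO (ECst 1))
  (CSeq (set_var YD (ERd DD (var VY)))
  (CFor VJ walk_body))))).

(** Loops cannot be left early; after an augmentation the flag [FND] makes the rest of the phase
    idle. *)
Definition pass_body : cmd :=
  CIf (e_and (e_not (var FND)) (e_and (ERd DD (var VX)) adjE)) walk CSkip.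

Definition pass : cmd := CFor VX (CFor VY pass_body).

Definition phase : cmd :=
  CSeq (CFor VI (CWr DD (var VI) (e_eq (var VI) (var RT))))
  (CSeq (copy_to_row (var RT) MATE)
  (CSeq (set_var FND (ECst 0))
  (CFor PASS pass))).

Definition e_exposed : expr := e_and presE (e_eq (ERd MATE (var VX)) (var VX)).

(* The least present exposed vertex, or [N] if there is none: it counts the [VY] such that no
   [VX <= VY] is present and exposed. *)
Definition e_root : expr :=
  ESum VY (EIf (ESum VX (e_and (e_not (e_lt (var VY) (var VX))) e_exposed)) (ECst 0) (ECst 1)).

Definition match_prog : cmd :=
  CSeq (CFor VI (CWr MATE (var VI) (var VI)))
  (CSeq (CFor PH (CSeq (set_var RT e_root) (CIf (e_lt (var RT) EN) phase CSkip)))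
  (set_var RES (EIf (ESum VX e_exposed) (ECst 0) (ECst 1)))).

Variables (N : nat) (m0 : store).
(* The arrays below [6] contain the graph. *)
Definition frozen (m : store) : Prop := forall a i, a < 6 -> m a i = m0 a i.

Variables (g : rel 'I_N) (pr : pred 'I_N).
Hypotheses (g_sym : symmetric g) (g_irr : irreflexive g).
Hypothesis g_pr : forall u v, g u v -> pr u.
Hypothesis adjE_ok : forall (m : store) (x y : 'I_N), frozen m -> m VX 0 = x -> m VY 0 = y ->
  (eval N m adjE != 0) = g x y.
Hypothesis presE_ok : forall (m : store) (x : 'I_N), frozen m -> m VX 0 = x ->
  (eval N m presE != 0) = pr x.

Definition rep_fun (m : store) (a : nat) (f : 'I_N -> 'I_N) : Prop :=
  forall i : 'I_N, m a i = f i.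

Definition rep_set (m : store) (D : {set 'I_N}) : Prop :=
  forall i : 'I_N, (m DD i != 0) = (i \in D).

Definition rep_table (m : store) (D : {set 'I_N}) (Mt : 'I_N -> 'I_N -> 'I_N) : Prop :=
  forall u w : 'I_N, u \in D -> m MT (u * N + w) = Mt u w.

Lemma eval_idx (m : store) (a : expr) (b : expr) (x : 'I_N) :
  (forall i, eval N (wr m B1 0 i) a = eval N m a) -> eval N m a = x ->
  eval N m (e_idx a b) = x * N + eval N m b.
Proof.
move=> Ha Ex; rewrite [LHS]/= -[\sum_(0 <= i < N) _]/(eval N m (e_mulN a)) eval_mulN // Ex //.
exact: ltnW.
Qed.

Lemma copy_row_ok (m : store) (x : 'I_N) (D : {set 'I_N}) Mt : m VX 0 = x -> rep_table m D Mt -> x \in D ->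
  let m1 := exec N (copy_row (var VX)) m in
  rep_fun m1 WW (Mt x) /\ forall b j, b != WW -> b != VI -> m1 b j = m b j.
Proof.
move=> Hx HT xD m1.
have [|||H1 _ H3] := @exec_table N VI WW (var VI) (ERd MT (e_idx (var VX) (var VI)))
   id (fun i => m MT (x * N + i)) m.
- by [].
- by [].
- move=> m' i iN Hm' Hi; split; first by [].
  rewrite [LHS]/= -[_ + _]/(eval N m' (e_idx (var VX) (var VI))).
  by rewrite (@eval_idx _ _ _ x) /= ?Hi ?Hm' // => k; rewrite /wr /= Hm'.
split=> // i; apply: etrans (H1 i (ltn_ord i)) _; exact: HT.
Qed.

Lemma copy_array_ok (m : store) a b f : a != VI -> b != VI -> a != b -> rep_fun m b f ->
  let m1 := exec N (copy_array a b) m in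
  rep_fun m1 a f /\ forall c j, c != a -> c != VI -> m1 c j = m c j.
Proof.
move=> ai bi ab Hf m1.
have [|||H1 _ H3] := @exec_table N VI a (var VI) (ERd b (var VI)) id (m b) m.
- by [].
- by [].
- by move=> m' i iN Hm' Hi; rewrite /= Hi Hm' // eq_sym.
by split=> // i; apply: etrans (H1 i (ltn_ord i)) _; apply: Hf.
Qed.

Lemma copy_to_row_ok (m : store) dst b (z : 'I_N) f : dst != VI -> b != VI -> b != MT -> dst != MT -> dst != B1 ->
  m dst 0 = z -> rep_fun m b f ->
  let m1 := exec N (copy_to_row (var dst) b) m in
  [/\ forall w : 'I_N, m1 MT (z * N + w) = f w,
      forall u w : 'I_N, u != z -> m1 MT (u * N + w) = m MT (u * N + w)
    & forall c j, c != MT -> c != VI -> m1 c j = m c j].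
Proof.
move=> di bi bm dm db Hz Hf m1.
have [|||H1 H2 H3] := @exec_table N VI MT (e_idx (var dst) (var VI)) (ERd b (var VI))
   (fun i => z * N + i) (m b) m.
- by [].
- by move=> i j iN jN /eqP; rewrite idx_eq // => /andP[_ /eqP].
- move=> m' i iN Hm' Hi; rewrite (@eval_idx _ _ _ z) /= ?Hi ?Hm' //.
  by move=> k; rewrite /wr (negbTE db) /= Hm'.
split=> // [w|u w uz]; first by apply: etrans (H1 w (ltn_ord w)) _; apply: Hf.
apply: H2 => i iN; rewrite idx_eq //; apply: contra uz => /andP[/eqP E _].
by apply/eqP/val_inj.
Qed.

Lemma eval_row (m : store) a b (x t : 'I_N) (D : {set 'I_N}) Mt : m a 0 = x -> m b 0 = t -> a != B1 ->
  rep_table m D Mt -> x \in D -> eval N m (ERd MT (e_idx (var a) (var b))) = Mt x t.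
Proof.
move=> Hx Ht aB HT xD; rewrite [LHS]/= -[_ + _]/(eval N m (e_idx (var a) (var b))).
rewrite (@eval_idx _ _ _ x) /= ?Hx ?Ht ?HT // => k.
by rewrite wr_neq.
Qed.

Lemma walk_body_start (m : store) (x t h z : 'I_N)
    (D' : {set 'I_N}) (Mt' : 'I_N -> 'I_N -> 'I_N) (W : 'I_N -> 'I_N) :
  m GO 0 != 0 -> m VX 0 = x -> m VH 0 = h -> m VT 0 = t -> x \in D' ->
  rep_table m D' Mt' -> rep_fun m WW W -> Mt' x t = z ->
  let m3 := wr (wr (wr m VZ 0 z) WW h t) WW t h in
  exec N walk_body m = exec N (if z == t then walk_found else walk_move) m3
  /\ rep_fun m3 WW (join W h t).
Proof.
move=> Hgo Hx Hh Ht xD HT HW Hz m3; split; last first.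
  move=> i; rewrite /m3 /join !wrE [wr _ VZ _ _ _ _]wr_neq // !val_eqE.
  by case: eqP => // _; case: eqP.
rewrite /walk_body exec_if eval_var Hgo !exec_seq.
set s1 := exec N (set_var VZ _) m.
have E1 : s1 = wr m VZ 0 z by rewrite /s1 /set_var exec_wr (eval_row Hx Ht _ HT xD) // Hz.
set s3 := exec N (CWr WW (var VT) (var VH)) _.
have E3 : s3 = m3.
  by rewrite /s3 E1 !exec_wr !eval_var /m3; rd; rewrite Hh Ht.
by rewrite E3 exec_if eval_eq !eval_var /m3; rd; rewrite Ht val_eqE; case: (z == t).
Qed.

Lemma walk_body_augment (m : store) (x t h : 'I_N)
    (D' : {set 'I_N}) (Mt' : 'I_N -> 'I_N -> 'I_N) (W : 'I_N -> 'I_N) :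
  m GO 0 != 0 -> m VX 0 = x -> m VH 0 = h -> m VT 0 = t -> x \in D' ->
  rep_table m D' Mt' -> rep_fun m WW W -> Mt' x t = t ->
  let m1 := exec N walk_body m in
  [/\ rep_fun m1 MATE (join W h t), m1 FND 0 = 1 & m1 GO 0 = 0].
Proof.
move=> Hgo Hx Hh Ht xD HT HW Hz m1.
have [E Hj] := walk_body_start Hgo Hx Hh Ht xD HT HW Hz.
rewrite /m1 E eqxx /walk_found !exec_seq.
set s1 := exec N (set_var FND _) _.
have Hs1 : rep_fun s1 WW (join W h t) by move=> i; rewrite /s1 /set_var exec_wr wr_neq.
have [//|//|//|H1 H2] := copy_array_ok (a := MATE) _ _ _ Hs1.
rewrite /set_var exec_wr; split; rewrite ?wr_eq //.
by rewrite wr_neq // H2 // /s1 exec_wr wr_eq.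
Qed.

Lemma walk_body_move (m : store) (x y t h z : 'I_N)
    (D' : {set 'I_N}) (Mt' : 'I_N -> 'I_N -> 'I_N) (W : 'I_N -> 'I_N) (yd : bool) :
  m GO 0 != 0 -> m VX 0 = x -> m VY 0 = y -> m VH 0 = h -> m VT 0 = t -> x \in D' ->
  (m YD 0 != 0) = yd -> (yd -> y \in D') ->
  rep_set m D' -> rep_table m D' Mt' -> rep_fun m WW W -> Mt' x t = z -> W t = z -> z != t ->
  let m1 := exec N walk_body m in
  let W1 := hmove W h t in
  [/\ rep_fun m1 WW W1, m1 VH 0 = z, rep_set m1 (z |: D'),
      rep_table m1 (z |: D') (walk_table D' Mt' z W1)
    & [/\ forall i, m1 MATE i = m MATE i, m1 FND 0 = m FND 0 &
      if yd then m1 VT 0 = Mt' y z /\ (m1 GO 0 != 0) = (Mt' y z != x) else m1 GO 0 = 0]].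
Proof.
move=> Hgo Hx Hy Hh Ht xD Hyd ydD HS HT HW Hz HWz zt m1 W1.
have [E Hj] := walk_body_start Hgo Hx Hh Ht xD HT HW Hz.
rewrite /m1 E (negbTE zt) /walk_move !exec_seq.
set m3 := wr (wr (wr m VZ 0 z) WW h t) WW t h in Hj *.
set s4 := exec N (CWr WW _ _) m3.
have Hz3 : m3 VZ 0 = z by rewrite /m3; rd.
have Hs4 : s4 = wr m3 WW z z by rewrite /s4 exec_wr eval_var Hz3.
have HW4 : rep_fun s4 WW W1.
  move=> i; rewrite Hs4 wrE val_eqE /W1 /hmove HWz; case: eqP => [//|_].
  exact: Hj.
set s5 := exec N (set_var VH _) s4.
have Hs5 : s5 = wr s4 VH 0 z by rewrite /s5 /set_var exec_wr eval_var Hs4; rd; rewrite Hz3.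
have F5 a i : a \notin [:: VZ; WW; VH] -> s5 a i = m a i.
  by rewrite !inE !negb_or => /and3P[aZ aW aH]; rewrite Hs5 Hs4 /m3 !wr_neq.
have W5 : rep_fun s5 WW W1 by move=> i; rewrite Hs5; rd.
have Z5 : s5 VZ 0 = z by rewrite Hs5 Hs4; rd.
have H5 : s5 VH 0 = z by rewrite Hs5; rd.
have S5 : rep_set s5 D' by move=> i; rewrite F5.
have T5 : rep_table s5 D' Mt' by move=> u w uD; rewrite F5 // HT.
set s6 := exec N (CIf (ERd DD _) _ _) s5.
have [S6 T6 F6] : [/\ rep_set s6 (z |: D'), rep_table s6 (z |: D') (walk_table D' Mt' z W1)
    & forall a i, a \notin [:: DD; MT; VI] -> s6 a i = s5 a i].
  rewrite /s6 exec_if [eval _ _ _]/= Z5 S5 /walk_table; case: ifP => zD.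
    rewrite (setUidPr _) ?sub1set //; split=> //.
  rewrite exec_seq; set s' := exec N (CWr DD _ _) s5.
  have Es' : s' = wr s5 DD z 1 by rewrite /s' exec_wr eval_var Z5.
  have Z' : s' VZ 0 = z by rewrite Es'; rd.
  have W' : rep_fun s' WW W1 by move=> i; rewrite Es'; rd.
  have [//|//|//|//|//|R1 R2 R3] := copy_to_row_ok (dst := VZ) (b := WW) _ _ _ _ _ Z' W'.
  split.
  - move=> i; rewrite exec_frame // Es' wrE in_setU1 val_eqE; case: (i == z) => //=.
  - move=> u w; rewrite in_setU1; case: (eqVneq u z) => [-> _|uz]; first exact: R1.
    by rewrite orFb => uD; rewrite R2 // Es' wr_neq // T5.
  - by move=> a i; rewrite !inE !negb_or => /and3P[a1 a2 a3]; rewrite R3 // Es' wr_neq.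
have Y6 : s6 VY 0 = y by rewrite F6 // F5.
have X6 : s6 VX 0 = x by rewrite F6 // F5.
have Z6 : s6 VZ 0 = z by rewrite F6.
have W6 : rep_fun s6 WW W1 by move=> i; rewrite F6.
have H6 : s6 VH 0 = z by rewrite F6.
set s7 := exec N (CIf _ _ _) s6.
have Fr7 a i : a \notin [:: VT; GO; GO] -> s7 a i = s6 a i by move=> aN; apply: exec_frame.
split.
- by move=> i; rewrite Fr7.
- by rewrite Fr7.
- by move=> i; rewrite Fr7.
- by move=> u w uD; rewrite Fr7 // T6.
split.
- by move=> i; rewrite Fr7 // F6 // F5.
- by rewrite Fr7 // F6 // F5.
rewrite /s7 exec_if eval_var F6 // F5 // Hyd; case: yd Hyd ydD => Hyd ydD.
  rewrite exec_seq; set s8 := exec N (set_var VT _) s6.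
  have yD1 : y \in z |: D' by rewrite in_setU1 ydD ?orbT.
  have E8 : s8 = wr s6 VT 0 (Mt' y z).
    rewrite /s8 /set_var exec_wr (eval_row Y6 Z6 _ T6) // /walk_table.
    case: ifP => // zD; case: eqP => // yz; by rewrite -yz ydD in zD.
  rewrite /set_var exec_wr wr_eq eval_not eval_eq !eval_var E8; rd.
  by rewrite X6 val_eqE.
by rewrite /set_var exec_wr wr_eq.
Qed.

Section Walk.
Variables (M : 'I_N -> 'I_N) (r : 'I_N) (D : {set 'I_N}) (Mt : 'I_N -> 'I_N -> 'I_N).
Variables (A : {set 'I_N}) (c : 'I_N -> 'I_N).
Hypothesis PI : phase_inv g M r D Mt A c.

Definition augmented (m : store) : Prop :=
  m FND 0 != 0 /\ exists M' : 'I_N -> 'I_N,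
    [/\ rep_fun m MATE M', matching g M' & #|exposed M'| < #|exposed M|].

(** The set [A] and the labels [c] are not stored, so two states are compared through [D]. If [D] is
    unchanged, the old [A] and [c] fit the new table, which keeps what other edges have already
    shown. *)
Definition walk_post (x y : 'I_N) (m : store) : Prop :=
  augmented m \/
  [/\ m FND 0 = 0, rep_fun m MATE M & exists D' Mt' A' c',
    [/\ rep_set m D', rep_table m D' Mt', phase_inv g M r D' Mt' A' c', D \subset D'
      & D' = D -> phase_inv g M r D' Mt' A c /\ (y \in A \/ y \in D /\ c y = c x)]].

Lemma walk_post_agree x y (m m' : store) :
  (forall a i, a != VJ -> m' a i = m a i) -> walk_post x y m -> walk_post x y m'.
Proof.
move=> E [[F [M' [H1 H2 H3]]]|[F HM [D' [Mt' [A' [c' [H1 H2 H3 H4 H5]]]]]]].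
  left; split; first by rewrite E.
  by exists M'; split=> // i; rewrite E // H1.
right; split; [by rewrite E|by move=> i; rewrite E // HM|].
exists D', Mt', A', c'; split=> //; first by move=> i; rewrite E // H1.
by move=> u w uD; rewrite E // H2.
Qed.

Lemma walk_loop_in (m : store) (x y : 'I_N) : x \in D -> y \in D -> g x y ->
  m VX 0 = x -> m VY 0 = y -> m YD 0 != 0 -> m FND 0 = 0 -> rep_fun m MATE M ->
  m GO 0 != 0 -> m VH 0 = x -> m VT 0 = y -> rep_fun m WW (Mt x) ->
  rep_set m D -> rep_table m D Mt ->
  walk_post x y (exec N (CFor VJ walk_body) m).
Proof.
move=> xD yD gxy Hx Hy Hyd HF HM HG Hh Ht HW HS HT.
pose Q k (m' : store) := [/\ m' VX 0 = x, m' VY 0 = y, m' YD 0 != 0 &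
  (m' GO 0 = 0 /\ walk_post x y m') \/
  [/\ m' GO 0 != 0, m' FND 0 = 0, rep_fun m' MATE M & exists V W h t D' Mt',
    [/\ walk_inv g M r D Mt A c x y V W h t D' Mt', #|V| = k.*2.+1 &
    [/\ rep_fun m' WW W, m' VH 0 = nat_of_ord h, m' VT 0 = nat_of_ord t,
        rep_set m' D' & rep_table m' D' Mt']]]].
have [] : Q N (exec N (CFor VJ walk_body) m); last first.
  move=> _ _ _ [[_ //]|[_ _ _ [V [W [h [t [D' [Mt' [_ cV _]]]]]]]]].
  (* Each round visits two more vertices, so a walk of [N] rounds would visit [2 N + 1] of them. *)
  by have := max_card (mem V); rewrite cV card_ord; lia.
apply: for_ind.
  split=> //; right; split=> //; exists [set x], (Mt x), x, y, D, Mt; split=> //.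
    exact: (walk_start g_irr PI).
  by rewrite cards1.
move=> k m' kN [Hx' Hy' Hyd' Hcase].
set m1 := wr m' VJ 0 k.
have E1 a i : a != VJ -> m1 a i = m' a i by move=> aJ; rewrite /m1 wr_neq.
have FX : exec N walk_body m1 VX 0 = x by rewrite exec_frame // E1.
have FY : exec N walk_body m1 VY 0 = y by rewrite exec_frame // E1.
have FYD : exec N walk_body m1 YD 0 != 0 by rewrite exec_frame // E1.
split=> //; case: Hcase => [[G0 HP]|[G1 F1 M1 [V [W [h [t [D' [Mt' [WI cV [W1 h1 t1 S1 T1]]]]]]]]]].
  have -> : exec N walk_body m1 = m1 by rewrite /walk_body exec_if eval_var E1 // G0.
  by left; split; [rewrite E1|exact: walk_post_agree HP].
have D'E := wi_D' WI.
have xD' : x \in D' by rewrite D'E inE xD.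
have yD' : y \in D' by rewrite D'E inE yD.
have S1' : rep_set m1 D' by move=> i; rewrite E1.
have T1' : rep_table m1 D' Mt' by move=> u w uD; rewrite E1 // T1.
have W1' : rep_fun m1 WW W by move=> i; rewrite E1.
set z := Mt x t.
have Ez : Mt' x t = z by rewrite (wi_old WI xD).
have [Wz zt cV1 Hstep] := walk_step g_sym g_irr PI xD yD WI
   (Mt'' := walk_table D' Mt' z (hmove W h t)) (fun u _ => frefl _).
have X1 : m1 VX 0 = x by rewrite E1.
have Y1 : m1 VY 0 = y by rewrite E1.
have H1 : m1 VH 0 = h by rewrite E1.
have T1'' : m1 VT 0 = t by rewrite E1.
have G1' : m1 GO 0 != 0 by rewrite E1.
have YD1 : (m1 YD 0 != 0) = true by rewrite E1.
have [R1 R2 R3 R4 [R5 R6 [R7 R8]]] := @walk_body_move m1 x y t h z D' Mt' W true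
  G1' X1 Y1 H1 T1'' xD' YD1 (fun=> yD') S1' T1' W1' Ez Wz zt.
have Ey : Mt' y z = Mt y z by rewrite (wi_old WI yD).
rewrite Ey in R7 R8; rewrite -/z in Hstep cV1.
case: eqP Hstep R8 => [t1x|t1x] Hstep R8.
  left; split; first by move: R8; case: eqP => // ->.
  have [A' [c' [P1 P2 P3]]] := Hstep.
  right; split; [by rewrite R6 E1|by move=> i; rewrite R5 E1|].
  do 4! eexists; split; [exact: R3|exact: R4|exact: P1|exact: P2|].
  by move=> ED; have [Q1 Q2] := P3 ED; split=> //; right.
right; split.
- by rewrite R8.
- by rewrite R6 E1.
- by move=> i; rewrite R5 E1.
do 6! eexists; split; first exact: Hstep.
  by rewrite cV1 cV doubleS.
by [].
Qed.

Lemma walk_loop_out (m : store) (x y : 'I_N) : x \in D -> y \notin D -> g x y ->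
  m VX 0 = x -> m VY 0 = y -> m YD 0 = 0 -> m FND 0 = 0 -> rep_fun m MATE M ->
  m GO 0 != 0 -> m VH 0 = x -> m VT 0 = y -> rep_fun m WW (Mt x) ->
  rep_set m D -> rep_table m D Mt ->
  walk_post x y (exec N (CFor VJ walk_body) m).
Proof.
move=> xD yD gxy Hx Hy Hyd HF HM HG Hh Ht HW HS HT.
(* The first round already clears [GO]; the second alternative describes only the start. *)
pose Q k (m' : store) := (m' GO 0 = 0 /\ walk_post x y m') \/
  (k = 0 /\ forall a i, a != VJ -> m' a i = m a i).
have : Q N (exec N (CFor VJ walk_body) m); last first.
  by case=> [[]//|[N0 _]]; exfalso; have := ltn_ord x; lia.
apply: for_ind; first by right.
move=> k m' kN [[G0 HP]|[_ E]].
  have -> : exec N walk_body (wr m' VJ 0 k) = wr m' VJ 0 k.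
    by rewrite /walk_body exec_if eval_var wr_neq // G0.
  left; split; first by rewrite wr_neq.
  by apply: walk_post_agree HP => a i aJ; rewrite wr_neq.
set m1 := wr m' VJ 0 k.
have E1 a i : a != VJ -> m1 a i = m a i by move=> aJ; rewrite /m1 wr_neq ?E.
have S1 : rep_set m1 D by move=> i; rewrite E1.
have T1 : rep_table m1 D Mt by move=> u w uD; rewrite E1 // HT.
have W1 : rep_fun m1 WW (Mt x) by move=> i; rewrite E1.
have X1 : m1 VX 0 = x by rewrite E1.
have H1 : m1 VH 0 = x by rewrite E1.
have T1' : m1 VT 0 = y by rewrite E1.
have Y1 : m1 VY 0 = y by rewrite E1.
have G1 : m1 GO 0 != 0 by rewrite E1.
left; case: (eqVneq (Mt x y) y) => [Ey|Ney].
  have [R1 R2 R3] := walk_body_augment G1 X1 H1 T1' xD T1 W1 Ey.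
  split=> //; left; split; first by rewrite R2.
  have [P1 P2] := augment g_sym g_irr PI xD gxy Ey.
  by exists (join (Mt x) x y).
have YD1 : (m1 YD 0 != 0) = false by rewrite E1 // Hyd.
have [//|R1 R2 R3 R4 [R5 R6 R7]] := @walk_body_move m1 x y y x (Mt x y) D Mt (Mt x) false
  G1 X1 Y1 H1 T1' xD YD1 _ S1 T1 W1 erefl erefl Ney.
split=> //; right; split; [by rewrite R6 E1|by move=> i; rewrite R5 E1|].
(* For [y] in [A] the hole moves to a vertex of [D] by [pi_A], so the table stays as it is. *)
have [yA|yA] := boolP (y \in A).
  have zD := pi_A PI xD yA.
  exists D, Mt, A, c; split=> //; last by move=> _; split=> //; left.
    by move=> i; rewrite R3 (setUidPr _) ?sub1set.
  move=> u w uD; rewrite R4 ?inE ?uD ?orbT // /walk_table zD //.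
have zDA := mate_outside PI xD yD yA.
have zD : Mt x y \notin D by apply: contra zDA; rewrite inE => ->.
do 4! eexists; split; [exact: R3|exact: R4| |exact: subsetUr|].
  apply: (grow g_sym g_irr PI xD gxy yD yA Ney); last first.
    by rewrite /walk_table (negbTE zD) eqxx.
  move=> w wD u; rewrite /walk_table (negbTE zD).
  by case: eqP => // wz; rewrite -wz wD in zD.
by move=> ED; move: zD; rewrite -ED setU11.
Qed.

Lemma walk_ok (m : store) (x y : 'I_N) : x \in D -> g x y ->
  m VX 0 = x -> m VY 0 = y -> m FND 0 = 0 -> rep_fun m MATE M ->
  rep_set m D -> rep_table m D Mt -> walk_post x y (exec N walk m).
Proof.
move=> xD gxy Hx Hy HF HM HS HT; rewrite /walk exec_seq.
have [HW E] := copy_row_ok Hx HT xD.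
set m1 := exec N (copy_row _) m in HW E *.
rewrite /set_var !exec_seq !exec_wr.
set m5 := wr _ YD _ _.
have Em5 : m5 = wr (wr (wr (wr m1 VH 0 x) VT 0 y) GO 0 1) YD 0 (m DD y).
  by rewrite /m5 /=; rd; rewrite !E // Hx Hy.
have E5 a i : a \notin [:: VH; VT; GO; YD; WW; VI] -> m5 a i = m a i.
  rewrite !inE !negb_or => /and5P[a1 a2 a3 a4 /andP[a5 a6]].
  by rewrite Em5 !wr_neq // E.
have W5 : rep_fun m5 WW (Mt x) by move=> i; rewrite Em5; rd.
have X5 : m5 VX 0 = x by rewrite E5.
have Y5 : m5 VY 0 = y by rewrite E5.
have H5 : m5 VH 0 = x by rewrite Em5; rd.
have T5 : m5 VT 0 = y by rewrite Em5; rd.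
have G5 : m5 GO 0 != 0 by rewrite Em5; rd.
have F5 : m5 FND 0 = 0 by rewrite E5.
have M5 : rep_fun m5 MATE M by move=> i; rewrite E5.
have S5 : rep_set m5 D by move=> i; rewrite E5.
have TT5 : rep_table m5 D Mt by move=> u w uD; rewrite E5 // HT.
have YD5 : (m5 YD 0 != 0) = (y \in D) by rewrite Em5; rd.
have [yD|yD] := boolP (y \in D); rewrite ?yD ?(negbTE yD) in YD5.
  exact: walk_loop_in.
by apply: walk_loop_out => //; apply/eqP; move/negbT: YD5; rewrite negbK.
Qed.

End Walk.

Lemma frozen_agree (m m' : store) : (forall a i, a < 6 -> m' a i = m a i) -> frozen m -> frozen m'.
Proof. by move=> E Hm a i a6; rewrite E // Hm. Qed.

Lemma small_notin a (s : seq nat) : all (fun b => 5 < b) s -> a < 6 -> a \notin s.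
Proof. by move=> Hs a6; apply/negP => /(allP Hs); lia. Qed.

Lemma frozen_exec cc (m : store) : all (fun b => 5 < b) (cwrites cc) -> frozen m -> frozen (exec N cc m).
Proof.
move=> Hall; apply: frozen_agree => a i a6; rewrite exec_frame //.
exact: small_notin.
Qed.

Definition no_perfect : Prop := ~ exists f : 'I_N -> 'I_N, forall v, pr v -> g v (f v) /\ f (f v) = v.

(** * Scanning all edges until nothing changes *)

Section Pass.
Variables (M : 'I_N -> 'I_N) (r : 'I_N).

(* The edges in [seen] can no longer change anything, so [scanned] with all edges seen is the
   hypothesis of [stuck_no_perfect]. *)
Definition scanned (D : {set 'I_N}) (A : {set 'I_N}) (c : 'I_N -> 'I_N) (seen : 'I_N -> 'I_N -> bool) :=
  forall x y, seen x y -> x \in D -> g x y -> y \in A \/ y \in D /\ c y = c x.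

Definition pass_post (D A : {set 'I_N}) (c : 'I_N -> 'I_N) (seen : 'I_N -> 'I_N -> bool) (m : store) : Prop :=
  augmented M m \/
  [/\ m FND 0 = 0, rep_fun m MATE M & exists D' Mt' A' c',
    [/\ rep_set m D', rep_table m D' Mt', phase_inv g M r D' Mt' A' c', D \subset D'
      & D' = D -> phase_inv g M r D Mt' A c /\ scanned D A c seen]].

Lemma pass_post_agree (D A : {set 'I_N}) (c : 'I_N -> 'I_N) (seen : 'I_N -> 'I_N -> bool) (m m' : store) :
  (forall a i, a \notin [:: VX; VY; PASS] -> m' a i = m a i) ->
  pass_post D A c seen m -> pass_post D A c seen m'.
Proof.
move=> E [[F [M' [H1 H2 H3]]]|[F HM [D' [Mt' [A' [c' [H1 H2 H3 H4 H5]]]]]]].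
  left; split; first by rewrite E.
  by exists M'; split=> // i; rewrite E // H1.
right; split; [by rewrite E|by move=> i; rewrite E // HM|].
exists D', Mt', A', c'; split=> //; first by move=> i; rewrite E // H1.
by move=> u w uD; rewrite E // H2.
Qed.

Lemma pass_post_weaken (D A : {set 'I_N}) (c : 'I_N -> 'I_N) (seen seen' : 'I_N -> 'I_N -> bool) (m : store) :
  (forall x y, seen' x y -> seen x y) ->
  pass_post D A c seen m -> pass_post D A c seen' m.
Proof.
move=> E [H|[F HM [D' [Mt' [A' [c' [H1 H2 H3 H4 H5]]]]]]]; first by left.
right; split=> //; exists D', Mt', A', c'; split=> // ED.
by have [P1 P2] := H5 ED; split=> // x y /E; apply: P2.
Qed.

(** The record of earlier edges refers to the [A] and [c] at the beginning of the pass. Once [D] has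
    grown it cannot shrink again, and the clause about [seen] holds vacuously. *)
Lemma pass_step (D A : {set 'I_N}) (c : 'I_N -> 'I_N) (seen : 'I_N -> 'I_N -> bool) (m : store) (x y : 'I_N) :
  frozen m -> m VX 0 = x -> m VY 0 = y -> pass_post D A c seen m ->
  pass_post D A c (fun u v => (u == x) && (v == y) || seen u v)
    (exec N pass_body m).
Proof.
move=> Hf Hx Hy HP; rewrite /pass_body exec_if !eval_and eval_not eval_var (adjE_ok Hf Hx Hy) [eval _ _ _]/= Hx.
have [w Ew] : exists w, w = exec N walk m by eexists.
rewrite -Ew -[exec N CSkip m]/m.
case: HP => [[F HA]|[F HM [D' [Mt' [A' [c' [HS HT PI' DD' Heq]]]]]]].
  by rewrite F; left; split.
rewrite F eqxx /= HS; have [/andP[xD' gxy]|] := boolP (_ && _); last first.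
  move=> Hn; right; split=> //; exists D', Mt', A', c'; split=> // ED.
  have [P1 P2] := Heq ED; split=> // u v /orP[/andP[/eqP -> /eqP ->]|]; last exact: P2.
  by move=> xD gxy; rewrite ED xD gxy in Hn.
have [ED|/eqP ED] := D' =P D.
  rewrite ED in HS HT xD'.
  have [P1 P2] := Heq ED.
  have := walk_ok P1 xD' gxy Hx Hy F HM HS HT; rewrite -Ew.
  case=> [|[F1 HM1 [D1 [Mt1 [A1 [c1 [S1 T1 PI1 D1D H1]]]]]]]; first by left.
  right; split=> //; exists D1, Mt1, A1, c1; split=> // E1.
  have [Q1 Q2] := H1 E1; rewrite E1 in Q1; split=> // u v /orP[/andP[/eqP -> /eqP ->]|] //.
  exact: P2.
have := walk_ok PI' xD' gxy Hx Hy F HM HS HT; rewrite -Ew.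
case=> [|[F1 HM1 [D1 [Mt1 [A1 [c1 [S1 T1 PI1 D1D H1]]]]]]]; first by left.
right; split=> //; exists D1, Mt1, A1, c1; split=> //; first exact: subset_trans D1D.
by move=> E1; case/negP: ED; rewrite eqEsubset DD' -E1 D1D.
Qed.

Lemma pass_ok (D A : {set 'I_N}) (c : 'I_N -> 'I_N) (m : store) :
  frozen m -> pass_post D A c (fun _ _ => false) m ->
  pass_post D A c (fun _ _ => true) (exec N pass m).
Proof.
move=> Hf HP0.
suff [_ H] : frozen (exec N pass m) /\ pass_post D A c (fun u _ => u < N) (exec N pass m).
  by apply: pass_post_weaken H => u _ _.
apply: (for_ind (Q := fun k m' => frozen m' /\ pass_post D A c (fun u _ => u < k) m')).
  by split=> //; apply: pass_post_weaken HP0.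
move=> k m' kN [Hf' HP]; set m1 := wr m' VX 0 k.
have Hf1 : frozen m1 by move=> a i a6; rewrite /m1 wr_neq ?Hf' //; apply/eqP => E; rewrite E in a6.
have HP1 : pass_post D A c (fun u _ => u < k) m1.
  apply: pass_post_agree HP => a i; rewrite !inE !negb_or => /andP[aX _].
  by rewrite /m1 wr_neq.
pose x := Ordinal kN.
have X1 : m1 VX 0 = x by rewrite /m1; rd.
suff [H1 _ H3] : [/\ frozen (exec N (CFor VY pass_body) m1),
   exec N (CFor VY pass_body) m1 VX 0 = x & pass_post D A c (fun u v => (u == x) && (v < N) || (u < k)) (exec N (CFor VY pass_body) m1)].
  split=> //; apply: pass_post_weaken H3 => u v; rewrite ltnS leq_eqVlt ltn_ord andbT.
  by rewrite -[(u : nat) == k]/(u == x).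
apply: (for_ind (Q := fun j m' => [/\ frozen m', m' VX 0 = x
   & pass_post D A c (fun u v => (u == x) && (v < j) || (u < k)) m'])).
  by split=> //; apply: pass_post_weaken HP1 => u v; rewrite ltn0 andbF.
move=> j m2 jN [Hf2 X2 HP2]; set m3 := wr m2 VY 0 j.
have Hf3 : frozen m3 by move=> a i a6; rewrite /m3 wr_neq ?Hf2 //; apply/eqP => E; rewrite E in a6.
have X3 : m3 VX 0 = x by rewrite /m3; rd.
pose y := Ordinal jN.
have Y3 : m3 VY 0 = y by rewrite /m3; rd.
split.
- exact: frozen_exec.
- by rewrite exec_frame.
have HP3 : pass_post D A c (fun u v => (u == x) && (v < j) || (u < k)) m3.
  apply: pass_post_agree HP2 => a i; rewrite !inE !negb_or => /and3P[_ aY _].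
  by rewrite /m3 wr_neq.
apply: pass_post_weaken (pass_step Hf3 X3 Y3 HP3) => u v.
rewrite ltnS leq_eqVlt -[(v : nat) == j]/(v == y).
by case: (u == x) => //=; case: (v == y).
Qed.

End Pass.

Lemma phase_ok (M : 'I_N -> 'I_N) (r : 'I_N) (m : store) :
  frozen m -> matching g M -> M r = r -> pr r -> rep_fun m MATE M -> m RT 0 = r ->
  let m1 := exec N phase m in augmented M m1 \/ (rep_fun m1 MATE M /\ no_perfect).
Proof.
move=> Hf HM Mr prr Hmate Hr m1; rewrite /m1 /phase !exec_seq.
set s1 := exec N (CFor VI _) m.
have [|||R1 _ R3] := @exec_table N VI DD (var VI) (e_eq (var VI) (var RT)) id
  (fun i => eval N m (e_eq (ECst i) (var RT))) m.
- by [].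
- by [].
- by move=> m' i iN Hm' Hi; rewrite /= Hi Hm'.
have S1 : rep_set s1 [set r].
  move=> i; have -> : s1 DD i = eval N m (e_eq (ECst i) (var RT)) by exact: R1.
  by rewrite eval_eq /= Hr inE val_eqE.
have E1 a i : a != DD -> a != VI -> s1 a i = m a i by exact: R3.
have Mate1 : rep_fun s1 MATE M by move=> i; rewrite E1.
have RT1 : s1 RT 0 = r by rewrite E1.
have [//|//|//|//|//|T2 _ E2] := copy_to_row_ok (dst := RT) (b := MATE) _ _ _ _ _ RT1 Mate1.
set s2 := exec N (copy_to_row _ _) s1 in T2 E2 *.
set s3 := exec N (set_var FND _) s2.
have E3 a i : a \notin [:: DD; VI; MT; FND] -> s3 a i = m a i.
  by rewrite !inE !negb_or => /and4P[*]; rewrite /s3 /set_var exec_wr wr_neq // E2 // E1.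
have F3 : s3 FND 0 = 0 by rewrite /s3 /set_var exec_wr wr_eq.
have S3 : rep_set s3 [set r] by move=> i; rewrite /s3 /set_var exec_wr wr_neq // E2.
have T3 : rep_table s3 [set r] (fun _ => M).
  by move=> u w /set1P ->; rewrite /s3 /set_var exec_wr wr_neq.
have M3 : rep_fun s3 MATE M by move=> i; rewrite E3.
have Hf3 : frozen s3.
  by apply: frozen_agree Hf => a i a6; apply: E3; apply: small_notin.
have PI0 : phase_inv g M r [set r] (fun _ => M) set0 id.
  split=> //.
  - exact: set11.
  - move=> l /imsetP[w /set1P -> ->]; rewrite (_ : [set _ in _ | _] = [set r]) ?cards1 //.
    by apply/setP=> u; rewrite !inE; case: eqP.
  - by rewrite imset_set1 cards1 cards0.
  - by move=> w; rewrite in_set0.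
  - by move=> w; rewrite setU0 => /set1P.
  - by move=> w; rewrite setU0 => /set1P ->; rewrite Mr set11.
  - by move=> x w /set1P ->; case: (eqVneq w r) => [->|]; rewrite ?Mr ?eqxx //= andbT.
  - by move=> x a _; rewrite in_set0.
  - by move=> x w _ /set1P -> _; rewrite Mr.
  - by move=> a x1 x2 x3; rewrite in_set0.
(* A pass without augmentation enlarges [D], which starts with one vertex, or finds it stuck; so [N]
   passes suffice. *)
pose Q k (m' : store) := frozen m' /\ (augmented M m' \/
  [/\ m' FND 0 = 0, rep_fun m' MATE M & exists D Mt A c,
    [/\ rep_set m' D, rep_table m' D Mt, phase_inv g M r D Mt A c & k < #|D| \/ no_perfect]]).
have [_ [|[_ H [D [Mt [A [c [_ _ _ []]]]]]]]] : Q N (exec N (CFor PASS pass) s3).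
- apply: for_ind.
    split=> //; right; split=> //; exists [set r], (fun _ => M), set0, id.
    by split=> //; left; rewrite cards1.
  move=> k m' kN [Hf' Hc]; set m2 := wr m' PASS 0 k.
  have E4 a i : a != PASS -> m2 a i = m' a i by move=> aP; rewrite /m2 wr_neq.
  have Hf2 : frozen m2.
    by apply: frozen_agree Hf' => a i a6; apply: E4; rewrite /PASS; lia.
  split; first exact: frozen_exec.
  have HP D A c : pass_post M r D A c (fun _ _ => false) m' ->
      pass_post M r D A c (fun _ _ => true) (exec N pass m2).
    move=> H; apply: pass_ok => //.
  have stuck D Mt A c : phase_inv g M r D Mt A c -> scanned D A c (fun _ _ => true) -> no_perfect.
    move=> PI Hs; apply: (stuck_no_perfect g_irr PI g_pr prr) => x y xD gxy.
    exact: Hs.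
  case: Hc => [HA|[F HMm [D [Mt [A [c [HS HT PI Hk]]]]]]].
    (* After an augmentation [D] may be chosen freely. With [setT] every larger [D'] is equal to it,
       so even the second outcome of [pass_post] yields a stuck state. *)
    have [|[F' HM' [D' [Mt' [A' [c' [S' T' P' DD' Heq]]]]]]] := HP setT set0 id (or_introl HA).
      by left.
    right; split=> //; exists D', Mt', A', c'; split=> //; right.
    have [|P1 P2] := Heq; first by apply/eqP; rewrite -subTset.
    exact: stuck P1 P2.
  have [|[F' HM' [D' [Mt' [A' [c' [S' T' P' DD' Heq]]]]]]] : pass_post M r D A c (fun _ _ => true) (exec N pass m2).
  - by apply: HP; right; split=> //; exists D, Mt, A, c; split.
  - by left.
  right; split=> //; exists D', Mt', A', c'; split=> //.
  case: Hk => [Hk|]; last by right.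
  have [ED|ED] := eqVneq D' D.
    by right; have [P1 P2] := Heq ED; apply: stuck P1 P2.
  left; apply: leq_ltn_trans Hk _; apply: proper_card.
  by rewrite properEneq eq_sym ED.
- by left.
- by have := max_card (mem D); rewrite card_ord ltnNge => ->.
- by right.
Qed.

(** [F] vanishes exactly before the first number satisfying [q], so the sum counts the numbers below
    it. *)
Lemma first_sum (n : nat) (q : nat -> bool) (F : nat -> nat) :
  (forall b, b < n -> (F b == 0) = ~~ has q (iota 0 b.+1)) ->
  \sum_(0 <= b < n) (if F b == 0 then 1 else 0) = find q (iota 0 n).
Proof.
elim: n => [|n IHn] HF; first by rewrite big_geq.
rewrite big_nat_recr // IHn => [|b bn]; last by apply: HF; lia.
rewrite HF // -[n.+1]addn1 iotaD find_cat has_cat size_iota /=.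
rewrite add0n orbF; case: (boolP (has q _)) => [_|Hn] /=; first by rewrite addn0.
by rewrite (hasNfind Hn) size_iota; case: (q n).
Qed.

Definition exposed_at (M : 'I_N -> 'I_N) (x : nat) : bool :=
  if insub x is Some i then pr i && (M i == i) else false.

Lemma exposed_at_ord M (i : 'I_N) : exposed_at M i = pr i && (M i == i).
Proof. by rewrite /exposed_at valK. Qed.

Lemma eval_exposed M (m : store) (x : nat) : x < N -> frozen m -> rep_fun m MATE M -> m VX 0 = x ->
  (eval N m e_exposed != 0) = exposed_at M x.
Proof.
move=> xN Hf HM Hx; pose i := Ordinal xN.
rewrite -[x]/(val i) exposed_at_ord /e_exposed eval_and (@presE_ok _ i) // eval_eq.
by rewrite [eval _ _ _]/= Hx -[x]/(val i) HM /= Hx -[x]/(val i) val_eqE.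
Qed.

Lemma eval_root M (m : store) : frozen m -> rep_fun m MATE M ->
  eval N m e_root = find (exposed_at M) (iota 0 N).
Proof.
move=> Hf HM; rewrite [LHS]/=.
set F := fun b => \sum_(0 <= x < N) eval N (wr (wr m VY 0 b) VX 0 x)
   (e_and (e_not (e_lt (var VY) (var VX))) e_exposed).
have HF b : b < N -> (F b == 0) = ~~ has (exposed_at M) (iota 0 b.+1).
  move=> bN; have Ev x : x < N -> (eval N (wr (wr m VY 0 b) VX 0 x)
      (e_and (e_not (e_lt (var VY) (var VX))) e_exposed) != 0) = (x <= b) && exposed_at M x.
    move=> xN; rewrite eval_and eval_not eval_lt !eval_var; rd; rewrite -leqNgt.
    rewrite (@eval_exposed M _ x) //.
    by apply: frozen_agree Hf => a i a6; rewrite !wr_neq // /VX /VY; lia.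
  rewrite /F big_mkord sum_nat_eq0; apply/forall_inP/hasPn => [H x|H i _].
    rewrite mem_iota add0n => /= xb; have xN : x < N by lia.
    by have := H (Ordinal xN) isT; rewrite /= -[_ == 0]negbK Ev // -ltnS xb.
  rewrite -[_ == 0]negbK Ev //; apply/negP => /andP[ib]; apply/negP.
  by apply: H; rewrite mem_iota.
rewrite -(first_sum HF).
by apply: eq_bigr.
Qed.

Lemma eval_no_exposed M (m : store) : frozen m -> rep_fun m MATE M ->
  (eval N m (ESum VX e_exposed) == 0) = [forall i, pr i ==> (M i != i)].
Proof.
move=> Hf HM; rewrite -[eval _ _ _]/(\sum_(0 <= x < N) eval N (wr m VX 0 x) e_exposed).
rewrite big_mkord sum_nat_eq0; apply: eq_forallb => i /=.
rewrite -[_ == 0]negbK (@eval_exposed M _ i) //; [|by move=> a j a6; rewrite wr_neq ?Hf // /VX; lia].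
by rewrite exposed_at_ord negb_and implybE.
Qed.

Lemma match_prog_ok (m : store) : frozen m ->
  (exec N match_prog m RES 0 != 0) <->
  exists f : 'I_N -> 'I_N, forall v, pr v -> g v (f v) /\ f (f v) = v.
Proof.
move=> Hf; rewrite /match_prog !exec_seq.
set s1 := exec N (CFor VI _) m.
have [|||R1 _ R3] := @exec_table N VI MATE (var VI) (var VI) id id m.
- by [].
- by [].
- by move=> m' i iN Hm' Hi; rewrite /= Hi.
have M1 : rep_fun s1 MATE id by move=> i; apply: R1.
have Hf1 : frozen s1 by apply: frozen_exec.
pose perfect (M : 'I_N -> 'I_N) := [forall i, pr i ==> (M i != i)].
(* Unless one of the first two cases holds, a phase lowers the number of exposed vertices, which is
   at most [N] at the start; so [N] phases suffice. *)
pose Q k (m' : store) := frozen m' /\ exists M, [/\ rep_fun m' MATE M, matching g M &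
  [\/ no_perfect, perfect M | #|exposed M| + k <= N]].
have perfectP M : matching g M -> perfect M ->
    exists f : 'I_N -> 'I_N, forall v, pr v -> g v (f v) /\ f (f v) = v.
  move=> [H1 H2] /forallP HP; exists M => v prv; split=> //.
  by apply: H2; have := HP v; rewrite prv.
set loop := CFor PH _; set s2 := exec N loop s1.
have [Hf2 [M [HM Mm Hcase]]] : Q N s2.
  apply: for_ind.
    split=> //; exists id; split; first exact: M1.
      by split=> // v; rewrite eqxx.
    by apply: Or33; have := max_card (mem (exposed (@id 'I_N))); rewrite card_ord addn0.
  move=> k m' kN [Hf' [M [HM Mm Hcase]]]; rewrite exec_seq.
  set m2 := exec N (set_var RT e_root) _.
  have Em2 : m2 = wr (wr m' PH 0 k) RT 0 (find (exposed_at M) (iota 0 N)).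
    rewrite /m2 /set_var exec_wr (@eval_root M) //.
    by move=> a i a6; rewrite wr_neq ?Hf' // /PH; lia.
  have E2 a i : a != PH -> a != RT -> m2 a i = m' a i by move=> aP aR; rewrite Em2 !wr_neq.
  have Hf2 : frozen m2.
    by apply: frozen_agree Hf' => a i a6; apply: E2; rewrite ?/PH ?/RT; lia.
  have M2 : rep_fun m2 MATE M by move=> i; rewrite E2.
  have [w Ew] : exists w, w = exec N phase m2 by eexists.
  rewrite exec_if eval_lt eval_var -[eval N m2 EN]/N -Ew -[exec N CSkip m2]/m2.
  have Hroot : m2 RT 0 = find (exposed_at M) (iota 0 N) by rewrite Em2; rd.
  rewrite Hroot; case: ifP => Hlt.
    have Hhas : has (exposed_at M) (iota 0 N) by rewrite has_find size_iota.
    pose r := Ordinal Hlt.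
    have : exposed_at M r.
      by have := nth_find 0 Hhas; rewrite nth_iota // add0n.
    rewrite exposed_at_ord => /andP[prr /eqP Mr].
    have Hw : frozen w by rewrite Ew; apply: frozen_exec.
    have := phase_ok Hf2 Mm Mr prr M2 Hroot; rewrite -Ew /=.
    case=> [[_ [M' [HM' Mm' Hlt']]]|[HMw Hno]]; split=> //.
      exists M'; split=> //; case: Hcase => [H|H|H]; [exact: Or31| |apply: Or33; lia].
      by move/forallP/(_ r): H; rewrite prr Mr eqxx.
    by exists M; split=> //; apply: Or31.
  split=> //; exists M; split=> //; apply: Or32; apply/forallP => i; apply/implyP => pri.
  have : ~~ has (exposed_at M) (iota 0 N) by rewrite has_find size_iota Hlt.
  by move/hasPn/(_ i); rewrite mem_iota /= => /(_ (ltn_ord i)); rewrite exposed_at_ord pri.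
have -> : exec N (set_var RES (EIf (ESum VX e_exposed) (ECst 0) (ECst 1))) s2 RES 0
   = if perfect M then 1 else 0.
  rewrite /set_var exec_wr wr_eq -[eval _ _ _]/(if eval N s2 (ESum VX e_exposed) == 0 then 1 else 0).
  by rewrite (eval_no_exposed Hf2 HM).
case: ifP => HP; first by split=> // _; apply: perfectP HP.
split=> // -[f Hff].
case: Hcase => [Hno|Hp|Hc].
- by case: Hno; exists f.
- by rewrite Hp in HP.
case/negP: (negbT HP); apply/forallP => i; apply/implyP => _; apply/negP => Mi.
have : 0 < #|exposed M| by apply/card_gt0P; exists i; rewrite inE.
by lia.
Qed.

End Program.

(** * The decision program *)

Section PartialMatching.
Variables (S T : finType) (e : rel S) (g : rel T) (P : {set S}) (pr : pred T) (enc : S -> T).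
Hypothesis enc_inj : injective enc.
Hypothesis enc_pr : forall a, a \in P -> pr (enc a).
Hypothesis pr_enc : forall x, pr x -> exists2 a, a \in P & enc a = x.
Hypothesis enc_adj : forall a b, a \in P -> b \in P -> g (enc a) (enc b) = e a b.
Hypothesis g_pr : forall x y, g x y -> pr y.

(** It relates the graph on all numbers below [N], where only codes of vertices are present, to the
    graph of the reduction. *)
Lemma perfect_matching_transfer :
  (exists f : T -> T, forall x, pr x -> g x (f x) /\ f (f x) = x) <-> perfectly_matched e P.
Proof.
split=> [[f Hf]|[f Hf]].
  have H a : a \in P -> exists b, [/\ b \in P, enc b = f (enc a) & e a b].
    move=> aP; have [gf _] := Hf _ (enc_pr aP).
    have [b bP Eb] := pr_enc (g_pr gf); exists b; split=> //.
    by rewrite -(enc_adj aP bP) Eb.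
  exists (fun a => odflt a [pick b in P | enc b == f (enc a)]) => a aP.
  have pickE a' b : b \in P -> enc b = f (enc a') ->
      odflt a' [pick b in P | enc b == f (enc a')] = b.
    move=> bP Eb; case: pickP => [b' /andP[_ /eqP E]|/(_ b)].
      by apply: enc_inj; rewrite E Eb.
    by rewrite bP Eb eqxx.
  have [b [bP Eb eab]] := H a aP; rewrite (pickE a b) //; split=> //.
  by apply: pickE => //; rewrite Eb; case: (Hf _ (enc_pr aP)).
exists (fun x => if [pick a in P | enc a == x] is Some a then enc (f a) else x) => x prx.
have pickE a : a \in P -> [pick a' in P | enc a' == enc a] = Some a.
  move=> aP; case: pickP => [b' /andP[_ /eqP/enc_inj ->] //|/(_ a)].
  by rewrite aP eqxx.
have [a aP <-] := pr_enc prx; have [fP ef ff] := Hf a aP.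
by rewrite pickE // pickE // ff enc_adj.
Qed.

End PartialMatching.

(** * Computing the graph from the input *)

Definition e_count (x : nat) (b : expr) : expr := ESum x (EIf b (ECst 1) (ECst 0)).

Lemma eval_count N m x b (q : pred nat) : (forall i, i < N -> (eval N (wr m x 0 i) b != 0) = q i) ->
  eval N m (e_count x b) = count q (iota 0 N).
Proof.
move=> Hq; rewrite /= -sum1_count [RHS]big_mkcond /= /index_iota subn0.
apply: eq_big_seq => i; rewrite mem_iota add0n => /= iN.
by rewrite -Hq //; case: eqP.
Qed.

Lemma count_ord n N (q : pred nat) (r : pred 'I_n) : n <= N ->
  (forall i, i < N -> n <= i -> ~~ q i) -> (forall i : 'I_n, q i = r i) ->
  count q (iota 0 N) = #|[set i | r i]|.
Proof.
move=> nN Hq Hr; rewrite -{1}(subnKC nN) iotaD count_cat add0n.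
rewrite [X in _ + X](_ : _ = 0) ?addn0; last first.
  apply/eqP; rewrite -leqn0 leqNgt -has_count; apply/hasPn => i.
  by rewrite mem_iota => Hi; apply: Hq; lia.
rewrite -val_enum_ord count_map cardsE cardE size_filter -enumT.
by apply: eq_count => i; rewrite /= Hr.
Qed.

(* The input [IN] and its length [LEN], the partners [PT], the tables [EL] and [SP] of
   [eligible] and [spare], the number [DL] of dummies, the parsing position [PTR] and the
   failure flag [BAD].  The cell [i + 1] of [IN] contains the number [i] of the input for
   [i >= 4]; the numbers [1], [2] and [3] are in the cells after [LEN] (see [loaded]). *)
Definition IN := 0.
Definition LEN := 1.
Definition PT := 2.
Definition EL := 3.
Definition SP := 4.
Definition DL := 5.
Definition PTR := 25.
Definition BAD := 27.

Definition e_n : expr := ERd IN (EAdd (var LEN) (ECst 1)).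
Definition e_pref : expr := ERd IN (EAdd (var LEN) (ECst 2)).
Definition e_bud : expr := ERd IN (EAdd (var LEN) (ECst 3)).
(** The favorites come after four numbers, and the cells of [IN] are shifted by one. *)
Definition e_fav (e : expr) : expr := ERd IN (EAdd e (ECst 5)).
Definition e_ge (a b : expr) : expr := e_not (e_lt a b).

Lemma eval_neq N m a b : (eval N m (e_not (e_eq a b)) != 0) = (eval N m a != eval N m b).
Proof. by rewrite eval_not eval_eq. Qed.

Lemma eval_ge N m a b : (eval N m (e_ge a b) != 0) = (eval N m b <= eval N m a).
Proof. by rewrite eval_not eval_lt -leqNgt. Qed.

Definition e_total (c : expr) : expr :=
  e_count VX (e_and (e_lt (var VX) e_n) (e_eq (e_fav (var VX)) c)).
Definition e_excess (c : expr) : expr := ESub (e_total c) (e_total e_pref).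

(** [PTR] is the cell with the size of the bundle of [VI]; the members of the bundle follow it. *)
Definition parse_body : cmd :=
  CIf (e_lt (var VI) e_n)
    (CSeq (CIf (e_eq (ERd IN (var PTR)) (ECst 1))
             (CWr PT (var VI) (var VI))
             (CWr PT (var VI) (ESub (EAdd (ERd IN (EAdd (var PTR) (ECst 1)))
                                          (ERd IN (EAdd (var PTR) (ECst 2)))) (var VI))))
          (set_var PTR (EAdd (EAdd (var PTR) (ECst 1)) (ERd IN (var PTR)))))
    CSkip.

Definition parse_prog : cmd :=
  CSeq (set_var PTR (EAdd (ECst 5) e_n)) (CFor VI parse_body).

Definition e_eligible : expr :=
  e_and (e_lt (var VI) e_n)
    (e_and (e_not (e_eq (e_fav (var VI)) e_pref))
           (e_not (e_eq (e_fav (ERd PT (var VI))) e_pref))).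

Definition eligible_prog : cmd := CFor VI (CWr EL (var VI) e_eligible).

Definition e_above : expr :=
  e_count VX (e_and (ERd EL (var VX))
    (e_and (e_eq (e_fav (var VX)) (e_fav (var VI))) (e_ge (var VX) (var VI)))).

Definition spare_prog : cmd :=
  CFor VI (CWr SP (var VI)
    (e_and (ERd EL (var VI)) (e_lt (e_excess (e_fav (var VI))) e_above))).

Definition e_required : expr :=
  e_count VX (e_and (ERd EL (var VX)) (e_not (ERd SP (var VX)))).
(* [k - (k - n)] is [minn k n], by truncated subtraction. *)
Definition e_minkn : expr := ESub e_bud (ESub e_bud e_n).
Definition e_budget2 : expr := EAdd e_minkn e_minkn.

Definition dummy_prog : cmd := set_var DL (ESub e_budget2 e_required).

Definition e_infeasible : expr :=
  e_count VI (e_and (e_lt (var VI) e_n)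
    (e_lt (e_count VX (e_and (ERd EL (var VX)) (e_eq (e_fav (var VX)) (e_fav (var VI)))))
          (e_excess (e_fav (var VI))))).

Definition bad_prog : cmd :=
  set_var BAD (e_or e_infeasible (e_lt e_budget2 e_required)).

Definition e_2n : expr := EAdd e_n e_n.
(** The codes of voters start at [0], those of slack vertices at [n] and those of dummies at [2 n],
    as in [vertex_code]. *)
Definition e_dummy (a : nat) : expr :=
  e_and (e_ge (var a) e_2n) (e_lt (var a) (EAdd e_2n (var DL))).
(** The first test keeps truncated subtraction from reading the code of a voter as the slack vertex
    of voter [0]. *)
Definition e_spare (a : nat) : expr :=
  e_and (e_ge (var a) e_n) (ERd SP (ESub (var a) e_n)).

Definition e_half (a b : nat) : expr :=
  e_or (e_and (ERd EL (var a))
         (e_or (e_and (ERd EL (var b))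
                  (e_and (e_eq (ERd PT (var a)) (var b)) (e_not (e_eq (var a) (var b)))))
           (e_or (e_and (e_spare b) (e_eq (e_fav (var a)) (e_fav (ESub (var b) e_n))))
                 (e_dummy b))))
    (e_and (e_dummy a) (e_and (e_dummy b) (e_not (e_eq (var a) (var b))))).

Lemma eval_halfE N m a b : (eval N m (e_half a b) != 0) =
  (eval N m (ERd EL (var a)) != 0) &&
     [|| (eval N m (ERd EL (var b)) != 0) && ((eval N m (ERd PT (var a)) == m b 0) && (m a 0 != m b 0)),
         (eval N m (e_spare b) != 0) &&
           (eval N m (e_fav (var a)) == eval N m (e_fav (ESub (var b) e_n)))
       | eval N m (e_dummy b) != 0]
  || [&& eval N m (e_dummy a) != 0, eval N m (e_dummy b) != 0 & m a 0 != m b 0].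
Proof.
rewrite /e_half; move: (e_spare b) (e_dummy a) (e_dummy b) => s d d'.
by rewrite !eval_or !eval_and !eval_or !eval_and !eval_neq !eval_eq.
Qed.

Definition e_adj : expr := e_or (e_half VX VY) (e_half VY VX).
Definition e_pres : expr := e_or (ERd EL (var VX)) (e_or (e_spare VX) (e_dummy VX)).

Definition main_prog : cmd :=
  CSeq parse_prog (CSeq eligible_prog (CSeq spare_prog (CSeq dummy_prog (CSeq bad_prog
  (CSeq (match_prog e_adj e_pres) (CIf (var BAD) (set_var RES (ECst 0)) CSkip)))))).

Lemma main_prog_height : (cheight main_prog).+1 <= ntmp.
Proof. by []. Qed.

Lemma main_prog_arrays : carr main_prog.
Proof. by []. Qed.

Section Data.
Variables (n : nat) (F : 'I_n -> nat) (pt : 'I_n -> 'I_n) (p k N : nat).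
Hypothesis ptK : involutive pt.
Hypothesis N_big : 4 * n <= N.

Local Notation eligible := (eligible F pt p).
Local Notation excess := (excess F p).
Local Notation spare := (spare F pt p).
Local Notation required := (required F pt p).
Local Notation ndummy := (ndummy F pt p k).
Local Notation budget2 := (budget2 n k).

Definition holds_input (m : store) : Prop :=
  [/\ eval N m e_n = n, eval N m e_pref = p, eval N m e_bud = k
    & forall u : 'I_n, m IN (u + 5) = F u].

Lemma holds_input_agree (m m' : store) : (forall a i, a < 2 -> m' a i = m a i) ->
  holds_input m -> holds_input m'.
Proof.
move=> E [H1 H2 H3 H4]; split; last by move=> u; rewrite E.
- by rewrite -H1 /= !E.
- by rewrite -H2 /= !E.
- by rewrite -H3 /= !E.
Qed.

Definition lift_pred (q : pred 'I_n) (i : nat) : bool :=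
  if insub i is Some u then q u else false.

Lemma lift_ord q (u : 'I_n) : lift_pred q u = q u.
Proof. by rewrite /lift_pred valK. Qed.

Lemma lift_ge q i : n <= i -> lift_pred q i = false.
Proof. by move=> ni; rewrite /lift_pred insubF // ltnNge ni. Qed.

Lemma eval_count_lift m x b (r : pred 'I_n) :
  (forall i, i < N -> n <= i -> (eval N (wr m x 0 i) b != 0) = false) ->
  (forall u : 'I_n, (eval N (wr m x 0 u) b != 0) = r u) ->
  eval N m (e_count x b) = #|[set u | r u]|.
Proof.
move=> Hge Hord; have nN : n <= N by lia.
rewrite (eval_count (q := lift_pred r)) => [|i iN].
  by apply: count_ord => // [i _ ni|u]; [rewrite lift_ge|exact: lift_ord].
case: (ltnP i n) => [lt_in|ni]; last by rewrite Hge ?lift_ge.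
by rewrite -[i]/(val (Ordinal lt_in)) Hord lift_ord.
Qed.

Lemma wr_input m a i v : 1 < a -> holds_input m -> holds_input (wr m a i v).
Proof. by move=> a1; apply: holds_input_agree => b j b2; rewrite wr_neq //; lia. Qed.

Lemma eval_fav m e (u : 'I_n) : holds_input m -> eval N m e = u -> eval N m (e_fav e) = F u.
Proof. by case=> _ _ _ H Hu; rewrite /= Hu H. Qed.

Lemma eval_total m c d : holds_input m ->
  (forall i, eval N (wr m VX 0 i) c = d) -> eval N m (e_total c) = supporters F d.
Proof.
move=> Hm Hc; rewrite (@eval_count_lift m VX _ (fun u => F u == d)).
- by rewrite /supporters /color_card; apply: eq_card => u; rewrite !inE.
- move=> i iN ni; rewrite eval_and eval_lt eval_var wr_eq.
  by have [-> _ _ _] := wr_input (a := VX) 0 i isT Hm; rewrite ltnNge ni.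
- move=> u; have Hm' := wr_input (a := VX) 0 u isT Hm.
  rewrite eval_and eval_lt eval_eq Hc (@eval_fav _ _ u) // eval_var; rd.
  by have [-> _ _ _] := Hm'; rewrite ltn_ord.
Qed.

Lemma eval_excess m c d : holds_input m ->
  (forall i, eval N (wr m VX 0 i) c = d) -> eval N m (e_excess c) = excess d.
Proof.
move=> Hm Hc; rewrite -[LHS]/(eval N m (e_total c) - eval N m (e_total e_pref)).
rewrite (eval_total Hm Hc) (@eval_total m _ p) // => i.
by have [_ -> _ _] := wr_input (a := VX) 0 i isT Hm.
Qed.

Definition holds_partner (m : store) : Prop := forall u : 'I_n, m PT u = pt u.
(** The cells from [n] to [N] must be 0, so that [EL] can be read at the code of any vertex without
    testing that it is a voter. *)
Definition holds_eligible (m : store) : Prop :=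
  forall i, i < N -> (m EL i != 0) = lift_pred (mem eligible) i.
Definition holds_spare (m : store) : Prop :=
  forall i, i < N -> (m SP i != 0) = lift_pred (mem spare) i.

Lemma lt_ord_N (u : 'I_n) : u < N.
Proof. by have := ltn_ord u; lia. Qed.

Lemma eligible_prog_ok m : holds_input m -> holds_partner m ->
  holds_eligible (exec N eligible_prog m).
Proof.
move=> Hm Hp.
pose fv i := eval N (wr m VI 0 i) e_eligible.
have [|||H1 _ _] := @exec_table N VI EL (var VI) e_eligible id fv m.
- by [].
- by [].
- move=> m' i iN Hm' Hi; split; first by [].
  by rewrite /fv /= /wr /= Hi !Hm'.
move=> i iN; have -> : exec N eligible_prog m EL i = fv i by exact: H1.
have Hm' := wr_input (a := VI) 0 i isT Hm.
rewrite /fv !eval_and eval_lt !eval_neq eval_var wr_eq.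
have [-> -> _ _] := Hm'; case: (ltnP i n) => [lt_in|ni]; last by rewrite lift_ge.
pose u := Ordinal lt_in; rewrite (@eval_fav _ _ u) //.
rewrite (@eval_fav _ _ (pt u)) //; last by rewrite /= wr_eq wr_neq // -[i]/(val u) Hp.
by rewrite -[i]/(val u) lift_ord /= inE.
Qed.

Lemma eval_above m (u : 'I_n) : holds_input m -> holds_eligible m -> m VI 0 = u ->
  eval N m e_above =
  #|[set w in eligible | (F w == F u) && (u <= w)]|.
Proof.
move=> Hm He Hu; apply: eval_count_lift => [i iN ni|w].
  rewrite eval_and [eval _ _ (ERd _ _)]/= wr_eq wr_neq // He // lift_ge //.
have Hm' := wr_input (a := VX) 0 w isT Hm.
rewrite !eval_and eval_eq eval_ge [eval _ _ (ERd EL _)]/= !eval_var; rd.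
rewrite He ?lt_ord_N // lift_ord Hu (@eval_fav _ _ w) // (@eval_fav _ _ u) //.
Qed.

Lemma spare_prog_ok m : holds_input m -> holds_eligible m ->
  holds_spare (exec N spare_prog m).
Proof.
move=> Hm He.
pose Q j (m' : store) := (forall b i, b != SP -> b != VI -> m' b i = m b i) /\
  forall i, i < j -> (m' SP i != 0) = lift_pred (mem spare) i.
have [] : Q N (exec N spare_prog m); last by [].
apply: for_ind; first by [].
move=> j m' jN [E Hs]; set m1 := wr m' VI 0 j.
have E1 b i : b != SP -> b != VI -> m1 b i = m b i by move=> bS bV; rewrite /m1 wr_neq ?E.
have Hm1 : holds_input m1.
  by apply: holds_input_agree Hm => b i b2; rewrite E1 // /SP /VI; lia.
have He1 : holds_eligible m1 by move=> i iN; rewrite E1 // He.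
have Vj : m1 VI 0 = j by rewrite /m1 wr_eq.
rewrite exec_wr eval_var Vj; split=> [b i bS bV|i]; first by rewrite wr_neq ?E1.
rewrite ltnS leq_eqVlt; case: (eqVneq i j) => [-> _|ij /= Hi]; last first.
  by rewrite wrE (negbTE ij) /m1 wr_neq // Hs.
rewrite wr_eq eval_and [eval _ _ (ERd _ _)]/= Vj He1 //.
case: (ltnP j n) => [lt_jn|nj]; last by rewrite !lift_ge.
pose u := Ordinal lt_jn; have Hu : m1 VI 0 = u by rewrite Vj.
rewrite eval_lt (eval_above Hm1 He1 Hu) (@eval_excess m1 _ (F u)) //; last first.
  by move=> i'; apply: eval_fav; [exact: wr_input|rewrite eval_var wr_neq].
by rewrite -[j]/(val u) !lift_ord /= [u \in spare]inE.
Qed.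

Lemma eval_required m : holds_eligible m -> holds_spare m -> eval N m e_required = #|required|.
Proof.
move=> He Hs; rewrite (@eval_count_lift m VX _ (fun u => (u \in eligible) && (u \notin spare))).
- apply: eq_card => u; rewrite !inE.
  by case: (F u != p) => //=; case: (F (pt u) != p) => //=; rewrite -leqNgt.
- move=> i iN ni; rewrite eval_and [eval _ _ (ERd _ _)]/=; rd.
  by rewrite He // lift_ge.
- move=> u; rewrite eval_and eval_not ![eval _ _ (ERd _ _)]/=; rd.
  by rewrite He ?Hs ?lt_ord_N // !lift_ord.
Qed.

Lemma eval_budget2 m : holds_input m -> eval N m e_budget2 = budget2.
Proof.
move=> [H1 _ H3 _]; rewrite /budget2 -[LHS]/(eval N m e_minkn + eval N m e_minkn).
have -> : eval N m e_minkn = minn k n.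
  by rewrite -[LHS]/(eval N m e_bud - (eval N m e_bud - eval N m e_n)) H1 H3; lia.
by rewrite addnn.
Qed.

Lemma eval_infeasible m : holds_input m -> holds_eligible m ->
  (eval N m e_infeasible == 0) <-> feasible F pt p.
Proof.
move=> Hm He.
rewrite (@eval_count_lift m VI _ (fun u => color_card F eligible (F u) < excess (F u))).
- rewrite cards_eq0; split=> [/eqP/setP H u|H].
    by have := H u; rewrite !inE => /negbT; rewrite -leqNgt.
  by apply/eqP/setP=> u; rewrite !inE; apply/negbTE; rewrite -leqNgt; apply: H.
- move=> i iN ni; rewrite eval_and eval_lt eval_var wr_eq.
  by have [-> _ _ _] := wr_input (a := VI) 0 i isT Hm; rewrite ltnNge ni.
- move=> u; have Hm' := wr_input (a := VI) 0 u isT Hm.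
  rewrite eval_and !eval_lt eval_var wr_eq; have [-> _ _ _] := Hm'; rewrite ltn_ord andTb.
  rewrite (@eval_excess _ _ (F u)) //; last first.
    by move=> i; apply: eval_fav => //; apply: wr_input.
  congr (_ < _); apply: eval_count_lift => [i iN ni|w].
    rewrite eval_and [eval _ _ (ERd _ _)]/=; rd.
    by rewrite He // lift_ge.
  have Hm2 := wr_input (a := VX) 0 w isT Hm'.
  rewrite eval_and eval_eq [eval _ _ (ERd EL _)]/=; rd.
  rewrite He ?lt_ord_N // lift_ord.
  by rewrite (@eval_fav _ _ w) // (@eval_fav _ _ u).
Qed.

Lemma bad_prog_ok m : holds_input m -> holds_eligible m -> holds_spare m ->
  exec N bad_prog m BAD 0 = 0 <-> feasible F pt p /\ #|required| <= budget2.
Proof.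
move=> Hm He Hs; rewrite /bad_prog /set_var exec_wr wr_eq.
rewrite (rwP eqP) -[_ == 0]negbK eval_or eval_lt eval_required // eval_budget2 //.
rewrite negb_or negbK -leqNgt -(rwP andP).
by rewrite -(eval_infeasible Hm He).
Qed.

Lemma dummy_prog_ok m : holds_input m -> holds_eligible m -> holds_spare m ->
  exec N dummy_prog m DL 0 = ndummy.
Proof.
move=> Hm He Hs; rewrite /dummy_prog /set_var exec_wr wr_eq -[LHS]/(eval N m e_budget2 - eval N m e_required).
by rewrite eval_required // eval_budget2.
Qed.

Lemma ndummy_le : ndummy <= 2 * n.
Proof. by rewrite /ndummy /budget2; have := geq_minr k n; lia. Qed.

Definition vertex_code (a : vertex F pt p k) : nat :=
  match a with inl (inl u) => u | inl (inr u) => n + u | inr i => n + n + i end.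

Lemma vertex_code_lt a : vertex_code a < N.
Proof.
have := ndummy_le; case: a => [[u|u]|i] /=; [have := ltn_ord u|have := ltn_ord u|have := ltn_ord i];
  by rewrite -/ndummy; lia.
Qed.

Lemma vertex_code_inj : injective vertex_code.
Proof.
move=> [[u|u]|i] [[v|v]|j] /= E;
  try (by congr (inl (inl _)); apply: val_inj); try (by exfalso; have := ltn_ord u; have := ltn_ord v; lia);
  try (by exfalso; have := ltn_ord u; lia); try (by exfalso; have := ltn_ord v; lia).
- by congr (inl (inr _)); apply: val_inj; move/eqP: E; rewrite eqn_add2l => /eqP.
- by congr inr; apply: val_inj; move/eqP: E; rewrite eqn_add2l => /eqP.
Qed.

Definition vertex_of (a : vertex F pt p k) : 'I_N := Ordinal (vertex_code_lt a).

Definition graph_ready (m : store) : Prop :=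
  [/\ holds_input m, holds_partner m, holds_eligible m, holds_spare m & m DL 0 = ndummy].

Definition no_vertex (i : nat) : Prop :=
  [/\ n <= i, n <= i - n & (n + n <= i) && (i < n + n + ndummy) = false].

Lemma vertex_codeP i : i < N ->
  (exists a, vertex_code a = i) \/ no_vertex i.
Proof.
move=> iN; case: (ltnP i n) => [lt_in|ni]; first by left; exists (inl (inl (Ordinal lt_in))).
case: (ltnP (i - n) n) => [lt_in|nin].
  by left; exists (inl (inr (Ordinal lt_in))); rewrite /= subnKC.
have [/andP[H1 H2]|/negbTE out] := boolP ((n + n <= i) && (i < n + n + ndummy)); last by right.
have lt_i : i - (n + n) < ndummy by lia.
by left; exists (inr (Ordinal lt_i)) => /=; rewrite subnKC.
Qed.

Definition is_voter (q : pred 'I_n) (a : vertex F pt p k) : bool :=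
  if a is inl (inl u) then q u else false.
Definition is_slack (q : pred 'I_n) (a : vertex F pt p k) : bool :=
  if a is inl (inr u) then q u else false.
Definition is_dummy (a : vertex F pt p k) : bool := if a is inr _ then true else false.

Lemma eval_el m x a : graph_ready m -> m x 0 = vertex_code a ->
  (eval N m (ERd EL (var x)) != 0) = is_voter (mem eligible) a.
Proof.
move=> [_ _ He _ _] Hx; rewrite [eval _ _ _]/= Hx He ?vertex_code_lt //.
by case: a {Hx} => [[u|u]|i] /=; rewrite ?lift_ord // lift_ge //; lia.
Qed.

Lemma eval_sp m x a : graph_ready m -> m x 0 = vertex_code a ->
  (eval N m (e_spare x) != 0) = is_slack (mem spare) a.
Proof.
move=> [[Hn _ _ _] _ _ Hs _] Hx; rewrite eval_and eval_ge Hn eval_var Hx.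
have -> : eval N m (ERd SP (ESub (var x) e_n)) = m SP (vertex_code a - n).
  by rewrite -[LHS]/(m SP (eval N m (var x) - eval N m e_n)) Hn eval_var Hx.
rewrite Hs; last by apply: leq_ltn_trans (leq_subr _ _) (vertex_code_lt a).
case: a {Hx} => [[u|u]|i] /=.
- by rewrite leqNgt ltn_ord.
- by rewrite leq_addr addKn lift_ord.
- by rewrite lift_ge ?andbF // -addnA addKn leq_addr.
Qed.

Lemma eval_dm m x a : graph_ready m -> m x 0 = vertex_code a ->
  (eval N m (e_dummy x) != 0) = is_dummy a.
Proof.
move=> [[Hn _ _ _] _ _ _ Hd] Hx; rewrite eval_and eval_ge eval_lt eval_var Hx.
have -> : eval N m e_2n = n + n by rewrite -[LHS]/(eval N m e_n + eval N m e_n) Hn.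
have -> : eval N m (EAdd e_2n (var DL)) = n + n + ndummy.
  by rewrite -[LHS]/(eval N m e_n + eval N m e_n + m DL 0) Hn Hd.
case: a {Hx} => [[u|u]|i] /=.
- by have := ltn_ord u; lia.
- by have := ltn_ord u; lia.
- by rewrite leq_addr ltn_add2l ltn_ord.
Qed.

Lemma eval_half m x y a b : graph_ready m -> m x 0 = vertex_code a -> m y 0 = vertex_code b ->
  (eval N m (e_half x y) != 0) = half_adj a b.
Proof.
move=> Hm Hx Hy; have [Hin Hp _ _ _] := Hm; have [Hn _ _ _] := Hin.
rewrite eval_halfE (eval_el Hm Hx) (eval_el Hm Hy) (eval_sp Hm Hy)
  (eval_dm Hm Hx) (eval_dm Hm Hy) Hx Hy.
case: a b Hx Hy => [[u|u]|i] [[v|v]|j] //= Hx Hy; rewrite ?andbF ?orbF ?andbT //=.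
- by rewrite Hx Hp val_eqE val_eqE.
- have -> : m IN (m x 0 + 5) = F u by rewrite Hx; case: Hin.
  have -> : m IN (m y 0 - m IN (m LEN 0 + 1) + 5) = F v.
    rewrite -[m IN (m LEN 0 + 1)]/(eval N m e_n) Hn Hy addKn; by case: Hin.
  by [].
- by rewrite eqn_add2l val_eqE.
Qed.

Lemma eval_adj m (a b : vertex F pt p k) : graph_ready m -> m VX 0 = vertex_code a ->
  m VY 0 = vertex_code b -> (eval N m e_adj != 0) = adj a b.
Proof. by move=> Hm Ha Hb; rewrite eval_or (eval_half Hm Ha Hb) (eval_half Hm Hb Ha). Qed.

Lemma eval_pres m (a : vertex F pt p k) : graph_ready m -> m VX 0 = vertex_code a ->
  (eval N m e_pres != 0) = (a \in present F pt p k).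
Proof.
move=> Hm Ha; rewrite eval_or (eval_el Hm Ha) eval_or (eval_sp Hm Ha) (eval_dm Hm Ha) in_part.
by case: a {Ha} => [[u|u]|i] //=; rewrite ?orbF // inE.
Qed.

Lemma outside m x i : graph_ready m -> i < N -> m x 0 = i ->
  no_vertex i ->
  [/\ eval N m (ERd EL (var x)) = 0, eval N m (e_spare x) = 0 & eval N m (e_dummy x) = 0].
Proof.
move=> [[Hn _ _ _] _ He Hs Hd] iN Hx [H1 H2 H3].
split; apply/eqP; rewrite -[_ == 0]negbK.
- by rewrite [eval _ _ _]/= Hx He ?lift_ge.
- rewrite eval_and.
  have -> : eval N m (ERd SP (ESub (var x) e_n)) = m SP (i - n).
    by rewrite -[LHS]/(m SP (eval N m (var x) - eval N m e_n)) Hn eval_var Hx.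
  by rewrite Hs ?lift_ge ?andbF // (leq_ltn_trans (leq_subr _ _) iN).
- rewrite eval_and eval_ge eval_lt eval_var Hx.
  rewrite -[eval N m e_2n]/(eval N m e_n + eval N m e_n).
  rewrite -[eval N m (EAdd e_2n (var DL))]/(eval N m e_n + eval N m e_n + m DL 0).
  by rewrite Hn Hd H3.
Qed.

Lemma half_outside m x y i : graph_ready m -> i < N -> m x 0 = i \/ m y 0 = i ->
  no_vertex i ->
  eval N m (e_half x y) = 0.
Proof.
move=> Hm iN H Hi; apply/eqP; rewrite -[_ == 0]negbK eval_halfE.
by case: H => H; have [E1 E2 E3] := outside Hm iN H Hi; rewrite ?E1 ?E2 ?E3 !eqxx !(andFb, andbF, orbF).
Qed.

Lemma adj_irr : irreflexive (@adj n F pt p k).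
Proof. by move=> [[u|u]|i]; rewrite /adj /= ?eqxx ?andbF. Qed.

Lemma adj_present (a b : vertex F pt p k) : adj a b -> a \in present F pt p k.
Proof.
rewrite in_part; case: a b => [[u|u]|i] [[v|v]|j]; rewrite /adj /= ?in_setT ?orbF //.
- by case/orP => /and4P[].
- by case/and3P.
- by case/and3P.
Qed.

Lemma graph_ready_agree m m' : (forall a i, a < 6 -> m' a i = m a i) ->
  graph_ready m -> graph_ready m'.
Proof.
move=> E [H1 H2 H3 H4 H5]; split.
- by apply: holds_input_agree H1 => a i a2; apply: E; lia.
- by move=> u; rewrite E.
- by move=> i iN; rewrite E // H3.
- by move=> i iN; rewrite E // H4.
- by rewrite E.
Qed.

Lemma adj_outside m i : graph_ready m -> i < N -> m VX 0 = i \/ m VY 0 = i ->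
  no_vertex i ->
  eval N m e_adj = 0.
Proof.
move=> Hm iN H Hi; apply/eqP; rewrite -[_ == 0]negbK eval_or.
by rewrite (half_outside Hm iN H Hi) (half_outside Hm iN _ Hi) //; case: H; [right|left].
Qed.

Lemma match_prog_graph m : graph_ready m ->
  (exec N (match_prog e_adj e_pres) m RES 0 != 0) <->
  perfectly_matched (@adj n F pt p k) (present F pt p k).
Proof.
move=> Hm.
pose at2 (x y : nat) := wr (wr m VX 0 x) VY 0 y.
pose g (x y : 'I_N) := eval N (at2 x y) e_adj != 0.
pose pr (x : 'I_N) := eval N (wr m VX 0 x) e_pres != 0.
have Hready m' : frozen m m' -> graph_ready m' by move=> Hf; apply: graph_ready_agree Hm.
have Fr2 x y : frozen m (at2 x y) by move=> a i a6; rewrite /at2 !wr_neq // /VX /VY; lia.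
have Fr1 x : frozen m (wr m VX 0 x) by move=> a i a6; rewrite wr_neq // /VX; lia.
have at2X x y : at2 x y VX 0 = x by rewrite /at2; rd.
have at2Y x y : at2 x y VY 0 = y by rewrite /at2; rd.
have gE a b : g (vertex_of a) (vertex_of b) = adj a b.
  by apply: eval_adj; [exact: Hready|exact: at2X|exact: at2Y].
have gout (x y : 'I_N) : g x y -> exists a b, x = vertex_of a /\ y = vertex_of b.
  rewrite /g => Hg.
  have [[a Ea]|Hx] := vertex_codeP (ltn_ord x); last first.
    by rewrite (adj_outside (Hready _ (Fr2 x y)) (ltn_ord x) _ Hx) in Hg; last by left.
  have [[b Eb]|Hy] := vertex_codeP (ltn_ord y); last first.
    by rewrite (adj_outside (Hready _ (Fr2 x y)) (ltn_ord y) _ Hy) in Hg; last by right.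
  by exists a, b; split; apply: val_inj; rewrite /= ?Ea ?Eb.
have g_sym : symmetric g.
  move=> x y; apply/idP/idP => /[dup] H /gout[a [b [Ea Eb]]]; move: H;
    by rewrite Ea Eb !gE adj_sym.
have g_irr : irreflexive g.
  move=> x; apply/negbTE/negP => gxx; have [a [b [Ea _]]] := gout _ _ gxx.
  by rewrite Ea gE adj_irr in gxx.
have prE a : pr (vertex_of a) = (a \in present F pt p k).
  by apply: eval_pres; [exact: Hready|rewrite wr_eq].
have g_pr x y : g x y -> pr x.
  move=> /[dup] H /gout[a [b [Ea Eb]]]; move: H; rewrite Ea Eb gE prE.
  exact: adj_present.
have Hadj (m' : store) (x y : 'I_N) : frozen m m' -> m' VX 0 = x -> m' VY 0 = y ->
    (eval N m' e_adj != 0) = g x y.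
  move=> Hf Hx Hy; have Hm' := Hready _ Hf.
  have [[a Ea]|Hox] := vertex_codeP (ltn_ord x); last first.
    have -> : g x y = false.
      by rewrite /g (adj_outside (Hready _ (Fr2 x y)) (ltn_ord x) _ Hox) //; left.
    by rewrite (adj_outside Hm' (ltn_ord x) _ Hox) //; left.
  have [[b Eb]|Hoy] := vertex_codeP (ltn_ord y); last first.
    have -> : g x y = false.
      by rewrite /g (adj_outside (Hready _ (Fr2 x y)) (ltn_ord y) _ Hoy) //; right.
    by rewrite (adj_outside Hm' (ltn_ord y) _ Hoy) //; right.
  rewrite /g (eval_adj (a := a) (b := b) Hm') ?Hx ?Hy //.
  by rewrite (eval_adj (a := a) (b := b) (Hready _ (Fr2 x y))) ?at2X ?at2Y.
have Hpr0 (m' : store) (x : 'I_N) : frozen m m' -> m' VX 0 = x ->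
    no_vertex x -> eval N m' e_pres = 0.
  move=> Hf Hx Hox; apply/eqP; rewrite -[_ == 0]negbK eval_or.
  have [E1 E2 E3] := outside (Hready _ Hf) (ltn_ord x) Hx Hox.
  by rewrite E1 eval_or E2 E3.
have Hpr (m' : store) (x : 'I_N) : frozen m m' -> m' VX 0 = x ->
    (eval N m' e_pres != 0) = pr x.
  move=> Hf Hx.
  have [[a Ea]|Hox] := vertex_codeP (ltn_ord x); last first.
    by rewrite /pr (Hpr0 _ x Hf Hx Hox) (Hpr0 _ x (Fr1 x) _ Hox) // wr_eq.
  rewrite (eval_pres (a := a) (Hready _ Hf)) ?Hx // -prE.
  by congr pr; apply: val_inj.
rewrite (match_prog_ok g_sym g_irr g_pr Hadj Hpr) //.
apply: (perfect_matching_transfer (enc := vertex_of)) => [a b /(congr1 val) /vertex_code_inj //|a|x prx|a b _ _|x y].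
- by rewrite prE.
- have [[a Ea]|Hox] := vertex_codeP (ltn_ord x).
    have Ex : vertex_of a = x by apply: val_inj.
    by exists a => //; rewrite -prE Ex.
  by move: prx; rewrite /pr (Hpr0 _ x (Fr1 x) _ Hox) // wr_eq.
- exact: gE.
- by rewrite g_sym => /g_pr.
Qed.

Lemma main_prog_data m : holds_input m -> holds_partner (exec N parse_prog m) ->
  (exec N main_prog m RES 0 != 0) <->
  [/\ feasible F pt p, #|required| <= budget2
     & perfectly_matched (@adj n F pt p k) (present F pt p k)].
Proof.
move=> Hm Hp.
rewrite -[exec N main_prog m]/(exec N (CIf (var BAD) (set_var RES (ECst 0)) CSkip)
  (exec N (match_prog e_adj e_pres) (exec N bad_prog (exec N dummy_prog
  (exec N spare_prog (exec N eligible_prog (exec N parse_prog m))))))).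
set s1 := exec N parse_prog m in Hp *.
set s2 := exec N eligible_prog s1.
set s3 := exec N spare_prog s2.
set s4 := exec N dummy_prog s3.
set s5 := exec N bad_prog s4.
have input_frame c s : all (fun b => 1 < b) (cwrites c) -> holds_input s -> holds_input (exec N c s).
  move=> Hall; apply: holds_input_agree => a i a2; rewrite exec_frame //.
  by apply/negP => /(allP Hall); lia.
have I1 : holds_input s1 by apply: input_frame.
have I2 : holds_input s2 by apply: input_frame.
have I3 : holds_input s3 by apply: input_frame.
have I4 : holds_input s4 by apply: input_frame.
have I5 : holds_input s5 by apply: input_frame.
have E2 : holds_eligible s2 by apply: eligible_prog_ok.
have E3 : holds_eligible s3 by move=> i iN; rewrite /s3 exec_frame // E2.
have E4 : holds_eligible s4 by move=> i iN; rewrite /s4 exec_frame // E3.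
have S3 : holds_spare s3 by apply: spare_prog_ok.
have S4 : holds_spare s4 by move=> i iN; rewrite /s4 exec_frame // S3.
have D4 : s4 DL 0 = ndummy by apply: dummy_prog_ok.
have P5 : holds_partner s5 by move=> u; rewrite /s5 /s4 /s3 /s2 !exec_frame.
have E5 : holds_eligible s5 by move=> i iN; rewrite /s5 exec_frame // E4.
have S5 : holds_spare s5 by move=> i iN; rewrite /s5 exec_frame // S4.
have D5 : s5 DL 0 = ndummy by rewrite /s5 exec_frame.
have R5 : graph_ready s5 by [].
have Hbad := bad_prog_ok I4 E4 S4; rewrite -/s5 in Hbad.
have Hmatch := match_prog_graph R5.
set s6 := exec N (match_prog e_adj e_pres) s5 in Hmatch *.
have B6 : s6 BAD 0 = s5 BAD 0 by rewrite /s6 exec_frame.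
rewrite exec_if eval_var B6; case: (s5 BAD 0 =P 0) => HB; rewrite /=.
  rewrite Hmatch; have [H1 H2] := Hbad.1 HB; by split=> [?|[]].
by rewrite /wr /=; split=> // -[H1 H2 _]; case: HB; apply/Hbad.
Qed.

End Data.

Lemma nth_cat_r (T : Type) (x0 : T) s1 s2 i : nth x0 (s1 ++ s2) (size s1 + i) = nth x0 s2 i.
Proof. by rewrite nth_cat ltnNge leq_addr /= addKn. Qed.

(** * Instances as elections with paired voters, and their encoding *)

Section Instance.
Variable I : instance.
Hypothesis I_wf : wf_instance I.
Hypothesis I_sym : symmetric_bundling I.
Hypothesis I_le2 : bundles_le2 I.

Let n := nvot I.
Definition bundle (v : nat) : seq nat := nth [::] (kap I) v.
(* For a bundle [{v, w}] the sum of its elements minus [v] is [w]. *)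
Definition partner_nat (v : nat) : nat :=
  if size (bundle v) == 1 then v else nth 0 (bundle v) 0 + nth 0 (bundle v) 1 - v.

Lemma bundleE v : v < n ->
  partner_nat v < n /\ forall w, (w \in bundle v) = (w == v) || (w == partner_nat v).
Proof.
move=> vn; have [_ _ _ _ Hb] := I_wf; have [vb bn bu] := Hb v vn.
have := I_le2 vn; rewrite /partner_nat -/(bundle v) in vb bn bu *.
case: (bundle v) vb bn bu => [|a [|b [|c s]]] //=.
  rewrite inE => /eqP <- _ _ _; split=> // w; by rewrite inE orbb.
rewrite !inE !andbT => /orP[]/eqP E /andP[an bn] ab _; rewrite -E in an bn ab *; split.
- by rewrite addKn.
- by move=> w; rewrite !inE addKn.
- by rewrite addnK.
- by move=> w; rewrite !inE addnK orbC.
Qed.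

(** Symmetry puts [v] into the bundle of its partner, and the only other member of that bundle is
    the partner of the partner. *)
Lemma partner_natK v : v < n -> partner_nat (partner_nat v) = v.
Proof.
move=> vn; have [pn Hv] := bundleE vn; have [_ Hp] := bundleE pn.
case: (eqVneq (partner_nat v) v) => [E|ne]; first by rewrite !E.
have : v \in bundle (partner_nat v).
  by rewrite /bundle -(I_sym vn pn) 1?eq_sym // -/(bundle v) Hv eqxx orbT.
by rewrite Hp eq_sym (negbTE ne) /= => /eqP <-.
Qed.

Definition favorite (u : 'I_n) : nat := nth 0 (fav I) u.
Definition partner (u : 'I_n) : 'I_n := insubd u (partner_nat u).

Lemma val_partner u : val (partner u) = partner_nat u.
Proof. by rewrite val_insubd; have [-> _] := bundleE (ltn_ord u). Qed.

Lemma partnerK : involutive partner.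
Proof. by move=> u; apply: val_inj; rewrite !val_partner partner_natK. Qed.

Lemma favorite_lt u : favorite u < ncand I.
Proof.
have [sf _ /allP Hf _ _] := I_wf; apply: Hf; apply: mem_nth.
by rewrite sf.
Qed.

Lemma CConsDelE : CConsDel I <-> can_win (ncand I) favorite partner (pref I) (budget I).
Proof.
have E (V' : {set 'I_n}) : bundle_set I V' = deleted partner V'.
  apply/setP=> w; rewrite !inE; apply: eq_existsb => v; congr (_ && _).
  have [_ H] := bundleE (ltn_ord v).
  by rewrite -[nth _ _ _]/(bundle v) H -val_partner !val_eqE.
by split=> -[V' [H1 H2]]; exists V'; split=> // c cn; have := H2 c cn; rewrite E.
Qed.

Let x := encode I.
Definition blocks : seq (seq nat) := [seq size s :: s | s <- kap I].
Definition block_pos (v : nat) : nat := 4 + n + size (flatten (take v blocks)).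

Lemma size_encode : size x = 4 + n + size (flatten blocks).
Proof. by have [sf _ _ _ _] := I_wf; rewrite /x /encode !size_cat sf /= addnA. Qed.

Lemma block_nth v j : v < n -> j <= size (bundle v) ->
  block_pos v + j < size x /\ nth 0 x (block_pos v + j) = nth 0 (size (bundle v) :: bundle v) j.
Proof.
move=> vn jb; have [sf sk _ _ _] := I_wf.
have vb : v < size blocks by rewrite size_map sk.
have Eb : nth [::] blocks v = size (bundle v) :: bundle v by rewrite (nth_map [::]) ?sk.
have Ef : flatten blocks = flatten (take v blocks) ++
    ((size (bundle v) :: bundle v) ++ flatten (drop v.+1 blocks)).
  by rewrite -{1}(cat_take_drop v blocks) flatten_cat (drop_nth [::] vb) Eb.
split; first by rewrite size_encode Ef !size_cat /= /block_pos; lia.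
have -> : block_pos v + j = size [:: ncand I; n; pref I; budget I] +
    (size (fav I) + (size (flatten (take v blocks)) + j)).
  by rewrite /block_pos sf /= !addnA.
rewrite /x /encode !nth_cat_r -/blocks Ef nth_cat_r nth_cat ifT //.
Qed.

Lemma block_posS v : v < n -> block_pos v.+1 = block_pos v + 1 + size (bundle v).
Proof.
move=> vn; have [_ sk _ _ _] := I_wf.
have vb : v < size blocks by rewrite size_map sk.
rewrite /block_pos (take_nth [::] vb) -cats1 flatten_cat size_cat (nth_map [::]) ?sk //=.
by rewrite cats0 /= /bundle; lia.
Qed.

Section Loaded.
Variable m : store.
Hypothesis m_loaded : loaded x m.
Let N := 4 * size x.

Lemma loaded_cell i : 4 <= i < size x -> m IN i.+1 = nth 0 x i.
Proof. by move=> Hi; have [H _ _] := m_loaded; rewrite H //; lia. Qed.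

Lemma loaded_input : holds_input favorite (pref I) (budget I) N m.
Proof.
have [_ [H1 H2 H3] H4] := m_loaded.
split.
- by rewrite [LHS]/= [m LEN 0]H4 addn1 H1.
- by rewrite [LHS]/= [m LEN 0]H4 addn2 H2.
- by rewrite [LHS]/= [m LEN 0]H4 addn3 H3.
- move=> u; have un := ltn_ord u; rewrite addnS loaded_cell; last by rewrite size_encode; lia.
  have [sf _ _ _ _] := I_wf.
  have -> : u + 4 = size [:: ncand I; n; pref I; budget I] + u by rewrite /= addnC.
  by rewrite /x /encode nth_cat_r nth_cat sf ifT.
Qed.

Lemma parse_ok : holds_partner partner (exec N parse_prog m).
Proof.
have nN : n <= N by rewrite /N size_encode; lia.
rewrite /parse_prog exec_seq; set m0 := exec N (set_var PTR _) m.
have E0 : m0 = wr m PTR 0 (5 + n).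
  by have [H _ _ _] := loaded_input; rewrite /m0 /set_var exec_wr -[in RHS]H.
(* The loop runs past the [n] voters; from then on the position stays behind the last block, whence
   the minimum. *)
pose Q j (m' : store) := [/\ forall a i, a \notin [:: PT; PTR; VI] -> m' a i = m a i,
  m' PTR 0 = (block_pos (minn j n)).+1 & forall i, i < j -> i < n -> m' PT i = partner_nat i].
suff [_ _ H] : Q N (exec N (CFor VI parse_body) m0).
  by move=> u; rewrite H ?val_partner //; apply: leq_trans nN.
apply: for_ind.
  split=> // [a i|]; first by rewrite E0 !inE !negb_or => /and3P[_ aP _]; rewrite wr_neq.
  by rewrite E0 wr_eq min0n /block_pos take0 /=; lia.
move=> j m' jN [Hf Hptr Hpt]; set m1 := wr m' VI 0 j.
have Hf1 a i : a \notin [:: PT; PTR; VI] -> m1 a i = m a i.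
  by move=> aN; rewrite -Hf //; move: aN; rewrite !inE !negb_or => /and3P[_ _ aV]; rewrite /m1 wr_neq.
have V1 : m1 VI 0 = j by rewrite /m1 wr_eq.
have P1 : m1 PTR 0 = (block_pos (minn j n)).+1 by rewrite /m1 wr_neq.
have T1 i : m1 PT i = m' PT i by rewrite /m1 wr_neq.
have N1 : eval N m1 e_n = n.
  by have [H _ _ _] := loaded_input; rewrite -[RHS]H /= !Hf1.
rewrite /parse_body exec_if eval_lt eval_var V1 N1; case: ltnP => jn; last first.
  rewrite -[exec N CSkip m1]/m1; split=> //.
    by rewrite P1 (minn_idPr jn) (minn_idPr (leqW jn)).
  by move=> i ij i_n; rewrite T1 Hpt //; lia.
have Em : minn j n = j by lia.
rewrite Em in P1.
have Rd d : d <= size (bundle j) -> m1 IN ((block_pos j).+1 + d) = nth 0 (size (bundle j) :: bundle j) d.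
  move=> dj; have [H1 H2] := block_nth jn dj.
  rewrite Hf1 // addSn loaded_cell ?H2 // H1 andbT /block_pos; lia.
have R0 : m1 IN (block_pos j).+1 = size (bundle j) by have := Rd 0 (leq0n _); rewrite addn0.
have [pn Hb] := bundleE jn.
have sz : size (bundle j) = 1 \/ size (bundle j) = 2.
  have := I_le2 jn; rewrite -/(bundle j).
  have : j \in bundle j by rewrite Hb eqxx.
  by case: (bundle j) => [|a [|b [|c s]]] //=; auto.
rewrite exec_seq; set m2 := exec N (CIf _ _ _) m1.
have Em2 : m2 = wr m1 PT j (partner_nat j).
  rewrite /m2 exec_if eval_eq [eval _ _ (ERd IN (var PTR))]/= P1 R0 [eval _ _ (ECst 1)]/=.
  rewrite /partner_nat; case: eqP => Hs; first by rewrite exec_wr !eval_var V1.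
  have s2 : size (bundle j) = 2 by case: sz.
  rewrite exec_wr eval_var V1; congr (wr _ _ _ _).
  by rewrite [LHS]/= P1 V1 !Rd ?s2.
rewrite /set_var exec_wr; split=> [a i aN||i].
- rewrite wr_neq; last by move: aN; rewrite !inE !negb_or => /and3P[].
  rewrite Em2 wr_neq ?Hf1 //; by move: aN; rewrite !inE !negb_or => /and3P[].
- rewrite wr_eq Em2 [eval _ _ _]/=; rd; rewrite P1 R0 (_ : minn j.+1 n = j.+1); last by lia.
  by rewrite block_posS //; lia.
- rewrite ltnS leq_eqVlt => /orP[/eqP -> _|ij i_n]; first by rewrite wr_neq // Em2 wr_eq.
  by rewrite wr_neq // Em2 wrE; case: eqP => [-> //|_]; rewrite T1 Hpt.
Qed.

Lemma main_prog_instance : exec N main_prog m RES 0 != 0 <-> CConsDel I.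
Proof.
rewrite CConsDelE (can_winE (pref I) (budget I) favorite_lt partnerK).
apply: main_prog_data; [|exact: loaded_input|exact: parse_ok].
by rewrite /N size_encode; lia.
Qed.

End Loaded.
End Instance.

Theorem theorem3 :
  poly_time_decidable
    (fun I => [/\ wf_instance I, symmetric_bundling I & bundles_le2 I])
    CConsDel.
Proof.
apply: (poly_time_of_cmd main_prog_height main_prog_arrays (isT : RES < narr)).
move=> I m [I_wf I_sym I_le2] Hm; exact: main_prog_instance.
Qed.
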